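(* Let $n\ge 1$ and $N\ge 0$ be integers and let $a,b,c,d,e,q,x$ be nonzero complex parameters, generic so that no denominator below vanishes, satisfying the balancing condition $$bcdex^{n-1}=a^2q^{N+1}.$$ Then \begin{multline*} \sum_{\lambda\in\Lambda_{nN}}\prod_{i=1}^n \left(\frac{E(ax^{2(1-i)}q^{2\lambda_i})}{E(ax^{2(1-i)})}\,q^{\lambda_i}x^{2(i-1)\lambda_i}\right)\prod_{1\leq i<j\leq n}\left(\frac{E(x^{j-i}q^{\lambda_i-\lambda_j})}{E(x^{j-i})}\frac{E(ax^{2-i-j}q^{\lambda_i+\lambda_j})}{E(ax^{2-i-j})}\right.\\ \times\left.\frac{(ax^{3-i-j};q)_{\lambda_i+\lambda_j}(x^{j-i+1};q)_{\lambda_i-\lambda_j}}{(aqx^{1-i-j};q)_{\lambda_i+\lambda_j}(qx^{j-i-1};q)_{\lambda_i-\lambda_j}}\right) \frac{(ax^{1-n},b,c,d,e,q^{-N};q,x)_\lambda}{(qx^{n-1},aq/b,aq/c,aq/d,aq/e,aq^{N+1};q,x)_\lambda}\\ =\frac{(aq,aq/bc,aq/bd,aq/cd;q,x)_{N^n}}{(aq/b,aq/c,aq/d,aq/bcd;q,x)_{N^n}}, \end{multline*} where $N^n$ denotes the partition $(N,N,\dots,N)\in\Lambda_{nN}$.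
   Context: Fix a complex number $p$ with $|p|<1$ (the elliptic nome, suppressed from notation). For nonzero $y$ define $E(y)=\prod_{j=0}^\infty(1-yp^j)(1-p^{j+1}/y)$ and $E(y_1,\dots,y_m)=E(y_1)\cdots E(y_m)$. For a base $Q$ and integer $k\ge0$, $(y;Q)_k=\prod_{j=0}^{k-1}E(yQ^j)$; for $k<0$, $(y;Q)_k=1/(yQ^{k};Q)_{-k}$; and $(y_1,\dots,y_m;Q)_k=\prod_{s}(y_s;Q)_k$. For $\lambda\in\mathbb Z^n$ and bases $Q,X$, $(y;Q,X)_\lambda=\prod_{j=1}^n(yX^{1-j};Q)_{\lambda_j}$ and $(y_1,\dots,y_m;Q,X)_\lambda=\prod_s(y_s;Q,X)_\lambda$. The set $\Lambda_{nN}=\{\lambda\in\mathbb Z^n: N\ge\lambda_1\ge\lambda_2\ge\dots\ge\lambda_n\ge0\}$. *)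

(* Defs.v *)
From HB Require Import structures.
From mathcomp Require Import all_boot all_order all_algebra.
From mathcomp Require Import reals.
From mathcomp Require Export complex.
From Stdlib Require Import ClassicalEpsilon.
Set Implicit Arguments. Unset Strict Implicit. Unset Printing Implicit Defensive.
Import Order.TTheory GRing.Theory Num.Theory.
Local Open Scope ring_scope.

Section Elliptic.
Variable R : realType.
Local Notation C := R[i].

Definition cvgC (u : nat -> C) (L : C) : Prop :=
  forall eps : C, 0 < eps -> exists K : nat, forall k : nat, (K <= k)%N -> `|u k - L| < eps.

(* the limit of u (chosen by Hilbert's epsilon; it is THE limit when u converges) *)
Definition limC (u : nat -> C) : C := epsilon (inhabits 0) (cvgC u).

(* E(y) = prod_{j>=0} (1 - y p^j)(1 - p^(j+1)/y), the elliptic nome p explicit *)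
Definition Ell (p y : C) : C :=
  limC (fun k => \prod_(j < k) ((1 - y * p ^+ j) * (1 - p ^+ j.+1 / y))).

Definition epoch (p y Q : C) (k : int) : C :=
  match k with
  | Posz m => \prod_(j < m) Ell p (y * Q ^+ j)
  | Negz m => (\prod_(j < m.+1) Ell p (y * Q ^ k * Q ^+ j))^-1
  end.

(* (y;Q,X)_lambda = prod_{j=1}^n (y X^(1-j); Q)_{lambda_j};
   lambda is given 0-indexed: lambda i = lambda_{i+1}, i < n *)
Definition epochX (p y Q X : C) (n : nat) (lam : 'I_n -> int) : C :=
  \prod_(i < n) epoch p (y * X ^- i) Q (lam i).

Definition epochXs (p : C) (ys : seq C) (Q X : C) (n : nat) (lam : 'I_n -> int) : C :=
  \prod_(y <- ys) epochX p y Q X lam.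

Definition inLambda (n N : nat) (lam : {ffun 'I_n -> 'I_N.+1}) : bool :=
  [forall i : 'I_n, forall j : 'I_n, (i <= j)%N ==> (lam j <= lam i)%N].

Definition lamZ (n N : nat) (lam : {ffun 'I_n -> 'I_N.+1}) : 'I_n -> int :=
  fun i => Posz (lam i).

End Elliptic.

(* Main.v *)
(**
  In logarithmic coordinates [a = exp A], ..., the normalized theta function
  [sigma z = E(exp z) exp(- z / 2)] is odd and satisfies the three-term addition formula.
  Interpolation of even theta functions then gives, for [z_1, ..., z_n] and
  [t_0 + t_1 + t_2 + t_3 + (n - 1) t = 0],
    sum over signs of [prod_i (prod_r sigma(t_r + y_i)) / sigma(2 y_i)
      * prod_(i < j) sigma(t + y_i + y_j) / sigma(y_i + y_j)], where [y_i = +- z_i],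
    equals [prod_(0 <= i < n) sigma(i t + t_0 + t_1) sigma(i t + t_0 + t_2) sigma(i t + t_0 + t_3)].
  The choice of signs encodes a vertical strip [lam / lam'].  Up to a constant, the weight of
  [lam] times the summand of one such identity is the weight of [lam'] with [(a, e, N)] replaced
  by [(a q, e q, N - 1)] times the summand of another one.  Summing over strips and partitions in
  both orders expresses the sum for [N] through the sum for [N - 1].  The divisions are legitimate
  for generic parameters; the others are limits of generic ones.
*)
Require Import Defs.
From HB Require Import structures.
From mathcomp Require Import all_boot all_order all_algebra.
From mathcomp Require Import reals complex.
From mathcomp Require Import ring lra zify.
From Stdlib Require Import ClassicalEpsilon.
Set Implicit Arguments. Unset Strict Implicit. Unset Printing Implicit Defensive.
Import Order.TTheory GRing.Theory Num.Theory.
Local Open Scope ring_scope.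

(** * Even theta functions *)

(** The algebraic part rests on two facts about [s], oddness and the three-term relation, over any
    [numFieldType]. Through them interpolation becomes a root count for polynomials in one variable,
    and comparing theta values becomes a linear identity between arguments, which [ring] decides.
    Logarithms serve a second purpose: the strip identities are expressed through [a / 2] and
    [q / 2], which would be square roots in the multiplicative form.

    The obstacle is genericity. The hypotheses exclude zeros of the denominators in the identity
    itself, whereas the recursion also divides by [s (z_i + z_j)], [s (z_i - z_j)] and the sums over
    strips. Hence the strong notion [generic], which forbids every nontrivial integral relation,
    survives the shift of [a] by [q], and fails only on a countable set along a suitable curve of
    parameters.

    The addition formula comes from identities that are exact at each finite truncation of the
    product, with an error that decays geometrically. *)

Section EvenTheta.
Variables (K : numFieldType) (s : K -> K).
Local Notation psi x y := (s (x + y) * s (x - y)).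
Hypothesis s_odd : forall u, s (- u) = - s u.
Hypothesis s_add : forall x y u v,
  psi x y * psi u v - psi x u * psi y v + psi x v * psi y u = 0.

Lemma s0 : s 0 = 0.
Proof.
have /eqP := s_odd 0; rewrite oppr0 -subr_eq0 opprK -mulr2n mulrn_eq0 /=.
by move/eqP.
Qed.

Lemma psiC x y : psi y x = - psi x y.
Proof. by rewrite -(opprB x y) s_odd mulrN addrC. Qed.

Lemma size_prod_linear (al be : K -> K) (w : seq K) :
  (size (\prod_(v <- w) (al v *: 'X + (be v)%:P))%R <= (size w).+1)%N.
Proof.
elim: w => [|v w IH]; first by rewrite big_nil size_polyC oner_neq0.
rewrite big_cons (leq_trans (size_polyMleq _ _)) //=.
have: (size (al v *: 'X + (be v)%:P)%R <= 2)%N.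
  rewrite (leq_trans (size_polyD _ _)) // geq_max size_polyC.
  rewrite (leq_trans (size_scale_leq _ _)) ?size_polyX //=.
  by case: (_ == _).
by move=> sz_v; rewrite -subn1 leq_subLR; apply: (leq_add sz_v IH).
Qed.

Lemma coef_prod_linear (al be : K -> K) (w : seq K) :
  (\prod_(v <- w) (al v *: 'X + (be v)%:P))`_(size w) = \prod_(v <- w) al v.
Proof.
elim: w => [|v w IH]; first by rewrite !big_nil coefC.
rewrite !big_cons mulrDl coefD -scalerAl coefZ coefXM /= IH coefCM.
rewrite [X in _ + _ * X]nth_default ?mulr0 ?addr0 //.
exact: size_prod_linear.
Qed.

(* By the addition formula, [psi T v] is linear in the pair of coordinates
   [X T = psi T u], [Y T = psi T Pinf], so that the sum below is a binary form
   of degree [n] in [(X T, Y T)]. *)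
Lemma even_theta_eq0 (J : Type) (r : seq J) (n : nat) (cf : J -> K)
    (w : J -> seq K) (ps : seq K) (Pinf T : K) :
  (forall j, size (w j) = n) -> size ps = n ->
  (forall P, P \in ps -> psi P Pinf != 0) ->
  uniq ps -> {in ps &, forall P P', P != P' -> psi P P' != 0} ->
  (forall P, P \in Pinf :: ps -> \sum_(j <- r) cf j * \prod_(v <- w j) psi P v = 0) ->
  \sum_(j <- r) cf j * \prod_(v <- w j) psi T v = 0.
Proof.
(* The first node [u] doubles as a base point of the coordinates. For [n = 0] there is none, and the
   sum is a constant that vanishes at [Pinf]. *)
move=> szw; case: ps => [|u ps] szps Pinf_ps uniq_ps ps_neq f0.
  rewrite -[RHS](f0 Pinf) ?inE //; apply: eq_bigr => j _.
  by rewrite (size0nil (etrans (szw j) (esym szps))) !big_nil.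
set ups := u :: ps in szps Pinf_ps uniq_ps ps_neq f0.
have cup : psi u Pinf != 0 by apply: Pinf_ps; rewrite inE eqxx.
set c := psi u Pinf in cup.
pose X S := psi S u; pose Y S := psi S Pinf.
pose al v := psi v Pinf; pose be v := - psi v u.
have lin S v : psi S v * c = X S * al v + Y S * be v.
  have /eqP := s_add S v u Pinf; rewrite addr_eq0 subr_eq => /eqP.
  by rewrite /c /X /Y /al /be => ->; ring.
pose F : {poly K} := \sum_(j <- r) cf j *: \prod_(v <- w j) (al v *: 'X + (be v)%:P).
have fE S : (\sum_(j <- r) cf j * \prod_(v <- w j) psi S v) * c ^+ n =
    \sum_(j <- r) cf j * \prod_(v <- w j) (X S * al v + Y S * be v).
  rewrite mulr_suml; apply: eq_bigr => j _; rewrite -mulrA; congr (_ * _).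
  rewrite -(szw j); elim: (w j) => [|v w' IH]; first by rewrite !big_nil expr0 mulr1.
  by rewrite !big_cons -lin -IH /= exprS; ring.
have FE S : Y S != 0 -> \sum_(j <- r) cf j * \prod_(v <- w j) (X S * al v + Y S * be v)
    = Y S ^+ n * F.[X S / Y S].
  move=> Y0; rewrite /F horner_sum mulr_sumr; apply: eq_bigr => j _.
  rewrite hornerZ mulrCA; congr (_ * _); rewrite -(szw j).
  elim: (w j) => [|v w' IH]; first by rewrite !big_nil expr0 mul1r hornerC.
  rewrite !big_cons hornerM {}IH hornerD hornerZ hornerX hornerC /= exprS.
  by move: _.[_] (Y S ^+ _) => h y; field.
have FE0 S : Y S = 0 -> \sum_(j <- r) cf j * \prod_(v <- w j) (X S * al v + Y S * be v)
    = X S ^+ n * F`_n.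
  move=> Y0; rewrite /F coef_sum mulr_sumr; apply: eq_bigr => j _.
  rewrite coefZ mulrCA; congr (_ * _); rewrite -(szw j) coef_prod_linear Y0.
  elim: (w j) => [|v w' IH]; first by rewrite !big_nil expr0 mulr1.
  by rewrite !big_cons IH /= exprS; ring.
(* As [Y Pinf = 0], [Pinf] is the point at infinity of the affine coordinate [X / Y]: vanishing
   there kills the coefficient of degree [n], and the [n] finite nodes then suffice. *)
have Fn : F`_n = 0.
  have YP : Y Pinf = 0 by rewrite /Y subrr s0 mulr0.
  have := fE Pinf; rewrite f0 ?inE ?eqxx // mul0r FE0 // => /esym/eqP.
  by rewrite mulf_eq0 expf_eq0 /X psiC oppr_eq0 (negbTE cup) andbF => /eqP.
have szF : (size F <= n)%N.
  have: (size F <= n.+1)%N.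
    rewrite /F; elim/big_ind: _ => [|f g szf szg|j _]; first by rewrite size_poly0.
      by rewrite (leq_trans (size_polyD _ _)) // geq_max szf.
    by rewrite (leq_trans (size_scale_leq _ _)) // -(szw j) size_prod_linear.
  rewrite leq_eqVlt => /orP[/eqP szF|//].
  by move: (Fn); rewrite -[n in _`_n]/(n.+1.-1) -szF => /eqP; rewrite lead_coef_eq0 => /eqP ->;
    rewrite size_poly0.
have Y_ps P : P \in ups -> Y P != 0 by exact: Pinf_ps.
have F0 : F = 0.
  apply/eqP/contraT => F_neq0.
  have: (size [seq X P / Y P | P <- ups] < size F)%N.
    apply: max_poly_roots => //.
      apply/allP => _ /mapP[P Pps ->]; apply/rootP.
      have P0 := f0 P (mem_behead (s := Pinf :: ups) Pps).
      have := fE P; rewrite P0 mul0r FE ?Y_ps // => /esym/eqP.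
      by rewrite mulf_eq0 expf_eq0 (negbTE (Y_ps _ Pps)) andbF => /eqP.
    rewrite map_inj_in_uniq // => P P' Pps P'ps eqXY; apply/eqP/contraT => neqP.
    (* The three-term relation reads [psi P P' * c = X P * Y P' - Y P * X P'], so equal affine
       coordinates force [psi P P' = 0]. *)
    have /eqP[] : psi P P' != 0 by exact: ps_neq.
    apply: (mulIf cup); rewrite mul0r.
    have /eqP := s_add P P' u Pinf; rewrite addr_eq0 subr_eq => /eqP ->.
    move/eqP: eqXY; rewrite eqr_div ?Y_ps // => /eqP.
    by rewrite /X /Y => eqXY; rewrite eqXY; ring.
  by rewrite size_map szps; move: szF; lia.
apply: (mulIf (expf_neq0 n cup)); rewrite mul0r fE.
have [Y0|Y0] := eqVneq (Y T) 0; first by rewrite FE0 // Fn mulr0.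
by rewrite FE // F0 horner0 mulr0.
Qed.

End EvenTheta.

(** * The type BC summation over subsets *)

Section SubsetSum.
Variables (K : numFieldType) (s : K -> K).
Local Notation psi x y := (s (x + y) * s (x - y)).
Hypothesis s_odd : forall u, s (- u) = - s u.
Hypothesis s_add : forall x y u v,
  psi x y * psi u v - psi x u * psi y v + psi x v * psi y u = 0.

Definition flip n (z : 'I_n -> K) (S : {set 'I_n}) (i : 'I_n) : K :=
  if i \in S then z i else - z i.

(** The index set [A] is a parameter so that an induction can delete one index without renumbering
    ['I_n]. *)
Definition bc_pairs n (A : {set 'I_n}) (t : K) (y : 'I_n -> K) : K :=
  \prod_(i in A) \prod_(j in A | (i < j)%N) (s (t + y i + y j) / s (y i + y j)).

Definition bc_term n (A : {set 'I_n}) (t t0 t1 t2 t3 : K) (y : 'I_n -> K) : K :=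
  \prod_(i in A) (s (t0 + y i) * s (t1 + y i) * s (t2 + y i) * s (t3 + y i)
                  / s (y i + y i)) * bc_pairs A t y.

Lemma eq_bc_pairs n (A : {set 'I_n}) t y y' :
  {in A, y =1 y'} -> bc_pairs A t y = bc_pairs A t y'.
Proof.
move=> eqy; apply: eq_bigr => i Ai; apply: eq_bigr => j /andP[Aj _].
by rewrite !eqy.
Qed.

Lemma eq_bc_term n (A : {set 'I_n}) t t0 t1 t2 t3 y y' :
  {in A, y =1 y'} -> bc_term A t t0 t1 t2 t3 y = bc_term A t t0 t1 t2 t3 y'.
Proof.
move=> eqy; rewrite /bc_term (eq_bc_pairs _ eqy); congr (_ * _).
by apply: eq_bigr => i Ai; rewrite !eqy.
Qed.

Lemma bc_term_eq0 n (A : {set 'I_n}) t t0 t1 t2 t3 y k :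
  k \in A -> t0 = - y k -> bc_term A t t0 t1 t2 t3 y = 0.
Proof.
by move=> Ak ->; rewrite /bc_term (bigD1 k) //= addNr s0 // !mul0r.
Qed.

(** Each pair factor is symmetric in its two indices, so the pairs with [k] in first and in second
    position merge into one product. *)
Lemma bc_pairsD1 n (A : {set 'I_n}) t y k : k \in A ->
  bc_pairs A t y = \prod_(j in A :\ k) (s (t + y k + y j) / s (y k + y j))
                   * bc_pairs (A :\ k) t y.
Proof.
move=> Ak; rewrite /bc_pairs (big_setD1 k) //=.
rewrite [X in _ * X = _](eq_bigr (fun i : 'I_n => (if (i < k)%N then s (t + y i + y k) / s (y i + y
  k) else 1) *
   \prod_(j in A :\ k | (i < j)%N) (s (t + y i + y j) / s (y i + y j)))); last first.
  move=> i; rewrite !inE => /andP[ik Ai].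
  case: ifP => ltik.
    rewrite (bigD1 k) /= ?Ak //; congr (_ * _); apply: eq_bigl => j.
    by rewrite !inE andbC andbA.
  rewrite mul1r; apply: eq_bigl => j; rewrite !inE.
  by case: eqP => [->|]; rewrite ?ltik ?andbF.
rewrite [X in _ * X = _]big_split /= mulrA; congr (_ * _).
rewrite -big_mkcondr /= mulrC [RHS](bigID (fun j : 'I_n => (j < k)%N)) /=; congr (_ * _).
  apply: eq_bigr => i _; rewrite [y k + y i]addrC.
  by rewrite -addrA [y i + y k]addrC addrA.
apply: eq_bigl => j; rewrite !inE -leqNgt ltn_neqAle (eq_sym (k : nat)).
by rewrite -[(j : nat) == k]/(j == k) andbA [(_ \in _) && _]andbC.
Qed.

(** At [t0 = y k] the factor [s (t0 + y k)] cancels the denominator [s (y k + y k)], and each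
    [s (t0 + y j)] cancels the denominator of the pair of [k] and [j]. The surviving numerators
    [s (t + y k + y j)] take the place of [s (t0 + y j)], with [t + y k] as the new [t0]. *)
Lemma bc_term_peel n (A : {set 'I_n}) t t1 t2 t3 y k :
  k \in A -> s (y k + y k) != 0 ->
  {in A :\ k, forall j, s (y k + y j) != 0} ->
  bc_term A t (y k) t1 t2 t3 y =
  s (t1 + y k) * s (t2 + y k) * s (t3 + y k) *
  bc_term (A :\ k) t (t + y k) t1 t2 t3 y.
Proof.
move=> Ak y2 yj; rewrite /bc_term (bc_pairsD1 _ _ Ak) (big_setD1 k) //=.
set P1 := \prod_(i in _) _; set P2 := \prod_(i in _) _; set P3 := \prod_(i in _) _.
have -> : P3 = P1 * P2.
  rewrite -big_split /=; apply: eq_bigr => j Aj; have := yj j Aj.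
  by move: (s (y j + y j))^-1 (s (y k + y j)) => u v v0; field.
by move: (s (y k + y k)) y2 => u u0; field.
Qed.

Lemma bc_sum0 n t t0 t1 t2 t3 (z : 'I_n -> K) :
  \sum_(S : {set 'I_n} | S \subset set0) bc_term set0 t t0 t1 t2 t3 (flip z S) = 1.
Proof.
under eq_bigl => S do rewrite subset0.
by rewrite big_pred1_eq /bc_term /bc_pairs !big_set0 mulr1.
Qed.

Lemma flipU1 n (z : 'I_n -> K) S k : flip z (k |: S) k = z k.
Proof. by rewrite /flip setU11. Qed.

Section Peel.
Variables (n : nat) (z : 'I_n -> K) (A : {set 'I_n}) (t t1 t2 t3 : K) (k : 'I_n).
Hypothesis Ak : k \in A.
Hypothesis zD : forall i j, s (z i + z j) != 0.
Hypothesis zB : forall i j, i != j -> s (z i - z j) != 0.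

(** If [k \in S] then [t0 + y k = 0] and the term vanishes; the other terms all have [y k = t0] and
    are peeled. *)
Lemma bc_sum_at_opp :
  \sum_(S : {set 'I_n} | S \subset A) bc_term A t (- z k) t1 t2 t3 (flip z S) =
  s (t1 - z k) * s (t2 - z k) * s (t3 - z k) *
  \sum_(S : {set 'I_n} | S \subset A :\ k)
     bc_term (A :\ k) t (t - z k) t1 t2 t3 (flip z S).
Proof.
rewrite (bigID (fun S : {set 'I_n} => k \in S)) /= big1 ?add0r => [|S /andP[_ kS]].
  rewrite mulr_sumr; apply: eq_big => [S|S]; first by rewrite subsetD1.
  case/andP=> _ /negbTE kS.
  have fk : flip z S k = - z k by rewrite /flip kS.
  rewrite -fk bc_term_peel // fk -?opprD ?s_odd ?oppr_eq0 ?zD // => j.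
  rewrite !inE => /andP[jk _]; rewrite /flip; case: ifP => _.
    by rewrite addrC zB.
  by rewrite -opprD s_odd oppr_eq0 zD.
by apply: (bc_term_eq0 _ _ _ _ Ak); rewrite /flip kS.
Qed.

Lemma bc_sum_at :
  \sum_(S : {set 'I_n} | S \subset A) bc_term A t (z k) t1 t2 t3 (flip z S) =
  s (t1 + z k) * s (t2 + z k) * s (t3 + z k) *
  \sum_(S : {set 'I_n} | S \subset A :\ k)
     bc_term (A :\ k) t (t + z k) t1 t2 t3 (flip z S).
Proof.
rewrite (bigID (fun S : {set 'I_n} => k \in S)) /= addrC big1 ?add0r => [|S /andP[_ kS]].
  rewrite mulr_sumr (reindex_onto (fun S => k |: S) (fun S => S :\ k)) /=; last first.
    by move=> S /andP[_ kS]; rewrite setD1K.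
  apply: eq_big => [S|S].
    rewrite subUset sub1set Ak setU11 andbT subsetD1; congr (_ && _).
    apply/eqP/idP => [<-|kS]; first by rewrite setD11.
    by rewrite setU1K.
  case/andP=> _ /eqP kS.
  rewrite -[in LHS](flipU1 z S k) bc_term_peel // flipU1 ?zD // => [|j].
    congr (_ * _); apply: eq_bc_term => j; rewrite !inE => /andP[jk _].
    by rewrite /flip !inE (negbTE jk).
  rewrite !inE => /andP[jk _]; rewrite /flip; case: ifP => _; first exact: zD.
  by rewrite zB // eq_sym.
apply: (bc_term_eq0 _ _ _ _ Ak).
by rewrite /flip (negbTE kS) opprK.
Qed.

End Peel.

(* With [t0 + t3] fixed, both sides are even theta functions of [t0] of the same degree, which
   agree at [t0 = +- z_k] by induction on [A]. *)
Lemma bc_sumE n (z : 'I_n -> K) (A : {set 'I_n}) t t0 t1 t2 t3 :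
  (forall i j, s (z i + z j) != 0) ->
  (forall i j, i != j -> s (z i - z j) != 0) ->
  (forall m i j, s (z i + z j - (t0 + t3) - m%:R * t) != 0) ->
  (forall m i j, s (z i - z j - (t0 + t3) - m%:R * t) != 0) ->
  t0 + t1 + t2 + t3 + #|A|%:R * t = t ->
  \sum_(S : {set 'I_n} | S \subset A) bc_term A t t0 t1 t2 t3 (flip z S) =
  \prod_(i < #|A|) (s (i%:R * t + t0 + t1) * s (i%:R * t + t0 + t2)
                    * s (i%:R * t + t0 + t3)).
Proof.
move=> zD zB; move cA: #|A| => m; elim: m A t0 t3 cA => [|m IH] A t0 t3 cA zDc zBc.
  move=> _; rewrite big_ord0.
  by move: cA => /eqP; rewrite cards_eq0 => /eqP ->; rewrite bc_sum0.
move=> bal; set c := t0 + t3 in zDc zBc.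
have t3E : t3 = c - t0 by rewrite /c; ring.
have t2E : t2 = - c - t1 - m%:R * t.
  have : t2 = t - m.+1%:R * t - c - t1 by rewrite -[X in X - _ - _ - _]bal /c; ring.
  by move=> ->; rewrite -natr1; ring.
pose lhs T := \sum_(S : {set 'I_n} | S \subset A) bc_term A t T t1 t2 (c - T) (flip z S).
pose rhs T := \prod_(i < m.+1) (s (i%:R * t + T + t1) * s (i%:R * t + T + t2)
                    * s (i%:R * t + c)).
suff eqLR : lhs t0 = rhs t0.
  move: eqLR; rewrite /lhs /rhs -t3E => ->.
  by apply: eq_bigr => i _; rewrite /c addrA.
(* The factor [i = 0] of the product is what peeling extracts; the others form the product with
   [t + v] as the new [t0]. *)
have rhs_rec v : s (t1 + v) * s (t2 + v) * s (c - v + v) *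
    \prod_(i < m) (s (i%:R * t + (t + v) + t1) * s (i%:R * t + (t + v) + t2)
       * s (i%:R * t + (t + v) + (c - v))) = rhs v.
  rewrite /rhs big_ord_recl /=; congr (_ * _).
    by congr (s _ * s _ * s _); ring.
  apply: eq_bigr => i _; rewrite /bump leq0n add1n -natr1.
  by congr (s _ * s _ * s _); ring.
(* Peeling replaces [t0 + t3 = c] by [c + t]; this is why the hypotheses exclude zeros at all shifts
   by [m%:R * t]. *)
have zDc' v : t + v + (c - v) = c + t by ring.
have balv v : t + v + t1 + t2 + (c - v) + m%:R * t = t by rewrite t2E; ring.
have zDct j i i' : s (z i + z i' - (c + t) - j%:R * t) != 0.
  by have := zDc j.+1 i i'; rewrite -natr1; congr (s _ != 0); ring.
have zBct j i i' : s (z i - z i' - (c + t) - j%:R * t) != 0.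
  by have := zBc j.+1 i i'; rewrite -natr1; congr (s _ != 0); ring.
have cAk k : k \in A -> #|A :\ k| = m.
  by move=> Ak; move: cA; rewrite (cardsD1 k A) Ak => -[].
have at_opp k : k \in A -> lhs (- z k) = rhs (- z k).
  move=> Ak; rewrite /lhs bc_sum_at_opp // -rhs_rec.
  by rewrite (IH (A :\ k)) ?cAk ?balv // => j i i'; rewrite zDc'.
have at_id k : k \in A -> lhs (z k) = rhs (z k).
  move=> Ak; rewrite /lhs bc_sum_at // -rhs_rec.
  by rewrite (IH (A :\ k)) ?cAk ?balv // => j i i'; rewrite zDc'.
have /card_gt0P[k0 Ak0] : (0 < #|A|)%N by rewrite cA.
(* Since [t3 = c - T], the factors of [t0] and [t3] combine to [- psi (T - h) (y + h)], even in
   [T - h]. On the product side the factor [i] of [t1] is paired with the factor [m - i] of [t2].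
   The index [None] stands for that product with the opposite sign. *)
pose h := c / 2%:R.
pose cf (o : option {set 'I_n}) := if o is Some B then
   (B \subset A)%:R * (\prod_(i in A) (- (s (t1 + flip z B i) * s (t2 + flip z B i)
     / s (flip z B i + flip z B i))) * bc_pairs A t (flip z B))
   else - \prod_(i < m.+1) s (i%:R * t + c).
pose w (o : option {set 'I_n}) := if o is Some B then
   [seq flip z B i + h | i <- enum A]
   else [seq i%:R * t + t1 + h | i <- iota 0 m.+1].
pose r := None :: map Some (index_enum {set 'I_n}).
have hh : h + h = c by rewrite /h; field.
have fE T : \sum_(j <- r) cf j * \prod_(v <- w j) psi (T - h) v = lhs T - rhs T.
  rewrite /r big_cons big_map addrC; congr (_ + _).
    rewrite /lhs [RHS]big_mkcond /=; apply: eq_bigr => S _.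
    case: ifP => _; rewrite ?mul0r // mul1r big_map big_enum /= /bc_term mulrAC.
    congr (_ * _); rewrite -big_split /=; apply: eq_bigr => i _.
    have -> : T - h + (flip z S i + h) = T + flip z S i by ring.
    have -> : T - h - (flip z S i + h) = - (c - T + flip z S i) by rewrite -hh; ring.
    by rewrite s_odd; ring.
  rewrite [cf None]/cf mulNr [w None]/w; congr (- _);
    rewrite big_map -[iota 0 m.+1]/(index_iota 0 m.+1) big_mkord.
  rewrite /rhs big_split mulrC /= [in RHS]big_split /=; congr (_ * _).
  rewrite big_split /=; congr (_ * _).
    by apply: eq_bigr => i _; congr (s _); ring.
  rewrite [RHS](reindex_inj rev_ord_inj) /=; apply: eq_bigr => i _; congr (s _).
  by rewrite subSS natrB -1?ltnS // t2E -hh; ring.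
apply/eqP; rewrite -subr_eq0 -fE; apply/eqP.
(* A form of degree [m.+1] needs [m.+2] nodes: the [z l] for [l] in [A], and one further point
   [- z k0]. *)
pose ps := [seq z l - h | l <- enum A].
apply: (@even_theta_eq0 _ _ s_odd s_add _ r m.+1 cf w ps (- z k0 - h)).
- case=> [S|] /=; first by rewrite size_map -cardE.
  by rewrite size_map size_iota.
- by rewrite size_map -cardE.
- move=> _ /mapP[l _ ->].
  have -> : z l - h + (- z k0 - h) = z l - z k0 - c - 0%:R * t by rewrite -hh; ring.
  have -> : z l - h - (- z k0 - h) = z l + z k0 by ring.
  by rewrite mulf_neq0.
- rewrite map_inj_uniq ?enum_uniq // => i j /addIr eqz; apply/eqP/contraT => nij.
  by have := zB _ _ nij; rewrite eqz subrr s0 // eqxx.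
- move=> _ _ /mapP[i _ ->] /mapP[j _ ->] neqz.
  have nij : i != j by apply: contraNneq neqz => ->.
  have -> : z i - h + (z j - h) = z i + z j - c - 0%:R * t by rewrite -hh; ring.
  have -> : z i - h - (z j - h) = z i - z j by ring.
  by rewrite mulf_neq0 // zB.
- move=> P; rewrite inE => /orP[/eqP ->|/mapP[l]].
    by rewrite fE at_opp ?subrr.
  by rewrite mem_enum => Al ->; rewrite fE at_id ?subrr.
Qed.

End SubsetSum.

(** * The weight and its shifts *)

Section Weights.
Variables (K : numFieldType) (s : K -> K).

Definition ph (q y : K) (k : nat) : K := \prod_(j < k) s (y + j%:R * q).

(** The powers of [q] and [x] in the summand do not appear: they are absorbed when [E] is replaced
    by [sigma]. Each denominator is [a + q - r] for a numerator [r] of the list, the well-poised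
    pattern. *)
Definition single_weight (n N : nat) (a b c d e q x : K) (i k : nat) : K :=
  s (a - i%:R * x - i%:R * x + k%:R * q + k%:R * q) / s (a - i%:R * x - i%:R * x) *
  \prod_(r <- [:: a - (n%:R * x - x); b; c; d; e; - (N%:R * q)])
     (ph q (r - i%:R * x) k / ph q (a + q - r - i%:R * x) k).

Definition pair_weight (A D q x : K) (u v : nat) : K :=
  s (D + v%:R * q) * s (A + u%:R * q) / (s D * s A) *
  (ph q (A + x) u * ph q (D + x) v / (ph q (A + q - x) u * ph q (D + q - x) v)).

Definition weight (n N : nat) (a b c d e q x : K) (lam : 'I_n -> nat) : K :=
  \prod_(i < n) single_weight n N a b c d e q x i (lam i) *
  \prod_(i < n) \prod_(j < n | (i < j)%N)
     pair_weight (a - i%:R * x - j%:R * x) (j%:R * x - i%:R * x) q x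
       (lam i + lam j) (lam i - lam j).

Lemma phS q y k : ph q y k.+1 = ph q y k * s (y + k%:R * q).
Proof. by rewrite /ph big_ord_recr. Qed.

Lemma phSl q y k : ph q y k.+1 = s y * ph q (y + q) k.
Proof.
rewrite /ph big_ord_recl /= mul0r addr0; congr (_ * _); apply: eq_bigr => j _.
by rewrite /bump leq0n add1n -natr1; congr s; ring.
Qed.

Lemma ph_neq0 q y k : (forall m : nat, s (y + m%:R * q) != 0) -> ph q y k != 0.
Proof. by move=> y0; apply/prodf_neq0 => j _. Qed.

Hypothesis s_odd : forall u, s (- u) = - s u.

(* Passing from [k'] to [k = k' + eps] while [a] becomes [a + q] and [r]
   becomes [r + q]. *)
Lemma ph_ratio_up q h r i (k' : nat) (eps : bool) :
  (forall m : nat, s (h + h + q - r - i + m%:R * q) != 0) ->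
  ph q (r - i) (k' + eps) / ph q (h + h + q - r - i) (k' + eps) *
    s (r - h + (-1) ^+ eps * (h - i + (k' + eps)%:R * q)) =
  (-1) ^+ eps * s (r - i) *
    (ph q (r + q - i) k' / ph q (h + h + q + q - (r + q) - i) k').
Proof.
move=> nz; have -> : h + h + q + q - (r + q) - i = h + h + q - r - i by ring.
have p0 := ph_neq0 k' nz; have -> : r + q - i = r - i + q by ring.
case: eps; rewrite ?addn1 ?addn0 ?expr0 ?expr1 ?mul1r ?mulN1r.
  rewrite phSl phS -natr1.
  have -> : r - h - (h - i + (k'%:R + 1) * q) = - (h + h + q - r - i + k'%:R * q) by ring.
  rewrite s_odd; move: (nz k') p0; move: (s (h + h + q - r - i + _)) (ph _ (h + h + q - r - i) _).
  by move=> u v u0 v0; field; rewrite u0 v0.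
have -> : r - h + (h - i + k'%:R * q) = r - i + k'%:R * q by ring.
by rewrite mulrAC -phS phSl mulrA.
Qed.

(* Passing from [k'] to [k = k' + eps] while [a] becomes [a + q] and [r] is fixed. *)
Lemma ph_ratio_down g h r i (k' : nat) (eps : bool) :
  let q := g + g in
  (forall m : nat, s (h + h + q - r - i + m%:R * q) != 0) ->
  ph q (r - i) (k' + eps) / ph q (h + h + q - r - i) (k' + eps) =
  (ph q (r - i) k' / ph q (h + h + q + q - r - i) k') *
  s (r - h - g - (-1) ^+ eps * (h + g - i + k'%:R * q)) *
  (- (-1) ^+ eps) / s (h + h + q - r - i).
Proof.
move=> q nz; have z0 : s (h + h + q - r - i) != 0 by have := nz 0; rewrite mul0r addr0.
have -> : h + h + q + q - r - i = h + h + q - r - i + q by ring.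
have p0 : ph q (h + h + q - r - i + q) k' != 0.
  by apply: ph_neq0 => m; have := nz m.+1; rewrite -natr1; congr (s _ != 0); ring.
case: eps; rewrite ?addn1 ?addn0 ?expr0 ?expr1 ?mul1r ?mulN1r.
  have -> : r - h - g - - (h + g - i + k'%:R * q) = r - i + k'%:R * q by ring.
  rewrite (phS q (r - i)) phSl; move: z0 p0;
    move: (s (h + h + q - r - i)) (ph _ (h + h + q - r - i + _) _).
  by move=> u v u0 v0; field; rewrite u0 v0.
have -> : r - h - g - (h + g - i + k'%:R * q) = - (h + h + q - r - i + k'%:R * q).
  by rewrite /q; ring.
rewrite s_odd.
have eqP : ph q (h + h + q - r - i) k' * s (h + h + q - r - i + k'%:R * q) =
   s (h + h + q - r - i) * ph q (h + h + q - r - i + q) k' by rewrite -phS -phSl.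
have p1 := ph_neq0 k' nz; move: z0 p0 p1 eqP.
move: (s (h + h + q - r - i)) (ph _ (h + h + q - r - i + _) _) (ph _ (h + h + q - r - i) _).
move=> u v w u0 v0 w0 eqP; have -> : s (h + h + q - r - i + k'%:R * q) = u * v / w.
  by rewrite -eqP; field.
by field; rewrite u0 v0 w0.
Qed.

Definition single_factor (n N : nat) (a b c d e q x : K) (i : nat) : K :=
  - s (a + q - i%:R * x - i%:R * x) / s (a - i%:R * x - i%:R * x) *
  (s (a - (n%:R * x - x) - i%:R * x) * s (e - i%:R * x) * s (- (N%:R * q) - i%:R * x)) /
  (s (a + q - b - i%:R * x) * s (a + q - c - i%:R * x) * s (a + q - d - i%:R * x)).

(** Stated on atoms so that [field] never meets a theta value. [P1], [P2], [P3] belong to the three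
    parameters that move with [a]; [pb], [pc], [pd] belong to the three fixed ones. *)
Lemma single_weight_assembly (eps : bool) (S2 Sa S1 S2' R P1 P2 P3 Q1 Q2 Q3 u1 u2 u3
    p1 p2 p3 pb pc pd Rb Rc Rd db dc dd : K) :
  P1 * Q1 = (-1) ^+ eps * u1 * p1 -> P2 * Q2 = (-1) ^+ eps * u2 * p2 ->
  P3 * Q3 = (-1) ^+ eps * u3 * p3 ->
  S2 != 0 -> Sa != 0 -> S1 != 0 -> S2' != 0 -> db != 0 -> dc != 0 -> dd != 0 ->
  S2 / Sa * (P1 * (pb * Rb * - (-1) ^+ eps / db * (pc * Rc * - (-1) ^+ eps / dc *
    (pd * Rd * - (-1) ^+ eps / dd * (P2 * (P3 * 1)))))) *
    (Q1 * Q3 * Q2 * - R / ((-1) ^+ eps * S2)) =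
  - S1 / Sa * (u1 * u2 * u3) / (db * dc * dd) *
    (S2' / S1 * (p1 * (pb * (pc * (pd * (p2 * (p3 * 1)))))) *
    (Rb * Rc * Rd * R / (- (-1) ^+ eps * S2'))).
Proof.
move=> e1 e2 e3 S20 Sa0 S10 S20' b0 c0 d0.
transitivity ((P1 * Q1) * (P2 * Q2) * (P3 * Q3) * (pb * Rb * pc * Rc * pd * Rd * R)
    * ((-1) ^+ eps) ^+ 3 / (Sa * db * dc * dd * (-1) ^+ eps)).
  have sg0 : (-1) ^+ eps != 0 :> K by rewrite signr_eq0.
  by field; rewrite sg0 S20 Sa0 b0 c0 d0.
rewrite e1 e2 e3; case: eps {e1 e2 e3}; rewrite ?expr0 ?expr1.
  by field; rewrite S10 S20' Sa0 b0 c0 d0.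
by field; rewrite S10 S20' Sa0 b0 c0 d0.
Qed.

(** Of the six numerator parameters, [a x^(1-n)], [e] and [q^(-N)] move by [q] together with [a],
    while [b], [c], [d] stay. By [ph_ratio_up] the first three are compensated by factors in [y],
    and by [ph_ratio_down] the last three by factors in [y']. This dictates the parameters of the
    two sums over signs. *)
Lemma single_weight_shift (n N : nat) (h b c d e g x : K) (i k' : nat) (eps : bool) :
  let q := g + g in let a := h + h in
  let y := (-1) ^+ eps * (h - i%:R * x + (k' + eps)%:R * q) in
  let y' := - (-1) ^+ eps * (h + g - i%:R * x + k'%:R * q) in
  (forall m : nat, s (a - i%:R * x - i%:R * x + m%:R * q) != 0) ->
  (forall r (m : nat), r \in [:: a - (n%:R * x - x); b; c; d; e; - (N.+1%:R * q)] ->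
     s (a + q - r - i%:R * x + m%:R * q) != 0) ->
  single_weight n N.+1 a b c d e q x i (k' + eps) *
   (s (h - (n%:R * x - x) + y) * s (- (N.+1%:R * q) - h + y) * s (e - h + y) *
    s (N.+1%:R * q + h - e + y) / s (y + y)) =
  single_factor n N.+1 a b c d e q x i *
  (single_weight n N (a + q) b c d (e + q) q x i k' *
   (s (b - h - g + y') * s (c - h - g + y') * s (d - h - g + y') *
    s (e - h - N.+1%:R * q + g + y') / s (y' + y'))).
Proof.
move=> q a y y' a0 r0.
have a1 : s (a + q - i%:R * x - i%:R * x) != 0.
  by have := a0 1%N; rewrite mul1r; congr (s _ != 0); ring.
have a2 : s (a - i%:R * x - i%:R * x) != 0 by have := a0 0%N; rewrite mul0r addr0.
have sg (u : K) : s ((-1) ^+ eps * u) = (-1) ^+ eps * s u.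
  by case: eps {y y'}; rewrite ?expr0 ?expr1 ?mul1r ?mulN1r.
have sg2 : ((-1) ^+ eps) ^+ 2 = 1 :> K by rewrite sqrr_sign.
have sg0 : (-1) ^+ eps != 0 :> K by rewrite signr_eq0.
have y2 : s (y + y) = (-1) ^+ eps * s (a - i%:R * x - i%:R * x + (k' + eps)%:R * q + (k' + eps)%:R
  * q).
  by rewrite -mulrDr sg; congr (_ * s _); rewrite /a; ring.
have y2' : s (y' + y') = - (-1) ^+ eps * s (a + q - i%:R * x - i%:R * x + k'%:R * q + k'%:R * q).
  by rewrite -mulrDr mulNr s_odd sg mulNr; congr (- (_ * s _)); rewrite /a /q; ring.
have y20 : s (a - i%:R * x - i%:R * x + (k' + eps)%:R * q + (k' + eps)%:R * q) != 0.
  by have := a0 ((k' + eps) + (k' + eps))%N; rewrite natrD mulrDl addrA.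
have y20' : s (a + q - i%:R * x - i%:R * x + k'%:R * q + k'%:R * q) != 0.
  by have := a0 ((k' + k').+1)%N; rewrite -natr1 natrD; congr (s _ != 0); ring.
(* For both values of [eps] one has [y + y' = - g], which matches the two fourth factors up to
   sign. *)
have t3 : s (N.+1%:R * q + h - e + y) = - s (e - h - N.+1%:R * q + g + y').
  rewrite -s_odd; congr s; rewrite /y /y'.
  case: eps {y y' sg sg2 sg0 y2 y2' y20 y20'}; rewrite ?addn1 ?addn0 ?expr0 ?expr1 -?natr1.
    by rewrite /q; ring.
  by rewrite /q; ring.
have up r : r \in [:: a - (n%:R * x - x); b; c; d; e; - (N.+1%:R * q)] ->
    ph q (r - i%:R * x) (k' + eps) / ph q (a + q - r - i%:R * x) (k' + eps) * s (r - h + y)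
    = (-1) ^+ eps * s (r - i%:R * x) *
    (ph q (r + q - i%:R * x) k' / ph q (a + q + q - (r + q) - i%:R * x) k').
  by move=> rP; apply: ph_ratio_up => m; apply: r0.
have down r : r \in [:: a - (n%:R * x - x); b; c; d; e; - (N.+1%:R * q)] ->
    ph q (r - i%:R * x) (k' + eps) / ph q (a + q - r - i%:R * x) (k' + eps) =
    (ph q (r - i%:R * x) k' / ph q (a + q + q - r - i%:R * x) k') *
     s (r - h - g + y') * (- (-1) ^+ eps) / s (a + q - r - i%:R * x).
  move=> rP; rewrite /y' mulNr; apply: ph_ratio_down => m; exact: r0.
have up1 : ph q (a - (n%:R * x - x) - i%:R * x) (k' + eps) / ph q (a + q - (a - (n%:R * x - x)) -
  i%:R * x) (k' + eps) * s (h - (n%:R * x - x) + y)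
    = (-1) ^+ eps * s (a - (n%:R * x - x) - i%:R * x) *
    (ph q (a + q - (n%:R * x - x) - i%:R * x) k' / ph q (a + q + q - (a + q - (n%:R * x - x)) -
      i%:R * x) k').
  have := up (a - (n%:R * x - x)); rewrite inE eqxx => /(_ isT).
  have -> : a - (n%:R * x - x) - h = h - (n%:R * x - x) by rewrite /a; ring.
  by have -> : a - (n%:R * x - x) + q = a + q - (n%:R * x - x) by ring.
have up2 := up e; have up3 := up (- (N.+1%:R * q)).
rewrite !inE !eqxx !orbT in up2 up3.
have {}up2 := up2 isT; have {}up3 := up3 isT.
have eN : - (N.+1%:R * q) + q = - (N%:R * q) by rewrite -natr1; ring.
rewrite eN in up3.
have := down b; have := down c; have := down d; rewrite !inE !eqxx !orbT.
move=> /(_ isT) dd /(_ isT) dc /(_ isT) db.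
have b0 r : r \in [:: a - (n%:R * x - x); b; c; d; e; - (N.+1%:R * q)] ->
    s (a + q - r - i%:R * x) != 0.
  by move=> rP; have := r0 r 0%N rP; rewrite mul0r addr0.
have := b0 b; have := b0 c; have := b0 d; rewrite !inE !eqxx !orbT.
move=> /(_ isT) d0 /(_ isT) c0 /(_ isT) {}b0.
rewrite /single_weight /single_factor !big_cons !big_nil t3 y2 y2'.
rewrite db dc dd.
by apply: (@single_weight_assembly eps _ _ _ _ _ _ _ _ _ _ _ _ _ _ _ _ _ _ _ _ _ _ _ _ _ _ up1 up2
  up3).
Qed.

(** * Ratios attached to a pair of rows *)

Section PairRatios.
Variables (q x A D : K).
Hypothesis A0 : forall m : nat, s (A + q - x + m%:R * q) != 0.
Hypothesis D0 : forall m : nat, s (D + q - x + m%:R * q) != 0.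
Local Notation F A u := (ph q (A + x) u / ph q (A + q - x) u).

Lemma ratio_sum1 u : F A u.+1 = s (A + x) / s (A + q - x) * F (A + q) u.
Proof.
have -> : A + q + q - x = A + q - x + q by ring.
have -> : A + q + x = A + x + q by ring.
by rewrite !phSl invfM; ring.
Qed.

Lemma ratio_sum0 u : F A u * s (A + x + u%:R * q) =
  s (A + x) / s (A + q - x) * F (A + q) u * s (A + q - x + u%:R * q).
Proof.
rewrite -ratio_sum1 !phS invfM mulrA -[RHS]mulrA.
by rewrite mulrAC -[RHS]mulrA mulVf ?A0 // mulr1.
Qed.

Lemma ratio_sum2 u : F A u.+2 * s (A + q - x + u.+1%:R * q) =
  s (A + x) / s (A + q - x) * F (A + q) u * s (A + x + u.+1%:R * q).
Proof.
rewrite -ratio_sum1 (phS _ _ u.+1) (phS _ (A + q - x) u.+1).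
have := A0 u.+1; move: (s (A + q - x + _)) => v v0.
by rewrite invfM; move: (ph q (A + q - x) u.+1)^-1 => w; field.
Qed.

Lemma ratio_diff v : F D v.+1 * s (D + q - x + v%:R * q) = F D v * s (D + x + v%:R * q).
Proof.
rewrite !phS; have := D0 v; move: (s (D + q - x + _)) => w w0.
by rewrite invfM; move: (ph q (D + q - x) v)^-1 => w'; field.
Qed.

End PairRatios.

(** The sum of the rows grows by [eps + del] while [X + Y] moves by [q]. If exactly one row grows,
    the sum ratio shifts exactly and the difference ratio is one step off; if both or none grow, the
    difference is unchanged and the sum ratio is one step off. The strip factors supply the missing
    quotient. *)
Lemma pair_weight_shift (X Y g x : K) (k' l' : nat) (eps del : bool) :
  let q := g + g in let k := (k' + eps)%N in let l := (l' + del)%N in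
  let yi := (-1) ^+ eps * (X + k%:R * q) in
  let yj := (-1) ^+ del * (Y + l%:R * q) in
  let yi' := - (-1) ^+ eps * (X + g + k'%:R * q) in
  let yj' := - (-1) ^+ del * (Y + g + l'%:R * q) in
  (forall m : nat, s (X + Y + m%:R * q) != 0) ->
  (forall m : nat, s (X - Y + m%:R * q) != 0) ->
  (forall m : nat, s (X + Y + q - x + m%:R * q) != 0) ->
  (forall m : nat, s (X - Y + q - x + m%:R * q) != 0) ->
  (l' <= k')%N -> (l <= k)%N ->
  pair_weight (X + Y) (X - Y) q x (k + l) (k - l) * (s (x + yi + yj) / s (yi + yj)) =
  s (X + Y + x) * s (X + Y + q) / (s (X + Y) * s (X + Y + q - x)) *
  (pair_weight (X + Y + q) (X - Y) q x (k' + l') (k' - l') *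
   (s (x + yi' + yj') / s (yi' + yj'))).
Proof.
move=> q k l yi yj yi' yj' A0 D0 Ax Dx /subnKC.
have a0 : s (X + Y) != 0 by have := A0 0; rewrite mul0r addr0.
have a1 : s (X + Y + q) != 0 by have := A0 1%N; rewrite mul1r.
have d0 : s (X - Y) != 0 by have := D0 0; rewrite mul0r addr0.
have ax0 : s (X + Y + q - x) != 0 by have := Ax 0; rewrite mul0r addr0.
rewrite /yi /yj /yi' /yj' /k /l {yi yj yi' yj' k l}.
move: (k' - l')%N => v <- {k'} lekl; set u := (l' + v + l')%N.
have uE : u%:R = l'%:R + v%:R + l'%:R :> K by rewrite /u !natrD.
pose F C w := ph q (C + x) w / ph q (C + q - x) w.
have pwE A D w w' : pair_weight A D q x w w' =
    s (D + w'%:R * q) * s (A + w%:R * q) / (s D * s A) * (F A w * F D w').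
  by rewrite /pair_weight; congr (_ * _); rewrite /F mulf_div.
have nat_args : (forall m : nat, m.+1%:R = m%:R + 1 :> K) *
    (forall m m' : nat, (m + m')%:R = m%:R + m'%:R :> K).
  by split=> *; rewrite (natr1, natrD).
rewrite !pwE; move: lekl; case: eps; case: del => lekl;
  rewrite ?addn1 ?addn0 ?expr0 ?expr1 ?mul1r ?opprK ?mul1r ?mulN1r.
- have -> : ((l' + v).+1 + l'.+1 = u.+2)%N by rewrite /u; lia.
  have -> : ((l' + v).+1 - l'.+1 = v)%N by lia.
  have -> : s (x + - (X + (l' + v).+1%:R * q) + - (Y + l'.+1%:R * q)) = - s (X + Y + q - x +
    u.+1%:R * q) by rewrite -s_odd; congr s; rewrite !nat_args ?uE /q; ring.
  have -> : s (- (X + (l' + v).+1%:R * q) - (Y + l'.+1%:R * q)) = - s (X + Y + u.+2%:R * q) by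
    rewrite -s_odd; congr s; rewrite !nat_args ?uE /q; ring.
  have -> : s (x + (X + g + (l' + v)%:R * q) + (Y + g + l'%:R * q)) = s (X + Y + x + u.+1%:R * q)
    by congr s; rewrite !nat_args ?uE /q; ring.
  have -> : s (X + g + (l' + v)%:R * q + (Y + g + l'%:R * q)) = s (X + Y + u.+1%:R * q) by congr s;
    rewrite !nat_args ?uE /q; ring.
  have -> : X + Y + q + u%:R * q = X + Y + u.+1%:R * q.
    by rewrite !nat_args; ring.
  have := ratio_sum2 Ax u; rewrite -/(F _ _) -/(F (_ + q) _).
  have := A0 u.+1; have := A0 u.+2; move: (F (X - Y) v).
  move: (F (X + Y) u.+2) (F (X + Y + q) u) (s (X + Y + q - x + _)) (s (X + Y + x + _)).
  move: (s (X + Y + u.+1%:R * q)) (s (X + Y + u.+2%:R * q)).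
  move=> A1 A2 Fa Fb e f G A10 A20 eF.
  transitivity (s (X - Y + v%:R * q) / (s (X - Y) * s (X + Y)) * G * (Fa * e)).
    by field; rewrite ?A10 ?A20 ?d0 ?a0 ?a1 ?ax0.
  by rewrite eF; field; rewrite ?A10 ?A20 ?d0 ?a0 ?a1 ?ax0.
- have -> : ((l' + v).+1 + l' = u.+1)%N by rewrite /u; lia.
  have -> : ((l' + v).+1 - l' = v.+1)%N by lia.
  have -> : s (x - (X + (l' + v).+1%:R * q) + (Y + l'%:R * q)) = - s (X - Y + q - x + v%:R * q) by
    rewrite -s_odd; congr s; rewrite !nat_args ?uE /q; ring.
  have -> : s (- (X + (l' + v).+1%:R * q) + (Y + l'%:R * q)) = - s (X - Y + v.+1%:R * q) by rewrite
    -s_odd; congr s; rewrite !nat_args ?uE /q; ring.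
  have -> : s (x + (X + g + (l' + v)%:R * q) - (Y + g + l'%:R * q)) = s (X - Y + x + v%:R * q) by
    congr s; rewrite !nat_args ?uE /q; ring.
  have -> : s (X + g + (l' + v)%:R * q - (Y + g + l'%:R * q)) = s (X - Y + v%:R * q) by congr s;
    rewrite !nat_args ?uE /q; ring.
  have -> : X + Y + q + u%:R * q = X + Y + u.+1%:R * q.
    by rewrite !nat_args; ring.
  have := ratio_diff Dx v; rewrite -/(F _ _) -/(F (X - Y) v).
  have -> : F (X + Y) u.+1 = _ := ratio_sum1 _ _ _ _.
  rewrite -/(F _ _).
  have := A0 u.+1; have := D0 v; have := D0 v.+1.
  move: (F (X + Y + q) u) (F (X - Y) v) (F (X - Y) v.+1).
  move: (s (X - Y + q - x + _)) (s (X - Y + x + _)).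
  move: (s (X + Y + u.+1%:R * q)) (s (X - Y + v%:R * q)) (s (X - Y + v.+1%:R * q)).
  move=> A1 D1 D2 e f Fa G1 G2 D20 D10 A10 eG.
  transitivity (A1 / (s (X - Y) * s (X + Y)) * (s (X + Y + x) / s (X + Y + q - x) * Fa)
     * (G2 * e)).
    by field; rewrite ?A10 ?D10 ?D20 ?d0 ?a0 ?a1 ?ax0.
  by rewrite eG; field; rewrite ?A10 ?D10 ?D20 ?d0 ?a0 ?a1 ?ax0.
(* Only the lower row grows here, so [l <= k] excludes [v = 0], where the difference would be
   truncated. *)
- case: v lekl @u uE => [|v] lekl u uE; first by move: lekl; lia.
  have -> : ((l' + v.+1) + l'.+1 = u.+1)%N by rewrite /u; lia.
  have -> : ((l' + v.+1) - l'.+1 = v)%N by lia.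
  have -> : s (x + (X + (l' + v.+1)%:R * q) - (Y + l'.+1%:R * q)) = s (X - Y + x + v%:R * q) by
    congr s; rewrite !nat_args ?uE /q; ring.
  have -> : s (X + (l' + v.+1)%:R * q - (Y + l'.+1%:R * q)) = s (X - Y + v%:R * q) by congr s;
    rewrite !nat_args ?uE /q; ring.
  have -> : s (x - (X + g + (l' + v.+1)%:R * q) + (Y + g + l'%:R * q)) = - s (X - Y + q - x + v%:R
    * q) by rewrite -s_odd; congr s; rewrite !nat_args ?uE /q; ring.
  have -> : s (- (X + g + (l' + v.+1)%:R * q) + (Y + g + l'%:R * q)) = - s (X - Y + v.+1%:R * q) by
    rewrite -s_odd; congr s; rewrite !nat_args ?uE /q; ring.
  have -> : X + Y + q + u%:R * q = X + Y + u.+1%:R * q.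
    by rewrite !nat_args; ring.
  have := ratio_diff Dx v; rewrite -/(F _ _) -/(F (X - Y) v).
  have -> : F (X + Y) u.+1 = _ := ratio_sum1 _ _ _ _.
  rewrite -/(F _ _).
  have := A0 u.+1; have := D0 v; have := D0 v.+1.
  move: (F (X + Y + q) u) (F (X - Y) v) (F (X - Y) v.+1).
  move: (s (X - Y + q - x + _)) (s (X - Y + x + _)).
  move: (s (X + Y + u.+1%:R * q)) (s (X - Y + v%:R * q)) (s (X - Y + v.+1%:R * q)).
  move=> A1 D1 D2 e f Fa G1 G2 D20 D10 A10 eG.
  transitivity (A1 / (s (X - Y) * s (X + Y)) * (s (X + Y + x) / s (X + Y + q - x) * Fa)
     * (G1 * f)).
    by field; rewrite ?A10 ?D10 ?D20 ?d0 ?a0 ?a1 ?ax0.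
  by rewrite -eG; field; rewrite ?A10 ?D10 ?D20 ?d0 ?a0 ?a1 ?ax0.
- have -> : (l' + v - l' = v)%N by lia.
  rewrite -/u.
  have -> : s (x + (X + (l' + v)%:R * q) + (Y + l'%:R * q)) = s (X + Y + x + u%:R * q) by congr s;
    rewrite !nat_args ?uE /q; ring.
  have -> : s (X + (l' + v)%:R * q + (Y + l'%:R * q)) = s (X + Y + u%:R * q) by congr s;
    rewrite !nat_args ?uE /q; ring.
  have -> : s (x - (X + g + (l' + v)%:R * q) - (Y + g + l'%:R * q)) = - s (X + Y + q - x + u%:R *
    q) by rewrite -s_odd; congr s; rewrite !nat_args ?uE /q; ring.
  have -> : s (- (X + g + (l' + v)%:R * q) - (Y + g + l'%:R * q)) = - s (X + Y + u.+1%:R * q) by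
    rewrite -s_odd; congr s; rewrite !nat_args ?uE /q; ring.
  have -> : X + Y + q + u%:R * q = X + Y + u.+1%:R * q.
    by rewrite !nat_args; ring.
  have := ratio_sum0 Ax u; rewrite -/(F _ _) -/(F (_ + q) _).
  have := A0 u.+1; have := A0 u; move: (F (X - Y) v).
  move: (F (X + Y) u) (F (X + Y + q) u) (s (X + Y + q - x + _)) (s (X + Y + x + _)).
  move: (s (X + Y + u.+1%:R * q)) (s (X + Y + u%:R * q)).
  move=> A1 A2 Fa Fb e f G A20 A10 eF.
  transitivity (s (X - Y + v%:R * q) / (s (X - Y) * s (X + Y)) * G * (Fa * f)).
    by field; rewrite ?A10 ?A20 ?d0 ?a0 ?a1 ?ax0.
  by rewrite eF; field; rewrite ?A10 ?A20 ?d0 ?a0 ?a1 ?ax0.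
Qed.

End Weights.

(** * The recursion in the size of the box *)

Definition antitone n (f : 'I_n -> nat) := forall i j : 'I_n, (i <= j)%N -> (f j <= f i)%N.

Lemma antitoneP n (f : 'I_n -> nat) :
  (forall i j : 'I_n, j = i.+1 :> nat -> (f j <= f i)%N) -> antitone f.
Proof.
move=> fS i j; move dk: (j - i)%N => k; elim: k j dk => [|k IH] j dk leij.
  by have -> : j = i by apply: val_inj => /=; lia.
have jn : (j.-1 < n)%N by have := ltn_ord j; lia.
apply: leq_trans (IH (Ordinal jn) _ _) => /=; [|lia|lia].
by apply: fS => /=; lia.
Qed.

Lemma inLambdaP n N (lam : {ffun 'I_n -> 'I_N.+1}) :
  reflect (antitone (fun i => lam i : nat)) (inLambda lam).
Proof.
apply: (iffP forallP) => [H i j leij|H i]; last first.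
  by apply/forallP => j; apply/implyP; exact: H.
by have /forallP/(_ j)/implyP := H i; exact.
Qed.

Definition add_strip n N (S : {set 'I_n}) (lam : {ffun 'I_n -> 'I_N.+1}) :
  {ffun 'I_n -> 'I_N.+2} := [ffun i => inord (lam i + (i \in S))].
Definition sub_strip n N (S : {set 'I_n}) (lam : {ffun 'I_n -> 'I_N.+2}) :
  {ffun 'I_n -> 'I_N.+1} := [ffun i => inord (lam i - (i \in S))].

Lemma add_stripE n N (S : {set 'I_n}) (lam : {ffun 'I_n -> 'I_N.+1}) i :
  add_strip S lam i = (lam i + (i \in S))%N :> nat.
Proof. by rewrite ffunE inordK //; have := ltn_ord (lam i); case: (i \in S); lia. Qed.

Lemma add_stripK n N (S : {set 'I_n}) : cancel (@add_strip n N S) (@sub_strip n N S).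
Proof.
move=> lam; apply/ffunP => i; apply: val_inj; rewrite ffunE add_stripE addnK.
by rewrite /= inord_val.
Qed.

(** Adding a strip always fits in the larger box, but after a removal a row may still be too long
    for the smaller one, and [inord] then returns its default value. *)
Lemma sub_stripE n N (S : {set 'I_n}) (lam : {ffun 'I_n -> 'I_N.+2}) i :
  (lam i - (i \in S) <= N)%N -> sub_strip S lam i = (lam i - (i \in S))%N :> nat.
Proof. by move=> leN; rewrite ffunE inordK. Qed.

Section Recursion.
Variables (K : numFieldType) (s : K -> K).
Local Notation psi x y := (s (x + y) * s (x - y)).
Hypothesis s_odd : forall u, s (- u) = - s u.
Hypothesis s_add : forall x y u v,
  psi x y * psi u v - psi x u * psi y v + psi x v * psi y u = 0.

(* The balancing condition makes [e] an integral combination of the other parameters. *)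
Definition generic (a b c d q x : K) := forall ka kb kc kd kq kx : int,
  [|| ka != 0, kb != 0, kc != 0, kd != 0, kq != 0 | kx != 0] ->
  s (ka%:~R * a + kb%:~R * b + kc%:~R * c + kd%:~R * d + kq%:~R * q + kx%:~R * x) != 0.

(** Replacing [a] by [a + q] is a unimodular change of the integral coefficients. *)
Lemma generic_shift a b c d q x : generic a b c d q x -> generic (a + q) b c d q x.
Proof.
move=> G ka kb kc kd kq kx nz.
have := G ka kb kc kd (kq + ka) kx; rewrite intrD.
have -> : ka%:~R * a + kb%:~R * b + kc%:~R * c + kd%:~R * d + (kq%:~R + ka%:~R) * q +
   kx%:~R * x = ka%:~R * (a + q) + kb%:~R * b + kc%:~R * c + kd%:~R * d + kq%:~R * q
   + kx%:~R * x by ring.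
apply; move: nz; have [->|//] := eqVneq ka 0.
by rewrite addr0.
Qed.

(** The coefficients of [q] and [x] are differences of natural numbers, the form in which rows and
    indices produce them, so that the equation for [u] is within reach of [ring]. *)
Lemma generic_neq0 a b c d q x (ka kb kc kd : int) (p1 p2 p3 p4 : nat) u :
  generic a b c d q x ->
  u = ka%:~R * a + kb%:~R * b + kc%:~R * c + kd%:~R * d
      + (p1%:R * q - p2%:R * q) + (p3%:R * x - p4%:R * x) ->
  [|| ka != 0, kb != 0, kc != 0, kd != 0, p1 != p2 | p3 != p4] -> s u != 0.
Proof.
move=> G -> nz; have := G ka kb kc kd (p1%:Z - p2%:Z) (p3%:Z - p4%:Z).
by rewrite !intrB -!pmulrn !mulrBl !subr_eq0; apply.
Qed.

(** For a fixed larger index [n] of the pair, the product over [i < n] telescopes to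
    [G (n + n) / G n]. This evaluates the pair product at the empty partition. *)
Lemma prod_pairs_telescope n (G : nat -> K) : (forall m, G m != 0) ->
  \prod_(i < n) (G (i + i)%N)^-1 *
  \prod_(i < n) \prod_(j < n | (i < j)%N) (G (i + j).+1 / G (i + j)%N) =
  \prod_(i < n) (G i)^-1.
Proof.
move=> G0; elim: n => [|n IH]; first by rewrite !big_ord0 mulr1.
rewrite !big_ord_recr /= -IH.
rewrite [X in _ * (_ * X)]big_pred0 ?mulr1 => [|i]; last first.
  by have := ltn_ord i; rewrite ltnS leqNgt => /negbTE.
under [X in _ * X = _]eq_bigr => i _ do rewrite big_mkcond big_ord_recr /= ltn_ord -big_mkcond.
rewrite big_split /=.
have tel m : \prod_(i < m) (G (i + n).+1 / G (i + n)%N) = G (m + n)%N / G n.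
  elim: m => [|m IHm]; first by rewrite big_ord0 mulfV.
  rewrite big_ord_recr /= IHm addSn; have := G0 (m + n)%N; have := G0 n.
  by move: (G n) (G (m + n)%N) => u v u0 v0; field; rewrite u0 v0.
rewrite tel; have := G0 n; have := G0 (n + n)%N.
by move: (G n) (G (n + n)%N) => u v v0 u0; field; rewrite u0 v0.
Qed.

(** * One step: from height [N + 1] to height [N] *)

Section Step.
Variables (n N : nat) (h b c d e g x : K).
Let q := g + g.
Let a := h + h.
Hypothesis n_gt0 : (0 < n)%N.
Hypothesis eE : e = 2%:R * a + N.+2%:R * q - (n%:R * x - x) - b - c - d.
Hypothesis gen : generic a b c d q x.

Definition z_of (k : 'I_n -> nat) (i : 'I_n) : K := h - i%:R * x + (k i)%:R * q.
Definition z'_of (k : 'I_n -> nat) (i : 'I_n) : K := h + g - i%:R * x + (k i)%:R * q.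

(* [S] is the set of rows of the vertical strip [lam / lam'].  In logarithmic coordinates
   [z_of lam] and [z'_of lam'] differ by [+- g], so that one and the same family of strips is
   summed over [lam'] at fixed [lam] by [lower_term], and over [lam] at fixed [lam'] by
   [raise_term]. *)
Definition lower_term (S : {set 'I_n}) (k : 'I_n -> nat) : K :=
  bc_term s setT x (h - (n%:R * x - x)) (- (N.+1%:R * q) - h) (e - h)
    (N.+1%:R * q + h - e) (flip (z_of k) (~: S)).
Definition raise_term (S : {set 'I_n}) (k : 'I_n -> nat) : K :=
  bc_term s setT x (b - h - g) (c - h - g) (d - h - g) (e - h - N.+1%:R * q + g)
    (flip (z'_of k) S).

Definition step_factor : K :=
  \prod_(i < n) single_factor s n N.+1 a b c d e q x i *
  \prod_(i < n) \prod_(j < n | (i < j)%N)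
    (s (a - i%:R * x - j%:R * x + x) * s (a - i%:R * x - j%:R * x + q) /
     (s (a - i%:R * x - j%:R * x) * s (a - i%:R * x - j%:R * x + q - x))).

(** Both sides factor over rows and over pairs and are compared factor by factor; monotonicity of
    the two partitions gives the inequalities that the truncated differences require. *)
Lemma weight_shift (S : {set 'I_n}) (k' k : 'I_n -> nat) :
  antitone k' -> antitone k -> (forall i, k i = k' i + (i \in S))%N ->
  weight s N.+1 a b c d e q x k * lower_term S k =
  step_factor * (weight s N (a + q) b c d (e + q) q x k' * raise_term S k').
Proof.
move=> mono' mono kE.
have bcE t t0 t1 t2 t3 y : bc_term s [set: 'I_n] t t0 t1 t2 t3 y =
  \prod_(i < n) (s (t0 + y i) * s (t1 + y i) * s (t2 + y i) * s (t3 + y i) / s (y i + y i))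
  * \prod_(i < n) \prod_(j < n | (i < j)%N) (s (t + y i + y j) / s (y i + y j)).
  rewrite /bc_term /bc_pairs; congr (_ * _); first by apply: eq_bigl => i; rewrite inE.
  apply: eq_big => [i|i _]; first by rewrite inE.
  by apply: eq_bigl => j; rewrite inE.
rewrite /lower_term /raise_term !bcE /weight /step_factor.
rewrite [LHS]mulrACA [X in _ = _ * X]mulrACA [RHS]mulrACA -!big_split /=.
have flip_lower i : flip (z_of k) (~: S) i =
    (-1) ^+ (i \in S) * (h - i%:R * x + (k' i + (i \in S))%:R * q).
  by rewrite /flip inE -kE /z_of; case: (i \in S); rewrite /= ?expr0 ?expr1 ?mul1r ?mulN1r.
have flip_raise i : flip (z'_of k') S i =
    - (-1) ^+ (i \in S) * (h + g - i%:R * x + (k' i)%:R * q).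
  by rewrite /flip /z'_of; case: (i \in S); rewrite /= ?expr0 ?expr1 ?opprK ?mul1r ?mulN1r.
apply: eq_bigr => i _; congr (_ * _).
  rewrite !flip_lower !flip_raise kE.
  apply: single_weight_shift => // [m|r m].
    apply: (generic_neq0 (ka := 1) (kb := 0) (kc := 0) (kd := 0) (p1 := m) (p2 := 0)
      (p3 := 0) (p4 := i + i) gen) => //.
    by rewrite /a /q natrD; ring.
  rewrite !inE => /or4P[/eqP ->|/eqP ->|/eqP ->|/or3P[/eqP ->|/eqP ->|/eqP ->]].
  - apply: (generic_neq0 (ka := 0) (kb := 0) (kc := 0) (kd := 0) (p1 := m.+1) (p2 := 0)
      (p3 := n) (p4 := i.+1) gen) => //.
    by rewrite /a /q -!natr1; ring.
  - apply: (generic_neq0 (ka := 1) (kb := -1) (kc := 0) (kd := 0) (p1 := m.+1) (p2 := 0)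
      (p3 := 0) (p4 := i) gen) => //.
    by rewrite /a /q -!natr1; ring.
  - apply: (generic_neq0 (ka := 1) (kb := 0) (kc := -1) (kd := 0) (p1 := m.+1) (p2 := 0)
      (p3 := 0) (p4 := i) gen) => //.
    by rewrite /a /q -!natr1; ring.
  - apply: (generic_neq0 (ka := 1) (kb := 0) (kc := 0) (kd := -1) (p1 := m.+1) (p2 := 0)
      (p3 := 0) (p4 := i) gen) => //.
    by rewrite /a /q -!natr1; ring.
  - apply: (generic_neq0 (ka := -1) (kb := 1) (kc := 1) (kd := 1) (p1 := m.+1) (p2 := N.+2)
      (p3 := n) (p4 := i.+1) gen) => //.
    by rewrite eE /a /q -!natr1; ring.
  - apply: (generic_neq0 (ka := 1) (kb := 0) (kc := 0) (kd := 0) (p1 := m + N.+2) (p2 := 0)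
      (p3 := 0) (p4 := i) gen) => //.
    by rewrite /a /q natrD -!natr1; ring.
rewrite -!big_split /=; apply: eq_bigr => j ltij.
rewrite !flip_lower !flip_raise !kE.
have -> : a - i%:R * x - j%:R * x = (h - i%:R * x) + (h - j%:R * x) by rewrite /a; ring.
have -> : j%:R * x - i%:R * x = (h - i%:R * x) - (h - j%:R * x) by rewrite /a; ring.
have -> : a + q - i%:R * x - j%:R * x = (h - i%:R * x) + (h - j%:R * x) + q by rewrite /a; ring.
have hgE l : h + g - l%:R * x = h - l%:R * x + g by ring.
rewrite !hgE.
apply: pair_weight_shift => // [m|m|m|m||].
- apply: (generic_neq0 (ka := 1) (kb := 0) (kc := 0) (kd := 0) (p1 := m) (p2 := 0)
    (p3 := 0) (p4 := i + j) gen) => //.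
  by rewrite /a /q natrD; ring.
- apply: (generic_neq0 (ka := 0) (kb := 0) (kc := 0) (kd := 0) (p1 := m) (p2 := 0)
    (p3 := j) (p4 := i) gen); first by rewrite /q; ring.
  by rewrite (gtn_eqF ltij) !orbT.
- apply: (generic_neq0 (ka := 1) (kb := 0) (kc := 0) (kd := 0) (p1 := m.+1) (p2 := 0)
    (p3 := 0) (p4 := (i + j).+1) gen) => //.
  by rewrite /a /q -!natr1 natrD; ring.
- apply: (generic_neq0 (ka := 0) (kb := 0) (kc := 0) (kd := 0) (p1 := m.+1) (p2 := 0)
    (p3 := j) (p4 := i.+1) gen) => //.
  by rewrite /q -!natr1; ring.
- by apply: mono'; apply: ltnW.
- by rewrite -!kE; apply: mono; apply: ltnW.
Qed.

Lemma z_ofD_neq0 k i j : s (z_of k i + z_of k j) != 0.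
Proof.
apply: (generic_neq0 (ka := 1) (kb := 0) (kc := 0) (kd := 0) (p1 := k i + k j) (p2 := 0)
  (p3 := 0) (p4 := i + j) gen) => //.
by rewrite /z_of /a /q !natrD; ring.
Qed.

Lemma z'_ofD_neq0 k i j : s (z'_of k i + z'_of k j) != 0.
Proof.
apply: (generic_neq0 (ka := 1) (kb := 0) (kc := 0) (kd := 0) (p1 := (k i + k j).+1) (p2 := 0)
  (p3 := 0) (p4 := i + j) gen) => //.
by rewrite /z'_of /a /q -natr1 !natrD; ring.
Qed.

Lemma z_ofB_neq0 k i j : i != j -> s (z_of k i - z_of k j) != 0.
Proof.
move=> nij; apply: (generic_neq0 (ka := 0) (kb := 0) (kc := 0) (kd := 0) (p1 := k i)
  (p2 := k j) (p3 := j) (p4 := i) gen); first by rewrite /z_of /q; ring.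
have -> : (j : nat) != i by rewrite eq_sym; exact: nij.
by rewrite !orbT.
Qed.

Lemma z'_ofB_neq0 k i j : i != j -> s (z'_of k i - z'_of k j) != 0.
Proof.
move=> nij; rewrite /z'_of; have := z_ofB_neq0 k nij; rewrite /z_of.
by congr (s _ != 0); ring.
Qed.

(** The parameters of [lower_term] satisfy the balancing of [bc_sumE] identically; for those of
    [raise_term] it amounts to [eE]. *)
Lemma sum_lower_term k :
  \sum_(S : {set 'I_n}) lower_term S k =
  \prod_(i < n) (s (i%:R * x + (h - (n%:R * x - x)) + (- (N.+1%:R * q) - h)) *
    s (i%:R * x + (h - (n%:R * x - x)) + (e - h)) *
    s (i%:R * x + (h - (n%:R * x - x)) + (N.+1%:R * q + h - e))).
Proof.
have := @bc_sumE _ _ s_odd s_add n (z_of k) setT x (h - (n%:R * x - x))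
  (- (N.+1%:R * q) - h) (e - h) (N.+1%:R * q + h - e).
rewrite cardsT card_ord => <-.
- rewrite (reindex_inj (@setC_inj _)) /=; apply: eq_big => [S|S _]; first by rewrite subsetT.
  by rewrite /lower_term setCK.
- exact: z_ofD_neq0.
- by move=> i j; apply: z_ofB_neq0.
- move=> m i j.
  apply: (generic_neq0 (ka := 2) (kb := -1) (kc := -1) (kd := -1) (p1 := (k i + k j).+1) (p2 := 0)
    (p3 := 0) (p4 := m + (i + j)) gen) => //.
  by rewrite /z_of eE /a /q -!natr1 !natrD; ring.
- move=> m i j.
  apply: (generic_neq0 (ka := 1) (kb := -1) (kc := -1) (kd := -1) (p1 := (k i).+1) (p2 := k j)
    (p3 := j) (p4 := m + i) gen) => //.
  by rewrite /z_of eE /a /q -!natr1 !natrD; ring.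
- by ring.
Qed.

Lemma sum_raise_term k :
  \sum_(S : {set 'I_n}) raise_term S k =
  \prod_(i < n) (s (i%:R * x + (b - h - g) + (c - h - g)) *
    s (i%:R * x + (b - h - g) + (d - h - g)) *
    s (i%:R * x + (b - h - g) + (e - h - N.+1%:R * q + g))).
Proof.
have := @bc_sumE _ _ s_odd s_add n (z'_of k) setT x (b - h - g) (c - h - g) (d - h - g)
  (e - h - N.+1%:R * q + g).
rewrite cardsT card_ord => <-.
- by apply: eq_big => [S|S _]; first by rewrite subsetT.
- exact: z'_ofD_neq0.
- by move=> i j; apply: z'_ofB_neq0.
- move=> m i j.
  apply: (generic_neq0 (ka := 0) (kb := 0) (kc := 1) (kd := 1) (p1 := k i + k j) (p2 := 0)
    (p3 := n) (p4 := (m + (i + j)).+1) gen) => //.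
  by rewrite /z'_of eE /a /q -!natr1 !natrD; ring.
- move=> m i j.
  apply: (generic_neq0 (ka := -1) (kb := 0) (kc := 1) (kd := 1) (p1 := k i) (p2 := (k j).+1)
    (p3 := n + j) (p4 := (m + i).+1) gen) => //.
  by rewrite /z'_of eE /a /q -!natr1 !natrD; ring.
- by rewrite eE /a /q -!natr1; ring.
Qed.

(* The pair factor vanishes as soon as adding the strip breaks the monotonicity. *)
Lemma raise_term_neq0 (S : {set 'I_n}) k :
  antitone k -> raise_term S k != 0 -> antitone (fun i => k i + (i \in S))%N.
Proof.
move=> mono R0; apply: antitoneP => i j ji; rewrite leqNgt; apply: contraNN R0 => lt.
have := mono i j; rewrite ji leqnSn => /(_ isT) lekk.
have [kk iS jS] : [/\ k j = k i, i \notin S & j \in S].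
  by move: lt lekk; case: (i \in S); case: (j \in S); split => //; lia.
rewrite /raise_term /bc_term mulf_eq0; apply/orP; right.
rewrite /bc_pairs (bigD1 i) ?inE //= (bigD1 j) ?inE ?ji //=.
have -> : x + flip (z'_of k) S i + flip (z'_of k) S j = 0.
  by rewrite /flip (negbTE iS) jS /z'_of kk ji -natr1; ring.
by rewrite s0 // !(mul0r, mulr0).
Qed.

(** [k i + (i \notin S)] is one more than the row left after removal, which avoids truncated
    subtraction. The pair factor enforces monotonicity. The parameter [h - (n%:R * x - x)] kills
    removal from an empty last row, and [- (N.+1%:R * q) - h] kills keeping a first row of full
    length [N.+1]; so the strip sum itself confines the partitions to the smaller box. *)
Lemma lower_term_neq0 (S : {set 'I_n}) k :
  antitone k -> (forall i, k i <= N.+1)%N -> lower_term S k != 0 ->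
  antitone (fun i => k i + (i \notin S))%N /\
  (forall i, 0 < k i + (i \notin S) <= N.+1)%N.
Proof.
move=> mono leN Q0.
have mono' : antitone (fun i => k i + (i \notin S))%N.
  apply: antitoneP => i j ji; rewrite leqNgt; apply: contraNN Q0 => lt.
  have := mono i j; rewrite ji leqnSn => /(_ isT) lekk.
  have [kk iS jS] : [/\ k j = k i, i \in S & j \notin S].
    by move: lt lekk; case: (i \in S); case: (j \in S); split => //; lia.
  rewrite /lower_term /bc_term mulf_eq0; apply/orP; right.
  rewrite /bc_pairs (bigD1 i) ?inE //= (bigD1 j) ?inE ?ji //=.
  have -> : x + flip (z_of k) (~: S) i + flip (z_of k) (~: S) j = 0.
    by rewrite /flip !inE iS jS /= /z_of kk ji -natr1; ring.
  by rewrite s0 // !(mul0r, mulr0).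
have n1 : (n.-1 < n)%N by rewrite prednK.
have last_gt0 : (0 < k (Ordinal n1) + (Ordinal n1 \notin S))%N.
  rewrite lt0n; apply: contraNneq Q0 => /eqP; rewrite addn_eq0 eqb0 negbK => /andP[/eqP k0 nS].
  rewrite /lower_term /bc_term (bigD1 (Ordinal n1)) ?inE //=.
  have -> : h - (n%:R * x - x) + flip (z_of k) (~: S) (Ordinal n1) = 0.
    rewrite /flip inE nS /= /z_of k0 /= -[in n%:R](prednK n_gt0) -natr1; ring.
  by rewrite s0 // !(mul0r, mulr0).
have first_le : (k (Ordinal n_gt0) + (Ordinal n_gt0 \notin S) <= N.+1)%N.
  rewrite leqNgt; apply: contraNN Q0 => lt.
  have [k0 nS] : k (Ordinal n_gt0) = N.+1 /\ Ordinal n_gt0 \notin S.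
    by move: lt (leN (Ordinal n_gt0)); case: (_ \in S); split => //=; lia.
  rewrite /lower_term /bc_term (bigD1 (Ordinal n_gt0)) ?inE //=.
  have -> : - (N.+1%:R * q) - h + flip (z_of k) (~: S) (Ordinal n_gt0) = 0.
    by rewrite /flip inE nS /= /z_of k0 /=; ring.
  by rewrite s0 // !(mul0r, mulr0).
split=> // i; apply/andP; split.
  by apply: leq_trans last_gt0 (mono' i _ _) => /=; have := ltn_ord i; lia.
by apply: leq_trans (mono' (Ordinal n_gt0) i _) first_le.
Qed.

(** For a fixed [S], adding and removing the strip are inverse to each other on the partitions for
    which the result is again a partition in the box. All other terms vanish by [lower_term_neq0]
    and [raise_term_neq0]. *)
Lemma weight_shift_sum (S : {set 'I_n}) :
  \sum_(lam : {ffun 'I_n -> 'I_N.+2} | inLambda lam)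
     weight s N.+1 a b c d e q x (fun i => lam i) * lower_term S (fun i => lam i) =
  \sum_(lam : {ffun 'I_n -> 'I_N.+1} | inLambda lam)
     step_factor * (weight s N (a + q) b c d (e + q) q x (fun i => lam i) *
                    raise_term S (fun i => lam i)).
Proof.
pose good (lam : {ffun 'I_n -> 'I_N.+2}) := inLambda (sub_strip S lam) &&
  [forall i, ((i \in S) <= lam i)%N && (lam i - (i \in S) <= N)%N].
rewrite (bigID good) /= [X in _ + X]big1 ?addr0 => [|lam /andP[Llam bad]]; last first.
  apply/eqP; rewrite mulf_eq0; apply/orP; right; apply: contraNT bad => Q0.
  have [|mono rng] := lower_term_neq0 (inLambdaP _ Llam) _ Q0.
    by move=> i; rewrite -ltnS ltn_ord.
  have rng' i : ((i \in S) <= lam i)%N && (lam i - (i \in S) <= N)%N.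
    by have := rng i; case: (i \in S) => /=; lia.
  apply/andP; split; last by apply/forallP.
  apply/inLambdaP => i j leij; have := mono i j leij.
  have /andP[? ?] := rng' i; have /andP[? ?] := rng' j; rewrite !sub_stripE //.
  by have := rng' i; have := rng' j; case: (i \in S); case: (j \in S) => /=; lia.
rewrite [RHS](bigID (fun lam => inLambda (add_strip S lam))) /=.
rewrite [X in _ = _ + X]big1 ?addr0 => [|lam /andP[Llam bad]]; last first.
  apply/eqP; rewrite mulf_eq0; apply/orP; right; rewrite mulf_eq0; apply/orP; right.
  apply: contraNT bad => R0; have mono := raise_term_neq0 (inLambdaP _ Llam) R0.
  by apply/inLambdaP => i j leij; rewrite !add_stripE; apply: mono.
rewrite (reindex_onto (@add_strip n N S) (@sub_strip n N S)) /=; last first.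
  move=> lam /andP[_ /andP[_ /forallP rng]]; apply/ffunP => i; apply: val_inj.
  by have /andP[ge le] := rng i; rewrite /= add_stripE sub_stripE // subnK.
have goodE lam : (inLambda (add_strip S lam) && good (add_strip S lam)) &&
    (sub_strip S (add_strip S lam) == lam) = inLambda lam && inLambda (add_strip S lam).
  rewrite /good add_stripK eqxx andbT andbCA; congr (_ && _); rewrite andbC.
  case: (inLambda _); rewrite ?andbF // andbT; apply/forallP => i.
  by rewrite add_stripE addnK leq_addl -ltnS ltn_ord.
rewrite (eq_bigl _ _ goodE); apply: eq_bigr => lam /andP[Llam Lalam].
by apply: weight_shift; [apply/inLambdaP | apply/inLambdaP | move=> i; rewrite add_stripE].
Qed.

Lemma weight0 M a1 e1 (k : 'I_n -> nat) :
  (forall i, k i = 0%N) -> (forall i j : 'I_n, s (a1 - i%:R * x - j%:R * x) != 0) ->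
  weight s M a1 b c d e1 q x k = 1.
Proof.
move=> k0 a0; rewrite /weight !big1 ?mulr1 // => i _; rewrite !k0.
  rewrite big1 // => j ltij; rewrite k0 /pair_weight subnn addn0 /ph !big_ord0 !mul0r !addr0.
  rewrite mulr1 invr1 !mulr1 mulfV // mulf_neq0 //.
  apply: (generic_neq0 (ka := 0) (kb := 0) (kc := 0) (kd := 0) (p1 := 0)
    (p2 := 0) (p3 := j) (p4 := i) gen); first by ring.
  by rewrite (gtn_eqF ltij) !orbT.
rewrite /single_weight big1 ?mulr1 => [|r _]; last by rewrite /ph !big_ord0 invr1 mulr1.
by rewrite !mul0r !addr0 mulfV.
Qed.

(* Both sums over strips are independent of the partition; the constants are fixed by
   evaluating at the empty partition. *)
Lemma sum_step :
  raise_term set0 (fun=> 0%N) != 0 /\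
  (\sum_(lam : {ffun 'I_n -> 'I_N.+2} | inLambda lam)
     weight s N.+1 a b c d e q x (fun i => lam i)) * raise_term set0 (fun=> 0%N) =
  (\sum_(lam : {ffun 'I_n -> 'I_N.+1} | inLambda lam)
     weight s N (a + q) b c d (e + q) q x (fun i => lam i)) *
  \prod_(i < n) (s (i%:R * x + (b - h - g) + (c - h - g)) *
    s (i%:R * x + (b - h - g) + (d - h - g)) *
    s (i%:R * x + (b - h - g) + (e - h - N.+1%:R * q + g))).
Proof.
set SN1 := (X in X * _ = _); set SN := (X in _ = X * _); set K1 := \prod_(i < n) _.
set K2 := \prod_(i < n) (s (i%:R * x + (h - (n%:R * x - x)) + (- (N.+1%:R * q) - h)) *
    s (i%:R * x + (h - (n%:R * x - x)) + (e - h)) *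
    s (i%:R * x + (h - (n%:R * x - x)) + (N.+1%:R * q + h - e))).
have K20 : K2 != 0.
  apply/prodf_neq0 => i _; rewrite !mulf_neq0 //.
  - apply: (generic_neq0 (ka := 0) (kb := 0) (kc := 0) (kd := 0) (p1 := 0)
      (p2 := N.+1) (p3 := i.+1) (p4 := n) gen) => //; by rewrite -!natr1; ring.
  - apply: (generic_neq0 (ka := 2) (kb := -1) (kc := -1) (kd := -1) (p1 := N.+2)
      (p2 := 0) (p3 := i.+2) (p4 := n + n) gen) => //.
    by rewrite eE /a /q natrD -!natr1; ring.
  - apply: (generic_neq0 (ka := -1) (kb := 1) (kc := 1) (kd := 1) (p1 := 0)
      (p2 := 1) (p3 := i) (p4 := 0) gen) => //.
    by rewrite eE /a /q -!natr1; ring.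
have K2E k : K2 = \sum_S lower_term S k by rewrite sum_lower_term.
have K1E k : K1 = \sum_S raise_term S k by rewrite sum_raise_term.
have eqA : SN1 * K2 = step_factor * (SN * K1).
  rewrite /SN1 /SN !mulr_suml mulr_sumr.
  under eq_bigr => lam _ do rewrite (K2E (fun i => lam i)) mulr_sumr.
  under [RHS]eq_bigr => lam _ do rewrite (K1E (fun i => lam i)) !mulr_sumr.
  rewrite exchange_big [RHS]exchange_big; apply: eq_bigr => S _.
  exact: weight_shift_sum.
(* From the empty partition only the empty strip can be removed, so a single term survives. *)
have eqB : K2 = lower_term set0 (fun=> 0%N).
  rewrite (K2E (fun=> 0%N)) (bigD1 set0) //= big1 ?addr0 // => S.
  apply: contraNeq => Q0.
  have [||_ rng] := lower_term_neq0 _ _ Q0; [by [] | by [] |].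
  apply/eqP/setP => i; rewrite in_set0; have := rng i.
  by case: (i \in S).
(* [weight_shift] between two empty partitions determines [step_factor] without expanding it; as
   [K2 != 0], neither factor on the right vanishes. *)
have eqC : K2 = step_factor * raise_term set0 (fun=> 0%N).
  have := @weight_shift set0 (fun=> 0%N) (fun=> 0%N).
  rewrite -eqB !weight0 ?mul1r // => [|i j|i j]; first apply=> //.
  - by move=> i; rewrite in_set0.
  - apply: (generic_neq0 (ka := 1) (kb := 0) (kc := 0) (kd := 0) (p1 := 1)
      (p2 := 0) (p3 := 0) (p4 := i + j) gen) => //.
    by rewrite /a /q natrD; ring.
  - apply: (generic_neq0 (ka := 1) (kb := 0) (kc := 0) (kd := 0) (p1 := 0)
      (p2 := 0) (p3 := 0) (p4 := i + j) gen) => //.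
    by rewrite /a /q natrD; ring.
have [f0 r0] : step_factor != 0 /\ raise_term set0 (fun=> 0%N) != 0.
  by move: K20; rewrite eqC mulf_eq0 negb_or => /andP.
split=> //; apply: (mulfI f0).
by rewrite mulrCA -eqC eqA.
Qed.

(** At the empty partition [y_i + y_j = - (a + q - (i + j) x)] depends on [i + j] only, so the pair
    factors together with the denominators [s (y_i + y_i)] telescope. *)
Lemma raise_term0 : raise_term set0 (fun=> 0%N) =
  \prod_(i < n) (s (a + q - b - i%:R * x) * s (a + q - c - i%:R * x) *
    s (a + q - d - i%:R * x) * s (a + q - b - c - d - i%:R * x) /
    s (a + q - i%:R * x)).
Proof.
pose G (m : nat) := s (a + q - m%:R * x).
have G0 m : G m != 0.
  apply: (generic_neq0 (ka := 1) (kb := 0) (kc := 0) (kd := 0) (p1 := 1) (p2 := 0)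
    (p3 := 0) (p4 := m) gen) => //.
  by rewrite /a /q; ring.
have yE i : flip (z'_of (fun=> 0%N)) set0 i = - (h + g - i%:R * x).
  by rewrite /flip in_set0 /z'_of mul0r addr0.
have sE u v : u = - v -> s u = - s v by move=> ->.
rewrite /raise_term /bc_term.
rewrite (eq_bigr (fun i : 'I_n => (s (a + q - b - i%:R * x) * s (a + q - c - i%:R * x) *
    s (a + q - d - i%:R * x)) * s (a + q - b - c - d - (n - i.+1)%:R * x) *
    (G (i + i)%N)^-1)) /=; last first.
  move=> i _; rewrite !yE (sE _ (a + q - b - i%:R * x)); last by rewrite /a /q; ring.
  rewrite (sE (c - h - g - (h + g - i%:R * x)) (a + q - c - i%:R * x)); last by rewrite /a /q; ring.
  rewrite (sE (d - h - g - (h + g - i%:R * x)) (a + q - d - i%:R * x)); last by rewrite /a /q; ring.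
  rewrite (sE (- (h + g - i%:R * x) - (h + g - i%:R * x)) (a + q - (i + i)%:R * x));
    last by rewrite /a /q natrD; ring.
  have -> : e - h - N.+1%:R * q + g - (h + g - i%:R * x) =
      a + q - b - c - d - (n - i.+1)%:R * x.
    by rewrite natrB // eE /a /q -!natr1; ring.
  by rewrite /G invrN; ring.
rewrite big_split [X in X * _ * _]big_split /= -mulrA.
have -> : \prod_(i in [set: 'I_n]) (G (i + i)%N)^-1 * bc_pairs s [set: 'I_n] x
     (flip (z'_of (fun=> 0%N)) set0) = \prod_(i < n) (G i)^-1.
  rewrite -(prod_pairs_telescope n G0) /bc_pairs; congr (_ * _).
    by apply: eq_bigl => i; rewrite inE.
  apply: eq_big => [i|i _]; first by rewrite inE.
  apply: eq_big => [j|j _]; first by rewrite inE.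
  rewrite !yE (sE _ (a + q - (i + j).+1%:R * x)); last by rewrite /a /q -natr1 natrD; ring.
  rewrite (sE (- (h + g - i%:R * x) - (h + g - j%:R * x)) (a + q - (i + j)%:R * x));
    last by rewrite /a /q natrD; ring.
  by rewrite invrN mulrNN.
rewrite [X in _ * X * _](reindex_inj rev_ord_inj) /=.
under [X in X * _ * _]eq_bigl => i do rewrite inE.
under [X in _ * X * _]eq_bigl => i do rewrite inE.
rewrite -!big_split /=; apply: eq_bigr => i _.
by have -> : (n - (n - i.+1).+1 = i)%N by have := ltn_ord i; lia.
Qed.

Lemma prod_raise : \prod_(i < n) (s (i%:R * x + (b - h - g) + (c - h - g)) *
    s (i%:R * x + (b - h - g) + (d - h - g)) *
    s (i%:R * x + (b - h - g) + (e - h - N.+1%:R * q + g))) =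
  \prod_(i < n) (s (a + q - b - c - i%:R * x) * s (a + q - b - d - i%:R * x) *
     s (a + q - c - d - i%:R * x)).
Proof.
have sE u v : u = - v -> s u = - s v by move=> ->.
rewrite [LHS]big_split [RHS]big_split /=; congr (_ * _).
  apply: eq_bigr => i _.
  rewrite (sE _ (a + q - b - c - i%:R * x)); last by rewrite /a /q; ring.
  rewrite (sE (i%:R * x + (b - h - g) + (d - h - g)) (a + q - b - d - i%:R * x)) ?mulrNN //;
    by rewrite /a /q; ring.
(* By the balancing, the factor [i] of one side is the factor [n - 1 - i] of the other. *)
rewrite [LHS](reindex_inj rev_ord_inj) /=; apply: eq_bigr => i _; congr s.
by rewrite natrB // eE /a /q -!natr1; ring.
Qed.

End Step.

(** * The closed product and the induction on the height *)

Definition jackson_product (n N : nat) (a b c d q x : K) : K :=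
  \prod_(i < n)
    (ph s q (a + q - i%:R * x) N * ph s q (a + q - b - c - i%:R * x) N *
     ph s q (a + q - b - d - i%:R * x) N * ph s q (a + q - c - d - i%:R * x) N /
     (ph s q (a + q - b - i%:R * x) N * ph s q (a + q - c - i%:R * x) N *
      ph s q (a + q - d - i%:R * x) N * ph s q (a + q - b - c - d - i%:R * x) N)).

Lemma jackson_productS n N a b c d q x :
  jackson_product n N.+1 a b c d q x =
  \prod_(i < n) (s (a + q - i%:R * x) * (s (a + q - b - c - i%:R * x) *
     s (a + q - b - d - i%:R * x) * s (a + q - c - d - i%:R * x)) /
    (s (a + q - b - i%:R * x) * s (a + q - c - i%:R * x) *
     s (a + q - d - i%:R * x) * s (a + q - b - c - d - i%:R * x))) *
  jackson_product n N (a + q) b c d q x.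
Proof.
rewrite /jackson_product -big_split /=; apply: eq_bigr => i _.
rewrite !phSl.
have -> : a + q - i%:R * x + q = a + q + q - i%:R * x by ring.
have -> : a + q - b - c - i%:R * x + q = a + q + q - b - c - i%:R * x by ring.
have -> : a + q - b - d - i%:R * x + q = a + q + q - b - d - i%:R * x by ring.
have -> : a + q - c - d - i%:R * x + q = a + q + q - c - d - i%:R * x by ring.
have -> : a + q - b - i%:R * x + q = a + q + q - b - i%:R * x by ring.
have -> : a + q - c - i%:R * x + q = a + q + q - c - i%:R * x by ring.
have -> : a + q - d - i%:R * x + q = a + q + q - d - i%:R * x by ring.
have -> : a + q - b - c - d - i%:R * x + q = a + q + q - b - c - d - i%:R * x by ring.
by rewrite mulf_div; congr (_ / _); ring.
Qed.

(** [a] and [q] are given by their halves, in which [z_of] and [z'_of] are written. The induction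
    replaces [(h, e)] by [(h + g, e + q)], which keeps the balancing with [N] lowered by one. *)
Lemma jackson_sum_half (n N : nat) (h b c d e g x : K) :
  let a := h + h in let q := g + g in
  (0 < n)%N -> e = 2%:R * a + N.+1%:R * q - (n%:R * x - x) - b - c - d ->
  generic a b c d q x ->
  \sum_(lam : {ffun 'I_n -> 'I_N.+1} | inLambda lam)
     weight s N a b c d e q x (fun i => lam i) = jackson_product n N a b c d q x.
Proof.
move=> a q n_gt0; rewrite {}/a; elim: N h e => [|N IH] h e eE gen.
  rewrite (big_pred1 [ffun => ord0]) => [|lam]; last first.
    have -> : lam = [ffun => ord0] by apply/ffunP => i; exact: etrans (ord1 _) (esym (ord1 _)).
    rewrite [RHS]eqxx; apply/inLambdaP => i j _; by rewrite !ffunE.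
  rewrite /jackson_product [RHS]big1 => [|i _]; last by rewrite /ph !big_ord0 !mulr1 divr1.
  apply: (weight0 gen) => [i|i j]; first by rewrite ffunE.
    apply: (generic_neq0 (ka := 1) (kb := 0) (kc := 0) (kd := 0) (p1 := 0)
      (p2 := 0) (p3 := 0) (p4 := i + j) gen) => //.
    by rewrite natrD; ring.
have [r0 eqS] := sum_step n_gt0 eE gen.
apply: (mulIf r0); rewrite eqS (prod_raise eE) (raise_term0 n_gt0 eE gen).
have shift : h + g + (h + g) = h + h + q by rewrite /q; ring.
have := IH (h + g) (e + q); rewrite shift => ->; first last.
- exact: generic_shift.
- by rewrite eE -!natr1; ring.
rewrite jackson_productS mulrAC [RHS]mulrC; congr (_ * _); rewrite -big_split /=.
apply: eq_bigr => i _.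
rewrite -/q.
have n0 : s (h + h + q - i%:R * x) != 0.
  apply: (generic_neq0 (ka := 1) (kb := 0) (kc := 0) (kd := 0) (p1 := 1) (p2 := 0)
    (p3 := 0) (p4 := i) gen) => //.
  by ring.
have nb : s (h + h + q - b - i%:R * x) != 0.
  apply: (generic_neq0 (ka := 1) (kb := -1) (kc := 0) (kd := 0) (p1 := 1) (p2 := 0)
    (p3 := 0) (p4 := i) gen) => //.
  by ring.
have nc : s (h + h + q - c - i%:R * x) != 0.
  apply: (generic_neq0 (ka := 1) (kb := 0) (kc := -1) (kd := 0) (p1 := 1) (p2 := 0)
    (p3 := 0) (p4 := i) gen) => //.
  by ring.
have nd : s (h + h + q - d - i%:R * x) != 0.
  apply: (generic_neq0 (ka := 1) (kb := 0) (kc := 0) (kd := -1) (p1 := 1) (p2 := 0)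
    (p3 := 0) (p4 := i) gen) => //.
  by ring.
have nbcd : s (h + h + q - b - c - d - i%:R * x) != 0.
  apply: (generic_neq0 (ka := 1) (kb := -1) (kc := -1) (kd := -1) (p1 := 1) (p2 := 0)
    (p3 := 0) (p4 := i) gen) => //.
  by ring.
move: (s (h + h + q - i%:R * x)) (s (h + h + q - b - i%:R * x)) n0 nb.
move: (s (h + h + q - c - i%:R * x)) (s (h + h + q - d - i%:R * x)) nc nd.
move: (s (h + h + q - b - c - d - i%:R * x)) nbcd => u u0 v w v0 w0 y z y0 z0.
by field; rewrite u0 v0 w0 y0 z0.
Qed.

Lemma jackson_sum_generic (n N : nat) (a b c d e q x : K) :
  (0 < n)%N -> e = 2%:R * a + N.+1%:R * q - (n%:R * x - x) - b - c - d ->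
  generic a b c d q x ->
  \sum_(lam : {ffun 'I_n -> 'I_N.+1} | inLambda lam)
     weight s N a b c d e q x (fun i => lam i) = jackson_product n N a b c d q x.
Proof.
have half (u : K) : u = u / 2%:R + u / 2%:R by field.
rewrite (half a) (half q); exact: jackson_sum_half.
Qed.

End Recursion.

From mathcomp Require Import boolp classical_sets topology normedtype cardinality.
From mathcomp Require Import sequences exp trigo constructive_ereal measure lebesgue_measure.
Import numFieldNormedType.Exports.
Import Normc.

(** * Convergence of the theta product *)

Section SeqLimit.
Local Open Scope classical_set_scope.
Local Open Scope ring_scope.
Variable K : numFieldType.

Definition seq_lim (u : nat -> K) (L : K) : Prop :=
  forall eps : K, 0 < eps -> exists k0 : nat, forall k : nat, (k0 <= k)%N -> `|u k - L| < eps.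

Lemma seq_limP (u : nat -> K) (L : K) : seq_lim u L <-> u @ \oo --> L.
Proof.
split => [H|/cvgrPdist_lt H e /H[k0 _ Hk]].
  by apply/cvgrPdist_lt => e /H[k0 Hk]; exists k0 => // k /= /Hk; rewrite distrC.
by exists k0 => k /Hk; rewrite /= distrC.
Qed.

Lemma seq_lim_cst (c : K) : seq_lim (fun=> c) c.
Proof. by apply/seq_limP; exact: cvg_cst. Qed.

Lemma seq_limD u v (L M : K) :
  seq_lim u L -> seq_lim v M -> seq_lim (fun k => u k + v k) (L + M).
Proof. by move=> /seq_limP uL /seq_limP vM; apply/seq_limP; exact: cvgD. Qed.

Lemma seq_limN u (L : K) : seq_lim u L -> seq_lim (fun k => - u k) (- L).
Proof. by move=> /seq_limP uL; apply/seq_limP; exact: cvgN. Qed.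

Lemma seq_limM u v (L M : K) :
  seq_lim u L -> seq_lim v M -> seq_lim (fun k => u k * v k) (L * M).
Proof. by move=> /seq_limP uL /seq_limP vM; apply/seq_limP; exact: cvgM. Qed.

Lemma seq_limV u (L : K) : L != 0 -> seq_lim u L -> seq_lim (fun k => (u k)^-1) L^-1.
Proof. by move=> L0 /seq_limP uL; apply/seq_limP; exact: cvgV. Qed.

Lemma seq_lim_unique u (L M : K) : seq_lim u L -> seq_lim u M -> L = M.
Proof.
by move=> /seq_limP uL /seq_limP uM; apply: (cvg_unique _ uL uM); exact: norm_hausdorff.
Qed.

Lemma eq_seq_lim u v (L : K) : u =1 v -> seq_lim u L -> seq_lim v L.
Proof. by move=> uv uL e /uL[k0 Hk]; exists k0 => k /Hk; rewrite uv. Qed.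

Lemma seq_lim_sum (I : Type) (r : seq I) (P : pred I) (u : I -> nat -> K) (L : I -> K) :
  (forall i, P i -> seq_lim (u i) (L i)) ->
  seq_lim (fun k => \sum_(i <- r | P i) u i k) (\sum_(i <- r | P i) L i).
Proof.
move=> uL; elim: r => [|i r IH].
  rewrite big_nil; apply: (eq_seq_lim _ (seq_lim_cst 0)) => k; by rewrite big_nil.
rewrite big_cons; case: ifPn => Pi; last first.
  by apply: (eq_seq_lim _ IH) => k; rewrite big_cons (negbTE Pi).
apply: (eq_seq_lim _ (seq_limD (uL _ Pi) IH)) => k; by rewrite big_cons Pi.
Qed.

Lemma seq_lim_prod (I : Type) (r : seq I) (P : pred I) (u : I -> nat -> K) (L : I -> K) :
  (forall i, P i -> seq_lim (u i) (L i)) ->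
  seq_lim (fun k => \prod_(i <- r | P i) u i k) (\prod_(i <- r | P i) L i).
Proof.
move=> uL; elim: r => [|i r IH].
  rewrite big_nil; apply: (eq_seq_lim _ (seq_lim_cst 1)) => k; by rewrite big_nil.
rewrite big_cons; case: ifPn => Pi; last first.
  by apply: (eq_seq_lim _ IH) => k; rewrite big_cons (negbTE Pi).
apply: (eq_seq_lim _ (seq_limM (uL _ Pi) IH)) => k; by rewrite big_cons Pi.
Qed.

Lemma seq_lim_div (u v : nat -> K) L M : M != 0 -> seq_lim u L -> seq_lim v M ->
  seq_lim (fun k => u k / v k) (L / M).
Proof. by move=> M0 uL vM; apply: seq_limM uL (seq_limV M0 vM). Qed.

Lemma seq_limMl (z : K) (u : nat -> K) L : seq_lim u L -> seq_lim (fun k => z * u k) (z * L).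
Proof. by move=> uL; apply: seq_limM (seq_lim_cst _) uL. Qed.

End SeqLimit.

Ltac seq_lim_linear := lazymatch goal with
  | |- seq_lim (fun _ => _ + _) _ => refine (seq_limD _ _); seq_lim_linear
  | |- seq_lim (fun _ => - _) _ => refine (seq_limN _); seq_lim_linear
  | |- seq_lim (fun _ => _ * _) _ => refine (seq_limMl _ _); seq_lim_linear
  | |- _ => assumption
  end.

Section ComplexLimit.
Variable R : realType.

(** [epsilon] selects some limit, and uniqueness of limits identifies it. *)
Lemma limC_eq (u : nat -> R[i]) (L : R[i]) : seq_lim u L -> limC u = L.
Proof.
move=> uL; apply: (@seq_lim_unique _ u _ _ _ uL).
by apply: (@epsilon_spec _ (inhabits 0) (cvgC u)); exists L.
Qed.

End ComplexLimit.

(** * Products whose factors tend geometrically to 1 *)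

Section GeometricConvergence.
Local Open Scope classical_set_scope.
Local Open Scope ring_scope.
Variable R : realType.
Local Notation C := R[i].

Lemma normcE' (z : C) : `|z| = (normc z)%:C%C.
Proof. by case: z. Qed.

Lemma normc_ge0 (z : C) : 0 <= normc z.
Proof. by case: z => x y; exact: sqrtr_ge0. Qed.

Lemma normc_prod (I : Type) (r : seq I) (P : pred I) (u : I -> C) :
  normc (\prod_(i <- r | P i) u i) = \prod_(i <- r | P i) normc (u i).
Proof. exact: (big_morph _ (@normcM R) (@normc1 R)). Qed.

Lemma normcX (z : C) k : normc (z ^+ k) = normc z ^+ k.
Proof. by elim: k => [|k IH]; rewrite ?expr0 ?normc1 // !exprS normcM IH. Qed.

Lemma normc_sum (I : Type) (r : seq I) (P : pred I) (u : I -> C) :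
  normc (\sum_(i <- r | P i) u i) <= \sum_(i <- r | P i) normc (u i).
Proof.
elim/big_ind2: _ => [|x1 x2 y1 y2 h1 h2|//]; first by rewrite normc0.
by rewrite (le_trans (le_normcD _ _)) // lerD.
Qed.

Lemma normcB (u v : C) : normc (u - v) = normc (v - u).
Proof. by rewrite -normcN opprB. Qed.

Lemma normc_real (x : R) : normc (x%:C%C) = `|x|.
Proof. by rewrite /= expr0n /= addr0 sqrtr_sqr. Qed.

Lemma normc_gt0 (z : C) : (0 < normc z) = (z != 0).
Proof.
rewrite lt_neqAle normc_ge0 andbT eq_sym; congr (~~ _).
by apply/eqP/eqP => [/eq0_normc//|->]; rewrite normc0.
Qed.

Lemma seq_lim_normcP (u : nat -> C) (L : C) : seq_lim u L <->
  (forall e : R, 0 < e -> exists k0 : nat, forall k, (k0 <= k)%N -> normc (u k - L) < e).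
Proof.
split=> [uL e e0|uL e].
  have /uL[k0 Hk] : 0 < (e%:C)%C :> C by rewrite ltcR.
  by exists k0 => k /Hk; rewrite normcE' ltcR.
rewrite ltcE => /andP[/eqP /= im0 re0].
have [k0 Hk] := uL _ re0; exists k0 => k /Hk lt.
by rewrite normcE' ltcE /= im0 eqxx.
Qed.

Lemma geometric_small (D rho e : R) : 0 <= rho < 1 -> 0 < e ->
  exists k0 : nat, forall k, (k0 <= k)%N -> D * rho ^+ k < e.
Proof.
move=> /andP[r0 r1] e0; have nr1 : `|rho| < 1 by rewrite ger0_norm.
have /cvgrPdist_lt/(_ e e0)[k0 _ Hk] := @cvg_geometric R D rho nr1.
exists k0 => k /Hk; rewrite /= sub0r normrN.
exact: le_lt_trans (ler_norm _).
Qed.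

Lemma real_geometric_cvg (D rho : R) (u : nat -> R) : 0 <= rho < 1 ->
  (forall k m, `|u (k + m)%N - u k| <= D * rho ^+ k) -> exists l : R, u @ \oo --> l.
Proof.
move=> r01 uD; suff cvu : cvgn u by exists (limn u).
apply: cauchy_cvg; apply/cauchy_exP => e e0.
have [k0 Hk] := geometric_small D r01 e0.
exists (u k0), k0 => //= k lek; rewrite /ball_ /= /ball /= distrC.
by rewrite -(subnKC lek); apply: le_lt_trans (uD _ _) (Hk _ _).
Qed.

Lemma abs_Re (z : C) : `|complex.Re z| <= normc z.
Proof.
case: z => x y /=; rewrite -sqrtr_sqr; apply: ler_wsqrtr.
by rewrite lerDl sqr_ge0.
Qed.

Lemma abs_Im (z : C) : `|complex.Im z| <= normc z.
Proof.
case: z => x y /=; rewrite -sqrtr_sqr; apply: ler_wsqrtr.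
by rewrite lerDr sqr_ge0.
Qed.

Lemma normc_le (z : C) : normc z <= `|complex.Re z| + `|complex.Im z|.
Proof.
case: z => x y /=; rewrite -[leRHS]ger0_norm ?addr_ge0 // -sqrtr_sqr.
apply: ler_wsqrtr; rewrite sqrrD !real_normK ?num_real // lerD2r lerDl.
by rewrite mulrn_wge0 // mulr_ge0.
Qed.

(** Completeness is applied to the real and imaginary parts. The rate passes to the limit and later
    makes the theta product converge locally uniformly. *)
Lemma geometric_seq_lim (D rho : R) (u : nat -> C) : 0 <= rho < 1 ->
  (forall k m, normc (u (k + m)%N - u k) <= D * rho ^+ k) ->
  exists2 L, seq_lim u L & forall k, normc (L - u k) <= D * rho ^+ k.
Proof.
move=> r01 uD.
have [|lr /cvgrPdist_lt ur] := @real_geometric_cvg D rho (fun k => complex.Re (u k)) r01.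
  by move=> k m; rewrite -raddfB; apply: le_trans (abs_Re _) (uD _ _).
have [|li /cvgrPdist_lt ui] := @real_geometric_cvg D rho (fun k => complex.Im (u k)) r01.
  by move=> k m; rewrite -raddfB; apply: le_trans (abs_Im _) (uD _ _).
have uL : seq_lim u (lr +i* li)%C.
  apply/seq_lim_normcP => e e0; have e20 : 0 < e / 2%:R by rewrite divr_gt0.
  have [k1 _ H1] := ur _ e20; have [k2 _ H2] := ui _ e20.
  exists (maxn k1 k2) => k; rewrite geq_max => /andP[/H1 /= h1 /H2 /= h2].
  rewrite normcB; apply: le_lt_trans (normc_le _) _.
  by move: h1 h2; case: (u k) => x y /=; lra.
exists (lr +i* li)%C => // k; apply/ler_addgt0Pr => e e0.
have /seq_lim_normcP/(_ e e0)[k0 Hk] := uL.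
have := Hk (k0 + k)%N (leq_addr _ _); have := uD k k0; rewrite addnC normcB => h1 h2.
rewrite -(subrKA (u (k0 + k)%N)) (le_trans (le_normcD _ _)) //.
by rewrite addrC; apply: lerD; rewrite // normcB // ltW.
Qed.

Lemma prod_le_expR (m : nat) (a : nat -> C) :
  normc (\prod_(j < m) (1 + a j)) <= expR (\sum_(j < m) normc (a j)).
Proof.
rewrite normc_prod expR_sum; apply: ler_prod => j _; rewrite normc_ge0 /=.
rewrite (le_trans (le_normcD _ _)) // normc1; exact: expR_ge1Dx.
Qed.

Section Product.
Variables (A rho : R) (a : nat -> C).
Hypotheses (A0 : 0 <= A) (r01 : 0 <= rho < 1).
Hypothesis aA : forall j, normc (a j) <= A * rho ^+ j.

Lemma sum_geometric_le m : \sum_(j < m) A * rho ^+ j <= A / (1 - rho).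
Proof.
have /andP[r0 r1] := r01; have r10 : 0 < 1 - rho by rewrite subr_gt0.
rewrite -mulr_sumr ler_wpM2l // -div1r ler_pdivlMr //.
have -> : (\sum_(j < m) rho ^+ j) * (1 - rho) = 1 - rho ^+ m.
  by rewrite -opprB mulrN mulrC -subrX1 opprB.
by rewrite gerBl exprn_ge0.
Qed.

Let B := expR (A / (1 - rho)).
Let D := B * (A / (1 - rho)).

Lemma prod_bounded m : normc (\prod_(j < m) (1 + a j)) <= B.
Proof.
rewrite (le_trans (prod_le_expR _ _)) // ler_expR.
by rewrite (le_trans _ (sum_geometric_le m)) // ler_sum.
Qed.

Lemma prod_cauchy k m :
  normc (\prod_(j < k + m) (1 + a j) - \prod_(j < k) (1 + a j)) <= D * rho ^+ k.
Proof.
have /andP[r0 r1] := r01; have r10 : 0 < 1 - rho by rewrite subr_gt0.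
have B0 : 0 <= B := expR_ge0 _.
have D0 : 0 <= D by rewrite mulr_ge0 // divr_ge0 // ltW.
(* Strengthened to a telescoping bound so that the induction on [m] closes; [D] satisfies
   [D * (1 - rho) = B * A]. *)
suff H : normc (\prod_(j < k + m) (1 + a j) - \prod_(j < k) (1 + a j)) <=
    D * (rho ^+ k - rho ^+ (k + m)).
  by rewrite (le_trans H) // ler_wpM2l // gerBl exprn_ge0.
elim: m => [|m IH]; first by rewrite addn0 !subrr normc0 mulr0.
rewrite addnS big_ord_recr /= mulrDr mulr1 addrAC.
rewrite (le_trans (le_normcD _ _)) // normcM.
have -> : D * (rho ^+ k - rho ^+ (k + m).+1) =
    D * (rho ^+ k - rho ^+ (k + m)) + B * (A * rho ^+ (k + m)).
  by rewrite exprS /D; field; rewrite gt_eqF.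
by apply: lerD => //; apply: ler_pM; rewrite ?normc_ge0 // prod_bounded.
Qed.

Lemma prod_seq_lim :
  exists2 L, seq_lim (fun k => \prod_(j < k) (1 + a j)) L &
    forall k, normc (L - \prod_(j < k) (1 + a j)) <= D * rho ^+ k.
Proof. by apply: geometric_seq_lim r01 _ => k m; exact: prod_cauchy. Qed.

End Product.

(** From an index [k] on where the error bound is below 1, the tail product has a limit at distance
    less than 1 from 1. The head is a finite product of nonzero factors. *)
Lemma prod_lim_neq0 (A rho : R) (a : nat -> C) (L : C) : 0 <= A -> 0 <= rho < 1 ->
  (forall j, normc (a j) <= A * rho ^+ j) -> (forall j, 1 + a j != 0) ->
  seq_lim (fun k => \prod_(j < k) (1 + a j)) L -> L != 0.
Proof.
move=> A0 r01 aA a0 aL; have /andP[r0 r1] := r01.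
have r10 : 0 < 1 - rho by rewrite subr_gt0.
pose B := expR (A / (1 - rho)).
have [k Hk] := geometric_small (B * (A / (1 - rho))) r01 (ltr01 : 0 < 1 :> R).
pose a' j := a (k + j)%N.
have a'A j : normc (a' j) <= A * rho ^+ k * rho ^+ j.
  by rewrite -mulrA -exprD; exact: aA.
have A'0 : 0 <= A * rho ^+ k by rewrite mulr_ge0 // exprn_ge0.
have [L' a'L' /(_ 0%N)] := prod_seq_lim A'0 r01 a'A.
rewrite big_ord0 expr0 mulr1 => L'1.
have L'0 : L' != 0.
  apply: contraTneq (Hk k (leqnn _)) => L'0; rewrite -leNgt.
  move: L'1; rewrite L'0 sub0r normcN normc1 => L'1; apply: (le_trans L'1).
  have q0 : 0 <= A / (1 - rho) by rewrite divr_ge0 // ltW.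
  have E : A * rho ^+ k / (1 - rho) = A / (1 - rho) * rho ^+ k by rewrite mulrAC.
  have le1 : A / (1 - rho) * rho ^+ k <= A / (1 - rho).
    by rewrite ler_piMr // exprn_ile1 // ltW.
  rewrite E /B -[leRHS]mulrA; apply: ler_wpM2r; first by rewrite mulr_ge0 // exprn_ge0.
  by rewrite ler_expR.
have -> : L = (\prod_(j < k) (1 + a j)) * L'.
  apply: (@seq_lim_unique _ (fun m => \prod_(j < k + m) (1 + a j))).
    move=> e /aL[k0 Hk0]; exists k0 => m lem; apply: Hk0.
    by rewrite (leq_trans lem) // leq_addl.
  apply: (eq_seq_lim _ (seq_limM (seq_lim_cst _) a'L')) => m.
  by rewrite big_split_ord.
by rewrite mulf_neq0 //; apply/prodf_neq0 => j _.
Qed.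

End GeometricConvergence.

(** * Inversion, zeros and continuity of [E] *)

Section Theta.
Variable R : realType.
Local Notation C := R[i].
Variable p : C.
Hypothesis p1 : normc p < 1.

Definition theta_defect (y : C) (j : nat) : C :=
  - (y * p ^+ j) - p ^+ j.+1 / y + y * p ^+ j * (p ^+ j.+1 / y).

Definition theta_part (y : C) (k : nat) : C := \prod_(j < k) (1 + theta_defect y j).

Lemma theta_partE y k : theta_part y k =
  \prod_(j < k) ((1 - y * p ^+ j) * (1 - p ^+ j.+1 / y)).
Proof. by apply: eq_bigr => j _; rewrite /theta_defect; ring. Qed.

Lemma normp : 0 <= normc p < 1. Proof. by rewrite normc_ge0. Qed.

Lemma theta_defect_le y A j : normc y + normc y^-1 + 1 <= A ->
  normc (theta_defect y j) <= A * normc p ^+ j.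
Proof.
move=> yA; apply: le_trans (ler_wpM2r (exprn_ge0 _ (normc_ge0 p)) yA).
have r0 := normc_ge0 p.
have rj : 0 <= normc p ^+ j := exprn_ge0 _ r0.
have rj1 : normc p ^+ j <= 1 by rewrite exprn_ile1 // ltW.
have h1 : normc (y * p ^+ j) = normc y * normc p ^+ j by rewrite normcM normcX.
have h2 : normc (p ^+ j.+1 / y) <= normc y^-1 * normc p ^+ j.
  rewrite normcM normcX exprS mulrC ler_wpM2l ?normc_ge0 //.
  by rewrite ler_piMl // ltW.
have h3 : normc (y * p ^+ j * (p ^+ j.+1 / y)) <= normc p ^+ j.
  have [->|y0] := eqVneq y 0; first by rewrite !mul0r normc0.
  have -> : y * p ^+ j * (p ^+ j.+1 / y) = p ^+ j * p ^+ j.+1 by field.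
  rewrite normcM !normcX ler_piMr // exprS mulr_ile1 // ltW //.
rewrite /theta_defect (le_trans (le_normcD _ _)) // !mulrDl mul1r lerD //.
by rewrite (le_trans (le_normcD _ _)) // !normcN h1 lerD.
Qed.

(** The bound depends on [y] through [A] only, hence is uniform on annuli around 0. *)
Lemma Ell_approx y A : normc y + normc y^-1 + 1 <= A -> forall k,
  normc (Ell p y - theta_part y k) <=
  expR (A / (1 - normc p)) * (A / (1 - normc p)) * normc p ^+ k.
Proof.
move=> yA; have A0 : 0 <= A by apply: le_trans yA; rewrite !addr_ge0 ?normc_ge0.
have [L yL HL] := prod_seq_lim A0 normp (fun j => theta_defect_le j yA).
suff -> : Ell p y = L by [].
by apply: limC_eq; apply: eq_seq_lim yL => k; rewrite -[LHS]/(theta_part y k) theta_partE.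
Qed.

Lemma Ell_lim y : seq_lim (theta_part y) (Ell p y).
Proof.
have [L yL _] := prod_seq_lim (addr_ge0 (addr_ge0 (normc_ge0 y) (normc_ge0 y^-1)) ler01)
  normp (fun j => theta_defect_le j (lexx _)).
suff -> : Ell p y = L by [].
by apply: limC_eq; apply: eq_seq_lim yL => k; rewrite -[LHS]/(theta_part y k) theta_partE.
Qed.

Lemma seq_lim_pX : seq_lim (fun k => p ^+ k) 0.
Proof.
apply/seq_lim_normcP => e e0; have [k0 Hk] := geometric_small 1 normp e0.
by exists k0 => k /Hk; rewrite subr0 normcX mul1r.
Qed.

Lemma seq_lim_shift (u : nat -> C) L : seq_lim u L -> seq_lim (fun k => u k.+1) L.
Proof. by move=> uL e /uL[k0 Hk]; exists k0 => k lek; apply: Hk; apply: leqW. Qed.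

(** Inversion exchanges the two families of factors up to a shift of the index. The partial products
    satisfy the relation once multiplied by the boundary factors [1 - p ^+ k.+1 * z], which tend to
    1. *)
Lemma EllV y : y != 0 -> Ell p y^-1 = - Ell p y / y.
Proof.
move=> y0.
have lim0 z : seq_lim (fun k => 1 - p ^+ k.+1 * z) 1.
  rewrite -[X in seq_lim _ X](subr0 1) -[X in 1 - X](mul0r z).
  apply: seq_limD (seq_lim_cst _) (seq_limN _); apply: seq_limM (seq_lim_cst _).
  exact: seq_lim_shift seq_lim_pX.
have L := seq_limM (seq_lim_shift (Ell_lim y^-1)) (lim0 y^-1).
have M := seq_limM (seq_limM (seq_limN (seq_lim_shift (Ell_lim y))) (seq_lim_cst y^-1)) (lim0 y).
rewrite -[LHS]mulr1 -[RHS]mulr1; apply: seq_lim_unique L _; apply: eq_seq_lim M => k.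
rewrite !theta_partE !big_split /= invrK.
have F1 z : \prod_(i < k.+1) (1 - z * p ^+ i) = (1 - z) * \prod_(i < k) (1 - p ^+ i.+1 * z).
  rewrite big_ord_recl /= expr0 mulr1; congr (_ * _).
  by apply: eq_bigr => i _; rewrite mulrC.
have F2 z : \prod_(i < k.+1) (1 - p ^+ i.+1 * z) =
    \prod_(i < k) (1 - p ^+ i.+1 * z) * (1 - p ^+ k.+1 * z) by rewrite big_ord_recr.
by rewrite !F1 !F2; field.
Qed.

(** The product vanishes only through one of its factors, so [y] is an integral power of [p]. The
    modulus alone is recorded, since genericity is tested on real parts of logarithms. *)
Lemma Ell_eq0 y : y != 0 -> Ell p y = 0 ->
  exists j : int, ln (normc y) = j%:~R * ln (normc p).
Proof.
move=> y0 E0; pose A := normc y + normc y^-1 + 1.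
have A0 : 0 <= A by rewrite !addr_ge0 ?normc_ge0.
have [j /eqP] : exists j, 1 + theta_defect y j == 0.
  apply: contrapT => H; have nz j : 1 + theta_defect y j != 0.
    by apply/negP => Hj; apply: H; exists j.
  have := prod_lim_neq0 A0 normp (fun j => theta_defect_le j (lexx _)) nz (Ell_lim y).
  by rewrite E0 eqxx.
have -> : 1 + theta_defect y j = (1 - y * p ^+ j) * (1 - p ^+ j.+1 / y).
  by rewrite /theta_defect; ring.
have lnX (r : R) k : 0 < r -> ln (r ^+ k) = k%:R * ln r.
  by move=> r0; rewrite lnXn // mulr_natl.
(* For [p = 0] the only zero is [y = 1], and [j = 0] works. *)
have [->|p0] := eqVneq p 0.
  rewrite exprS !mul0r subr0 mulr1; case: j => [|j].
    rewrite expr0 mulr1 => /eqP; rewrite subr_eq0 => /eqP <-.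
    by exists 0; rewrite normc1 ln1 mul0r.
  by rewrite exprS mul0r mulr0 subr0 => /eqP; rewrite oner_eq0.
have np0 : 0 < normc p by rewrite normc_gt0.
have ny0 : 0 < normc y by rewrite normc_gt0.
move=> /eqP; rewrite mulf_eq0 !subr_eq0 => /orP[] /eqP.
  move=> /(congr1 (@normc R)); rewrite normc1 normcM normcX => E.
  exists (- j%:Z); have := congr1 (@ln R) E; rewrite ln1 lnM ?posrE ?exprn_gt0 // lnX //.
  by rewrite mulrNz -pmulrn mulNr => /esym/eqP; rewrite addr_eq0 => /eqP.
move=> E; have {}E : y = p ^+ j.+1 by rewrite -[LHS]mul1r E mulfVK.
by exists j.+1%:Z; rewrite E normcX lnX // -pmulrn.
Qed.

Lemma seq_lim_normc_le (u : nat -> C) L : seq_lim u L ->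
  exists k0, forall k, (k0 <= k)%N -> normc (u k) <= normc L + 1.
Proof.
move=> /seq_lim_normcP/(_ 1 ltr01)[k0 Hk]; exists k0 => k /Hk lt.
rewrite -[u k](subrK L) (le_trans (le_normcD _ _)) // addrC lerD2l; exact: ltW.
Qed.

Lemma Ell_continuous (y : nat -> C) (L : C) : L != 0 -> seq_lim y L ->
  seq_lim (fun k => Ell p (y k)) (Ell p L).
Proof.
move=> L0 yL; have yVL := seq_limV L0 yL.
have [k1 H1] := seq_lim_normc_le yL; have [k2 H2] := seq_lim_normc_le yVL.
(* For large [k] the moduli of [y k] and of its inverse exceed those of [L] and [L^-1] by at most 1
   each; the third unit is the constant in [Ell_approx]. *)
pose A := normc L + normc L^-1 + 3.
apply/seq_lim_normcP => e e0; have e30 : 0 < e / 3 by rewrite divr_gt0.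
have [K HK] := geometric_small (expR (A / (1 - normc p)) * (A / (1 - normc p))) normp e30.
have /seq_lim_normcP/(_ _ e30)[k3 H3] : seq_lim (fun k => theta_part (y k) K) (theta_part L K).
  apply: seq_lim_prod => j _; rewrite /theta_defect.
  apply: seq_limD (seq_lim_cst _) _; apply: seq_limD; first apply: seq_limD.
  - by apply: seq_limN; apply: seq_limM (seq_lim_cst _).
  - by apply: seq_limN; apply: seq_limM => //; exact: seq_lim_cst.
  - apply: seq_limM; first by apply: seq_limM (seq_lim_cst _).
    by apply: seq_limM => //; exact: seq_lim_cst.
exists (maxn k1 (maxn k2 k3)) => k; rewrite !geq_max => /and3P[/H1 h1 /H2 h2 /H3 h3].
have a1 : normc (y k) + normc (y k)^-1 + 1 <= A by rewrite /A; lra.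
have a2 : normc L + normc L^-1 + 1 <= A by rewrite /A; lra.
have b1 := le_lt_trans (Ell_approx a1 K) (HK K (leqnn _)).
have b2 := le_lt_trans (Ell_approx a2 K) (HK K (leqnn _)).
have -> : Ell p (y k) - Ell p L = (Ell p (y k) - theta_part (y k) K) +
   ((theta_part (y k) K - theta_part L K) + (theta_part L K - Ell p L)) by ring.
rewrite normcB in b2.
have := le_normcD (Ell p (y k) - theta_part (y k) K) ((theta_part (y k) K - theta_part L K) +
  (theta_part L K - Ell p L)).
have := le_normcD (theta_part (y k) K - theta_part L K) (theta_part L K - Ell p L).
by move: b1 b2 h3; lra.
Qed.

End Theta.

(** * The addition formula *)

Definition int_range (m : nat) : seq int := [seq n%:Z - m%:Z | n <- iota 0 (m + m.+1)].

Lemma mem_int_range m k : (k \in int_range m) = (`|k| <= m)%N.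
Proof.
apply/mapP/idP => [[n]|km]; first by rewrite mem_iota => ? ->; lia.
by exists (absz (k + m%:Z)); rewrite ?mem_iota; lia.
Qed.

Lemma uniq_int_range m : uniq (int_range m).
Proof. by rewrite map_inj_uniq ?iota_uniq // => i j; lia. Qed.

Lemma big_int_range (V : nmodType) m (F : int -> V) :
  \sum_(k <- int_range m) F k = \sum_(n < m) F (- n.+1%:Z) + \sum_(n < m.+1) F n%:Z.
Proof.
rewrite big_map -[(m + m.+1)%N]subn0 -/(index_iota _ _) big_mkord big_split_ord /=.
congr (_ + _); last by apply: eq_bigr => i _; congr F; lia.
rewrite (reindex_inj rev_ord_inj); apply: eq_bigr => i _; congr F => /=.
by have := ltn_ord i; lia.
Qed.

(* The lattice [Z^2] splits into the points [(i + j + 1, i + 1 - j)] and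
   [(i + j + 1, i - j)], according to the parity of the coordinate sum. *)
Lemma big_parity_split (V : nmodType) m (f : int -> int -> V) :
  (forall k l, (m < `|k|)%N || (m < `|l|)%N -> f k l = 0) ->
  \sum_(k <- int_range m) \sum_(l <- int_range m) f k l =
  \sum_(i <- int_range m.+1) \sum_(j <- int_range m.+1)
     (f (i + j + 1) (i + 1 - j) + f (i + j + 1) (i - j)).
Proof.
move=> f0; pose g (t : int * int) := f t.1 t.2.
pose grid M := [seq (k, l) | k <- int_range M, l <- int_range M].
pose h1 (t : int * int) := (t.1 + t.2 + 1, t.1 + 1 - t.2).
pose h2 (t : int * int) := (t.1 + t.2 + 1, t.1 - t.2).
have gridE M (F : int * int -> V) :
    \sum_(k <- int_range M) \sum_(l <- int_range M) F (k, l) = \sum_(t <- grid M) F t.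
  by rewrite big_allpairs.
have mem_grid M t : (t \in grid M) = (`|t.1| <= M)%N && (`|t.2| <= M)%N.
  case: t => k l; rewrite -!mem_int_range; apply/allpairsP/andP => [[[a b] [? ?]]|[? ?]].
    by case=> -> ->.
  by exists (k, l).
have uniq_grid M : uniq (grid M).
  by apply: allpairs_uniq; rewrite ?uniq_int_range // => -[? ?] [? ?].
have h1I : injective h1 by move=> [a b] [a' b'] []; rewrite /h1 /= => ? ?; congr (_, _); lia.
have h2I : injective h2 by move=> [a b] [a' b'] []; rewrite /h2 /= => ? ?; congr (_, _); lia.
pose box (t : int * int) := (`|t.1| <= m)%N && (`|t.2| <= m)%N.
pose s := map h1 (grid m.+1) ++ map h2 (grid m.+1).
rewrite (gridE m g) (gridE m.+1 (fun t => g (h1 t) + g (h2 t))) big_split /=.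
rewrite -(big_map h1 predT) -(big_map h2 predT) -big_cat -/s.
rewrite [RHS](bigID box) /= [X in _ = _ + X]big1 ?addr0 => [|t /negP t_box]; last first.
  by rewrite /g f0 //; move: t_box; rewrite /box; lia.
rewrite -[RHS]big_filter; apply: perm_big; apply: uniq_perm => //.
  rewrite filter_uniq // cat_uniq !map_inj_uniq // !uniq_grid andbT andTb.
  apply/hasPn => _ /mapP[[a b] _ ->]; apply/negP => /mapP[[a' b'] _].
  by rewrite /h1 /h2 /= => -[]; lia.
move=> t; rewrite mem_filter mem_grid -/(box t) mem_cat.
case: (boolP (box t)) => // t_box; rewrite andTb; symmetry; apply/orP.
case: t t_box => k l /andP[km lm].
have {}km : (absz k <= m)%N := km; have {}lm : (absz l <= m)%N := lm.
have [odd0|odd1] := eqVneq (((k + l) %% 2)%Z) 0.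
  left; apply/mapP; exists ((((k + l) %/ 2)%Z - 1, k - ((k + l) %/ 2)%Z)).
    rewrite mem_grid /=. lia.
  by rewrite /h1 /=; congr (_, _); lia.
right; apply/mapP; exists (((k + l) %/ 2)%Z, k - 1 - ((k + l) %/ 2)%Z).
  rewrite mem_grid /=; lia.
rewrite /h2 /=; congr (_, _); lia.
Qed.

Lemma int_absz_cases (i : int) : i = absz i \/ i = - (absz i)%:Z.
Proof. by case: i => n; [left | right; lia]. Qed.

(** * From the finite q-binomial theorem to the addition formula *)

Section Addition.
Variable R : realType.
Local Notation C := R[i].
Variable p : C.
Hypothesis p1 : normc p < 1.

Definition pfac (n : nat) : C := \prod_(j < n) (1 + - p ^+ j.+1).

Lemma onemX_neq0 j : 1 + - p ^+ j.+1 != 0.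
Proof.
apply/negP; rewrite subr_eq0 => /eqP/(congr1 (@normc R)); rewrite normc1 normcX => E.
have /andP[r0 _] := normp p1.
by have := exprn_ilt1 j.+1 r0 p1; rewrite -E ltxx.
Qed.

Lemma pfac_neq0 n : pfac n != 0.
Proof. by apply/prodf_neq0 => j _; exact: onemX_neq0. Qed.

Lemma pfacS n : pfac n.+1 = pfac n * (1 + - p ^+ n.+1).
Proof. by rewrite /pfac big_ord_recr. Qed.

(** The finite q-binomial theorem in base [p]; [TS] is its Pascal rule. *)
Lemma qbinomial n v : \prod_(j < n) (1 - v * p ^+ j) =
  \sum_(r < n.+1) pfac n / (pfac r * pfac (n - r)) * (- v) ^+ r * p ^+ 'C(r, 2).
Proof.
elim: n => [|n IH].
  by rewrite big_ord0 big_ord1 subn0 /pfac !big_ord0 bin0n !expr0 !mulr1 divr1.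
pose T n r := pfac n / (pfac r * pfac (n - r)) * (- v) ^+ r * p ^+ 'C(r, 2).
have T0 m : T m 0%N = 1.
  by rewrite /T subn0 /pfac big_ord0 mul1r !expr0 !mulr1 mulfV // pfac_neq0.
have TS r : (r < n)%N -> T n.+1 r.+1 = T n r.+1 - v * p ^+ n * T n r.
  move=> ltrn; rewrite /T; have -> : (n.+1 - r.+1 = (n - r.+1).+1)%N by lia.
  have -> : (n - r = (n - r.+1).+1)%N by lia.
  have nE : n = (r + (n - r.+1).+1)%N by lia.
  move: (n - r.+1)%N nE => k nE; rewrite binS bin1 !pfacS (exprS (- v)) exprD.
  have := pfac_neq0 r; have := pfac_neq0 k; have := onemX_neq0 r; have := onemX_neq0 k.
  have -> : p ^+ n.+1 = p ^+ r.+1 * p ^+ k.+1 by rewrite -exprD; congr (_ ^+ _); lia.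
  have -> : p ^+ n = p ^+ r * p ^+ k.+1 by rewrite -exprD; congr (_ ^+ _); lia.
  rewrite (exprS p r);
    move: (pfac r) (pfac k) (p ^+ k.+1) (p ^+ r) (pfac n) (p ^+ 'C(r, 2)) ((-v) ^+ r).
  by move=> a b pk pr c u w k0 r0 b0 a0; field; rewrite a0 b0 k0 r0.
have Tn : T n.+1 n.+1 = - v * p ^+ n * T n n.
  rewrite /T !subnn binS bin1 (exprS (- v)) exprD.
  have := pfac_neq0 n.+1; have := pfac_neq0 n; have := pfac_neq0 0.
  move: (pfac n.+1) (pfac n) (pfac 0) (p ^+ n) ((-v) ^+ n) (p ^+ 'C(n, 2)).
  by move=> a b c u w z c0 b0 a0; field; rewrite a0 b0 c0.
rewrite big_ord_recr /= IH -[LHS]/((\sum_(r < n.+1) T n r) * _).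
rewrite -[RHS]/(\sum_(r < n.+2) T n.+1 r) mulrBr mulr1.
rewrite [RHS]big_ord_recl [X in _ = _ + X]big_ord_recr /= -[T n.+1 ord0]/(T n.+1 0%N) T0.
rewrite [X in X - _]big_ord_recl /= -[T n ord0]/(T n 0%N) T0.
rewrite [X in _ - X * _]big_ord_recr /=.
rewrite (eq_bigr (fun r : 'I_n => T n r.+1)) // [in RHS](eq_bigr (fun r : 'I_n => T n r.+1 - v * p
  ^+ n * T n r)); last first.
  by move=> r _; apply: TS.
rewrite sumrB -mulr_sumr -[T n.+1 (bump 0 n)]/(T n.+1 n.+1) Tn.
by ring.
Qed.

Section NonzeroNome.
Variable P : C.
Hypotheses (P0 : P != 0) (PE : p = P ^+ 2).

(** The usual convention that [1 / (p; p)_z] is zero for [z < 0] makes [theta_coef m] vanish outside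
    [[-m, m]]. *)
Definition pfacV (z : int) : C := if z is Posz n then (pfac n)^-1 else 0.

Definition theta_coef (m : nat) (k : int) : C := pfacV (m%:Z + k) * pfacV (m%:Z - k).

Lemma prod_pX m : \prod_(j < m) p ^+ j.+1 = P ^ (m%:Z * m%:Z + m%:Z).
Proof.
elim: m => [|m IH]; first by rewrite big_ord0.
rewrite big_ord_recr /= IH PE -exprM [P ^+ _]exprnP -expfzDr //; congr (_ ^ _); lia.
Qed.

(** A finite Jacobi triple product: for [v = y p^(-m)] the [2 m] factors [1 - v p^j] are those of
    [theta_part p y m] up to a monomial, and [qbinomial] expands them. The square root [P] of [p]
    expresses [p^(k(k-1)/2)] without halving an exponent. *)
Lemma theta_part_series m y : y != 0 ->
  theta_part p y m = pfac (m + m) *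
    \sum_(k <- int_range m) theta_coef m k * (-1) ^ k * P ^ (k * k - k) * y ^ k.
Proof.
move=> y0; have p0 : p != 0 by rewrite PE expf_neq0.
pose v := y * p ^- m.
have prodE : theta_part p y m =
    P ^ (m%:Z * m%:Z + m%:Z) * (- y) ^- m * \prod_(j < m + m) (1 - v * p ^+ j).
  rewrite theta_partE big_split /= big_split_ord /= mulrC [RHS]mulrA; congr (_ * _); last first.
    apply: eq_bigr => j _; congr (1 - _); rewrite /v exprD.
    by field; rewrite expf_neq0.
  have -> : \prod_(i < m) (1 - v * p ^+ i) =
      \prod_(i < m) ((- y) / p ^+ i.+1 * (1 - p ^+ i.+1 / y)).
    rewrite (reindex_inj rev_ord_inj) /=; apply: eq_bigr => j _; rewrite /v.
    have -> : p ^+ m = p ^+ (m - j.+1) * p ^+ j.+1 by rewrite -exprD subnK.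
    by field; rewrite y0 !expf_neq0.
  rewrite !big_split /= prodfV prod_pX prodr_const card_ord.
  have : P ^ (m%:Z * m%:Z + m%:Z) != 0 by rewrite expfz_neq0.
  have : (- y) ^+ m != 0 by rewrite expf_neq0 // oppr_eq0.
  by move: (P ^ _) (_ ^+ m) => a b b0 a0; field; rewrite a0 b0.
rewrite prodE qbinomial !mulr_sumr big_map -[(m + m.+1)%N]subn0 -/(index_iota _ _) big_mkord.
rewrite addnS; apply: eq_bigr => n _.
have le_n : (n <= m + m)%N by rewrite -ltnS.
rewrite /theta_coef; have -> : m%:Z + (n%:Z - m%:Z) = n by lia.
have -> : m%:Z - (n%:Z - m%:Z) = (m + m - n)%N by lia.
rewrite /pfacV invfM.
have -> : p ^+ 'C(n, 2) = P ^ (n%:Z * n%:Z - n%:Z).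
  rewrite PE -exprM exprnP; congr (_ ^ _).
  elim: (n : nat) => [//|k IH]; rewrite binS bin1; lia.
have -> : (- v) ^+ n = (-1) ^ n%:Z * y ^ n%:Z * P ^ (- (m%:Z * n%:Z) - m%:Z * n%:Z).
  have powE (w : C) : (- (y / w)) ^+ n = (-1) ^+ n * y ^+ n / w ^+ n.
    by rewrite -[- (y / w)]mulN1r !exprMn exprVn mulrA.
  rewrite -opprD -invr_expz /v PE powE -!exprM; congr (_ / _).
  by rewrite [LHS]exprnP; congr (_ ^ _); lia.
have -> : (- y) ^- m = (-1) ^ (- m%:Z) * y ^ (- m%:Z).
  by rewrite -[- y]mulN1r exprMn invfM -!invr_expz.
have -> : P ^ ((n%:Z - m%:Z) * (n%:Z - m%:Z) - (n%:Z - m%:Z)) =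
   P ^ (m%:Z * m%:Z + m%:Z) * P ^ (- (m%:Z * n%:Z) - m%:Z * n%:Z) * P ^ (n%:Z * n%:Z - n%:Z).
  by rewrite -!expfzDr //; congr (_ ^ _); ring.
rewrite !expfzDr // ?oppr_eq0 ?oner_eq0 //.
ring.
Qed.

Let r0 : 0 < normc p.
Proof. by rewrite normc_gt0 PE expf_neq0. Qed.

(** * Estimates uniform in the truncation *)

Lemma seq_lim_bounded (u : nat -> C) L : seq_lim u L ->
  exists2 B, 0 <= B & forall k, normc (u k) <= B.
Proof.
move=> /seq_lim_normc_le[k0 Hk].
have S0 : 0 <= \sum_(k < k0) normc (u k) by apply: sumr_ge0 => k _; exact: normc_ge0.
exists (normc L + 1 + \sum_(k < k0) normc (u k)).
  by rewrite addr_ge0 // addr_ge0 // normc_ge0.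
move=> k; have [lek|ltk] := leqP k0 k; first by rewrite (le_trans (Hk _ lek)) // lerDl.
rewrite (bigD1 (Ordinal ltk)) //= addrCA lerDl addr_ge0 //.
  by rewrite addr_ge0 // normc_ge0.
by apply: sumr_ge0 => j _; exact: normc_ge0.
Qed.

Let defect_le j : normc (- p ^+ j.+1) <= 1 * normc p ^+ j.
Proof. by rewrite normcN normcX exprS mul1r ler_piMl ?exprn_ge0 ?normc_ge0 // ltW. Qed.

Lemma pfac_lim : exists2 L, L != 0 & seq_lim pfac L.
Proof.
have [L pL _] := prod_seq_lim ler01 (normp p1) defect_le.
exists L => //; exact: prod_lim_neq0 ler01 (normp p1) defect_le onemX_neq0 pL.
Qed.

Lemma pfac_inv_bounded : exists2 H, 0 <= H & forall n, normc (pfac n)^-1 <= H.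
Proof.
have [L L0 pL] := pfac_lim; exact: seq_lim_bounded (seq_limV L0 pL).
Qed.

(** This form covers every [z]: if [m + z < 0] then [pfacV] is 0, but [m < absz z] makes the
    quotient of powers at least 1. The loss [normc p ^- absz z] is later absorbed by the Gaussian
    decay of the theta series. *)
Lemma pfacV_near : exists2 G, 0 <= G & forall (m : nat) (z : int),
  normc (pfacV (m%:Z + z) - (pfac m)^-1) <= G * (normc p ^+ m / normc p ^+ absz z).
Proof.
have [H H0 HH] := pfac_inv_bounded.
pose D := expR (1 / (1 - normc p)) * (1 / (1 - normc p)).
have D0 : 0 <= D by rewrite mulr_ge0 ?expR_ge0 // divr_ge0 // subr_ge0 ltW.
have near a b : (a <= b)%N ->
    normc ((pfac b)^-1 - (pfac a)^-1) <= D * H ^+ 2 * normc p ^+ a.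
  move=> leab; have -> : (pfac b)^-1 - (pfac a)^-1 = (pfac a - pfac b) * ((pfac a)^-1 * (pfac
    b)^-1).
    by field; rewrite !pfac_neq0.
  rewrite !normcM mulrAC; apply: ler_pM; rewrite ?normc_ge0 ?mulr_ge0 ?normc_ge0 //.
    rewrite normcB -(subnKC leab); exact: (prod_cauchy ler01 (normp p1) defect_le).
  by rewrite expr2; apply: ler_pM; rewrite ?normc_ge0.
have near_min a b c : (c <= a)%N -> (c <= b)%N ->
    normc ((pfac b)^-1 - (pfac a)^-1) <= D * H ^+ 2 * normc p ^+ c.
  move=> lca lcb; wlog leab : a b lca lcb / (a <= b)%N => [W|].
    by have [|/ltnW] := leqP a b; [exact: W | rewrite normcB; exact: W].
  rewrite (le_trans (near _ _ leab)) // ler_wpM2l //.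
    by rewrite mulr_ge0 // exprn_ge0.
  by apply: ler_wiXn2l => //; apply: ltW.
exists (D * H ^+ 2 + H) => [|m z]; first by rewrite addr_ge0 // mulr_ge0 // exprn_ge0.
have rz0 : 0 < normc p ^+ absz z by rewrite exprn_gt0.
have DH0 : 0 <= D * H ^+ 2 by rewrite mulr_ge0 // exprn_ge0.
case E : (m%:Z + z) => [n|n] /=.
  apply: le_trans (_ : D * H ^+ 2 * (normc p ^+ m / normc p ^+ absz z) <= _); last first.
    by rewrite ler_wpM2r // ?lerDl // divr_ge0 // exprn_ge0 // ltW.
  apply: le_trans (near_min _ _ (m - absz z)%N _ _) _; [lia|lia|].
  rewrite ler_wpM2l // ler_pdivlMr // -exprD.
  by apply: ler_wiXn2l; [exact: ltW|exact: ltW|lia].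
rewrite sub0r normcN (le_trans (HH m)) //.
apply: le_trans (_ : H * 1 <= _); first by rewrite mulr1.
apply: ler_pM => //; first by rewrite lerDr.
by rewrite ler_pdivlMr // mul1r; apply: ler_wiXn2l; [exact: ltW|exact: ltW|lia].
Qed.

Lemma normcXz (z : C) (n : int) : normc (z ^ n) = normc z ^ n.
Proof. by case: n => n; rewrite ?NegzE -?invr_expz ?normcV -?exprnP normcX. Qed.

(** After multiplication by [2 ^+ n] the left side is [(normc p ^+ n * (2 * Q)) ^+ n], whose base is
    at most 1 from some [n0] on; [M ^+ n0] bounds the earlier values. *)
Lemma gauss_small (Q : R) : 0 <= Q ->
  exists2 B, 0 <= B & forall n : nat, normc p ^+ (n * n) * Q ^+ n <= B / 2 ^+ n.
Proof.
move=> Q0; have r1 := normp p1.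
have [n0 Hn] := geometric_small (2 * Q) r1 ltr01.
pose M := Num.max 1 (2 * Q).
have M1 : 1 <= M by rewrite le_max lexx.
exists (M ^+ n0) => [|n]; first by rewrite exprn_ge0 // (le_trans ler01).
rewrite ler_pdivlMr ?exprn_gt0 // -mulrA [Q ^+ n * _]mulrC -exprMn exprM -exprMn.
have [len|ltn] := leqP n0 n.
  apply: le_trans (_ : 1 <= _); last exact: exprn_ege1.
  apply: exprn_ile1; first by rewrite !mulr_ge0 // exprn_ge0 // ltW.
  by rewrite mulrC ltW // Hn.
apply: le_trans (_ : M ^+ n <= _); last by apply: ler_weXn2l => //; exact: ltnW.
apply: lerXn2r; rewrite ?nnegrE ?(le_trans ler01 M1) //.
  by rewrite !mulr_ge0 // exprn_ge0 // ltW.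
apply: le_trans (_ : 1 * (2 * Q) <= _); last by rewrite mul1r le_max lexx orbT.
by rewrite ler_wpM2r ?mulr_ge0 // exprn_ile1 // ltW.
Qed.

Lemma sum_gauss_bounded (t : int -> R) (Q : R) : 0 <= Q ->
  (forall i, t i <= normc p ^+ (absz i * absz i) * Q ^+ absz i) ->
  exists2 B, 0 <= B & forall M, \sum_(i <- int_range M) t i <= B.
Proof.
move=> Q0 tQ; have [B B0 HB] := gauss_small Q0.
have geo (m : nat) : \sum_(n < m) B / 2 ^+ n <= 2 * B.
  suff -> : \sum_(n < m) B / 2 ^+ n = 2 * B - 2 * B / 2 ^+ m.
    by rewrite gerBl divr_ge0 // ?mulr_ge0 // exprn_ge0.
  elim: m => [|m IH]; first by rewrite big_ord0 expr0; field.
  rewrite big_ord_recr /= IH exprS; have: (2 : R) ^+ m != 0 by rewrite expf_neq0 // pnatr_eq0.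
  by move: (2 ^+ m) => w w0; field.
exists (2 * B + 2 * B) => [|M]; first by rewrite addr_ge0 // mulr_ge0.
rewrite big_int_range; apply: lerD.
  apply: le_trans (geo M); apply: ler_sum => n _; rewrite (le_trans (tQ _)) //.
  have -> : absz (- n.+1%:Z) = n.+1 by lia.
  rewrite (le_trans (HB _)) // ler_wpM2l // lef_pV2 ?posrE ?exprn_gt0 //.
  by apply: ler_weXn2l; rewrite ?ler1n ?leqnSn.
apply: le_trans (geo M.+1); apply: ler_sum => n _.
by rewrite (le_trans (tQ _)) // HB.
Qed.

(** Summed over all [i], [theta_even] and [theta_odd] give Jacobi's theta_3 and, up to a constant,
    theta_2 with nome [p]: a basis of the even theta functions of degree 2, among which is
    [Ell p (x * y) * Ell p (x / y) / x] as a function of [x]. *)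
Definition theta_even (x : C) (i : int) : C := p ^ (i * i) * x ^ (i + i).
Definition theta_odd (x : C) (i : int) : C := p ^ (i * i + i) * x ^ (i + i + 1).
Definition theta_det (m : nat) (x y : C) : C :=
  (\sum_(i <- int_range m.+1) theta_odd x i) * (\sum_(j <- int_range m.+1) theta_even y j) -
  (\sum_(i <- int_range m.+1) theta_even x i) * (\sum_(j <- int_range m.+1) theta_odd y j).

Let pE n : p ^ n = P ^ (n + n).
Proof. by rewrite PE [P ^+ 2]exprnP exprz_exp; congr (_ ^ _); lia. Qed.

(** In the coordinates of [big_parity_split] the exponent [k^2 - k + l^2 - l] becomes
    [2(i^2 + i) + 2 j^2] or [2 i^2 + 2(j^2 + j)], without mixed term, and the sign is constant on
    each class. Only [theta_coef] still couples [i] and [j]. *)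
Lemma theta_part_product m x y : x != 0 -> y != 0 ->
  theta_part p (x * y) m * theta_part p (x / y) m =
  pfac (m + m) ^+ 2 * (x * \sum_(i <- int_range m.+1) \sum_(j <- int_range m.+1)
    (theta_coef m (i + j + 1) * theta_coef m (i + 1 - j) * (theta_odd x i * theta_even y j) -
     theta_coef m (i + j + 1) * theta_coef m (i - j) * (theta_even x i * theta_odd y j))).
Proof.
move=> x0 y0; rewrite !theta_part_series ?mulf_neq0 ?invr_eq0 // mulrACA -expr2.
congr (_ * _); rewrite mulr_suml mulr_sumr.
under eq_bigr => k _ do rewrite mulr_sumr.
rewrite (@big_parity_split _ m (fun k l => theta_coef m k * (-1) ^ k * P ^ (k * k - k) * (x * y) ^
  k *
    (theta_coef m l * (-1) ^ l * P ^ (l * l - l) * (x / y) ^ l))); last first.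
  have coef0 k : (m < absz k)%N -> theta_coef m k = 0.
    rewrite /theta_coef /pfacV => mk.
    case E1 : (m%:Z + k) => [n1|n1]; last by rewrite mul0r.
    case E2 : (m%:Z - k) => [n2|n2]; last by rewrite mulr0.
    by exfalso; lia.
  by move=> k l /orP[/coef0 ->|/coef0 ->]; rewrite ?mul0r ?mulr0.
apply: eq_bigr => i _; rewrite mulr_sumr; apply: eq_bigr => j _.
rewrite [RHS]mulrBr /theta_even /theta_odd !pE.
have divE k : (x / y) ^ k = x ^ k / y ^ k by rewrite expfzMl exprz_inv invr_expz.
have signE k l : (-1) ^ k * (-1) ^ l = (-1) ^ (k + l) :> C.
  by rewrite expfzDr // oppr_eq0 oner_eq0.
have even_sign k : (-1) ^ (k + k) = 1 :> C.
  by rewrite -signE; case: k => k;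
    rewrite ?NegzE -?invr_expz -?invfM -exprnP -expr2 sqrr_sign ?invr1.
have split_term k l s0 (c1 c2 t1 t2 t3 t4 : C) : (-1) ^ (k + l) = s0 -> y ^ l != 0 ->
    s0 * P ^ (k * k - k) * P ^ (l * l - l) * (x ^ k * x ^ l) * (y ^ k / y ^ l) = t1 * t2 * t3 * t4
      ->
    c1 * (-1) ^ k * P ^ (k * k - k) * (x * y) ^ k *
      (c2 * (-1) ^ l * P ^ (l * l - l) * (x / y) ^ l) = c1 * c2 * (t1 * t2 * (t3 * t4)).
  move=> <- yl; rewrite -signE expfzMl divE => E.
  rewrite [t1 * t2 * _]mulrA -E; move: yl.
  move: ((-1) ^ k) ((-1) ^ l) (P ^ (k * k - k)) (P ^ (l * l - l)) (x ^ k) (x ^ l) (y ^ k) (y ^ l).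
  by move=> s1 s2 P1 P2 x1 x2 y1 y2 yl; field.
have yD k l : y ^ k / y ^ l = y ^ (k - l) by rewrite invr_expz expfzDr.
have xS k : x * x ^ k = x ^ (k + 1) by rewrite expfzDr // expr1z mulrC.
congr (_ + _).
  rewrite [RHS]mulrCA.
  have -> : x * (P ^ (i * i + i + (i * i + i)) * x ^ (i + i + 1) * (P ^ (j * j + j * j) * y ^ (j +
    j))) =
     (P ^ (i * i + i + (i * i + i)) * P ^ (j * j + j * j) * (x * x ^ (i + i + 1) * y ^ (j + j))) by
       ring.
  apply: (split_term _ _ 1); rewrite ?expfz_neq0 //.
    have -> : i + j + 1 + (i + 1 - j) = (i + 1) + (i + 1) by ring.
    exact: even_sign.
  rewrite mul1r; congr (_ * _ * _).
  - by rewrite -[LHS]expfzDr // -[RHS]expfzDr //; congr (exprz P); ring.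
  - by rewrite -[LHS]expfzDr // xS; congr (exprz x); ring.
  - by rewrite yD; congr (exprz y); ring.
rewrite [X in _ = - X]mulrCA -mulrN.
have -> : - (x * (P ^ (i * i + i * i) * x ^ (i + i) * (P ^ (j * j + j + (j * j + j)) * y ^ (j + j +
  1)))) =
     (P ^ (i * i + i * i) * P ^ (j * j + j + (j * j + j)) * (x * x ^ (i + i) * - y ^ (j + j + 1)))
       by ring.
apply: (split_term _ _ (-1)); rewrite ?expfz_neq0 //.
  have -> : i + j + 1 + (i - j) = (i + i) + 1 by ring.
  by rewrite -signE even_sign mul1r expr1z.
rewrite !mulN1r mulrN !mulNr; congr (- (_ * _ * _)).
- by rewrite -[LHS]expfzDr // -[RHS]expfzDr //; congr (exprz P); ring.
- by rewrite -[LHS]expfzDr // xS; congr (exprz x); ring.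
- by rewrite yD; congr (exprz y); ring.
Qed.

Definition theta_const (m : nat) : C := (pfac m)^-1 ^+ 4.

(** All four [pfacV] involved are close to [(pfac m)^-1], and are replaced by it one at a time. *)
Lemma theta_coef_near : exists2 G, 0 <= G & forall (m K : nat) (k l : int),
  (absz k <= K)%N -> (absz l <= K)%N ->
  normc (theta_coef m k * theta_coef m l - theta_const m) <= G * (normc p ^+ m / normc p ^+ K).
Proof.
have [H H0 HH] := pfac_inv_bounded; have [G G0 HG] := pfacV_near.
exists (4 * H ^+ 3 * G) => [|m K k l kK lK]; first by rewrite !mulr_ge0 // exprn_ge0.
have bound z : normc (pfacV z) <= H by case: z => n;
  [exact: HH | rewrite -[pfacV (Negz n)]/(0 : C) normc0].
set e := (pfac m)^-1; have eH : normc e <= H by exact: HH.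
have near z : (absz z <= K)%N ->
    normc (pfacV (m%:Z + z) - e) <= G * (normc p ^+ m / normc p ^+ K).
  move=> zK; rewrite (le_trans (HG m z)) // ler_wpM2l // ler_wpM2l ?exprn_ge0 ?(ltW r0) //.
  by rewrite lef_pV2 ?posrE ?exprn_gt0 //; apply: ler_wiXn2l => //; exact: ltW.
rewrite /theta_coef /theta_const -/e.
have := near _ kK; have := near (- k); have := near _ lK; have := near (- l).
rewrite !abszN => /(_ lK) d4 d3 /(_ kK) d2 d1.
have := bound (m%:Z - k); have := bound (m%:Z + l); have := bound (m%:Z - l).
move: (pfacV (m%:Z + k)) (pfacV (m%:Z - k)) (pfacV (m%:Z + l)) (pfacV (m%:Z - l)) d1 d2 d3 d4.
rewrite -[4 * _ * G * _]mulrA; move: (G * _) => X a b c d d1 d2 d3 d4 dH cH bH.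
have -> : a * b * (c * d) - e ^+ 4 = (a - e) * b * c * d + (e * (b - e) * c * d +
   (e * e * (c - e) * d + e * e * e * (d - e))) by ring.
have X0 : 0 <= X := le_trans (normc_ge0 _) d1.
have prod4 (u v w z : C) : normc u <= X -> normc v <= H -> normc w <= H -> normc z <= H ->
    normc (u * v * w * z) <= X * H * H * H.
  move=> *; rewrite !normcM; apply: ler_pM; rewrite ?mulr_ge0 ?normc_ge0 //.
  apply: ler_pM; rewrite ?mulr_ge0 ?normc_ge0 //.
  by apply: ler_pM; rewrite ?normc_ge0.
have t1 := prod4 (a - e) b c d d1 bH cH dH.
have t2 := prod4 (b - e) e c d d2 eH cH dH.
have t3 := prod4 (c - e) e e d d3 eH eH dH.
have t4 := prod4 (d - e) e e e d4 eH eH eH.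
have -> : e * (b - e) * c * d = (b - e) * e * c * d by ring.
have -> : e * e * (c - e) * d = (c - e) * e * e * d by ring.
have -> : e * e * e * (d - e) = (d - e) * e * e * e by ring.
have -> : 4 * H ^+ 3 * X = X * H * H * H + (X * H * H * H + (X * H * H * H + X * H * H * H)) by
  ring.
do 3! (apply: le_trans (le_normcD _ _) _; apply: lerD => //).
Qed.

Lemma theta_even_odd_bounded x : x != 0 ->
  exists2 B, 0 <= B & forall M,
    \sum_(i <- int_range M) normc (theta_even x i) / normc p ^+ absz i <= B /\
    \sum_(i <- int_range M) normc (theta_odd x i) / normc p ^+ absz i <= B.
Proof.
move=> x0; pose r := normc p; pose X := normc x.
have X0 : 0 < X by rewrite normc_gt0.
have r_neq0 : r != 0 by rewrite gt_eqF.
have X_neq0 : X != 0 by rewrite gt_eqF.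
have r_le1 : r <= 1 by exact: ltW.
(* [Q] dominates the four bases that occur at indices [n] and [- n]: [X^2 / r] and [X^-2 / r] for
   [theta_even], [X^2] and [X^-2 / r^2] for [theta_odd]. *)
pose Q := (X ^+ 2 + X ^- 2) / r ^+ 2.
have X2 : 0 <= X ^+ 2 by rewrite exprn_ge0 // ltW.
have XV2 : 0 <= X ^- 2 by rewrite invr_ge0.
have Q0 : 0 <= Q by rewrite divr_ge0 ?addr_ge0 // exprn_ge0 // ltW.
have rr : r ^+ 2 <= r by rewrite expr2 ler_piMl // ltW.
have Q1 : X ^+ 2 / r <= Q.
  rewrite /Q; apply: ler_pM => //; first by rewrite invr_ge0 ltW.
    by rewrite lerDl.
  by rewrite lef_pV2 ?posrE ?exprn_gt0.
have Q2 : X ^- 2 / r <= Q.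
  rewrite /Q; apply: ler_pM => //; first by rewrite invr_ge0 ltW.
    by rewrite lerDr.
  by rewrite lef_pV2 ?posrE ?exprn_gt0.
have Q3 : X ^+ 2 <= Q.
  by apply: le_trans Q1; rewrite ler_pdivlMr // ler_piMr.
have Q4 : X ^- 2 / r ^+ 2 <= Q.
  by rewrite /Q ler_wpM2r ?invr_ge0 ?exprn_ge0 ?(ltW r0) // lerDr.
have bound (t : int -> R) : (forall n : nat, t n%:Z <= r ^+ (n * n) * Q ^+ n) ->
    (forall n : nat, t (- n%:Z) <= r ^+ (n * n) * Q ^+ n) ->
    exists2 B, 0 <= B & forall M, \sum_(i <- int_range M) t i <= B.
  move=> tp tn; apply: sum_gauss_bounded Q0 _ => i.
  by have [E|E] := int_absz_cases i; rewrite [in t i]E.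
have step (n : nat) (y : R) : 0 <= y -> y <= Q -> r ^+ (n * n) * y ^+ n <= r ^+ (n * n) * Q ^+ n.
  move=> y0 yQ; rewrite ler_wpM2l ?exprn_ge0 ?(ltW r0) //.
  by apply: lerXn2r.
have zE (y : R) (n : nat) : y ^ (- n%:Z) = y ^- n by rewrite -invr_expz.
have sqE (y : R) (n : nat) : (y ^+ 2) ^+ n = y ^+ n * y ^+ n by rewrite exprAC expr2.
have rn (n : nat) : r ^+ n != 0 by rewrite expf_neq0.
have Xn (n : nat) : X ^+ n != 0 by rewrite expf_neq0.
have evenE (i : int) : normc (theta_even x i) = r ^ (i * i) * (X ^ i * X ^ i).
  by rewrite normcM !normcXz expfzDr.
have oddE (i : int) : normc (theta_odd x i) = r ^ (i * i) * r ^ i * (X ^ i * X ^ i) * X.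
  by rewrite normcM !normcXz !expfzDr // expr1z !mulrA.
have nnE (n : nat) : (- n%:Z) * (- n%:Z) = (n * n)%N by rewrite mulrNN.
have [B1 B10 HB1] : exists2 B, 0 <= B & forall M,
    \sum_(i <- int_range M) normc (theta_even x i) / r ^+ absz i <= B.
  apply: bound => n.
    suff -> : normc (theta_even x n%:Z) / r ^+ absz n = r ^+ (n * n) * (X ^+ 2 / r) ^+ n.
      by apply: step; rewrite // divr_ge0 // ltW.
    by rewrite evenE -PoszM -!exprnP expr_div_n sqE -[LHS]mulrA.
  suff -> : normc (theta_even x (- n%:Z)) / r ^+ absz (- n%:Z) = r ^+ (n * n) * (X ^- 2 / r) ^+ n.
    by apply: step; rewrite // divr_ge0 // ltW.
  by rewrite evenE nnE abszN -exprnP !zE expr_div_n exprVn sqE invfM -[LHS]mulrA.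
have [B2 B20 HB2] : exists2 B, 0 <= B & forall M,
    \sum_(i <- int_range M) normc (theta_odd x i) / X / r ^+ absz i <= B.
  apply: bound => n.
    suff -> : normc (theta_odd x n%:Z) / X / r ^+ absz n = r ^+ (n * n) * (X ^+ 2) ^+ n.
      exact: step.
    rewrite oddE -PoszM -!exprnP sqE.
    by have := rn n; move: (r ^+ n) => u u0; field; rewrite u0.
  suff -> : normc (theta_odd x (- n%:Z)) / X / r ^+ absz (- n%:Z) = r ^+ (n * n) * (X ^- 2 / r ^+
    2) ^+ n.
    by apply: step; rewrite // divr_ge0 // exprn_ge0 // ltW.
  rewrite oddE nnE abszN -exprnP !zE expr_div_n exprVn !sqE.
  have := rn n; have := Xn n; move: (r ^+ n) (X ^+ n) => u v v0 u0.
  by field; rewrite u0 v0.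
exists (B1 + X * B2) => [|M]; first by rewrite addr_ge0 // mulr_ge0 // ltW.
split; first by rewrite (le_trans (HB1 M)) // lerDl mulr_ge0 // ltW.
apply: le_trans (_ : X * B2 <= _); last by rewrite lerDr.
rewrite (le_trans _ (ler_wpM2l (ltW X0) (HB2 M))) // mulr_sumr ler_sum // => i _.
by rewrite [_ / X]mulrC -mulrA mulVKf.
Qed.

(* The triple product makes the left side a double series over [Z^2], which splits according
   to [big_parity_split] into a 2 x 2 determinant; determinants satisfy the Pluecker
   relation. *)
Lemma theta_part_det x y : x != 0 -> y != 0 -> exists B, forall m,
  normc (theta_part p (x * y) m * theta_part p (x / y) m / x -
         pfac (m + m) ^+ 2 * theta_const m * theta_det m x y) <= B * normc p ^+ m.
Proof.
move=> x0 y0.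
have [G G0 HG] := theta_coef_near.
have [Bx Bx0 HBx] := theta_even_odd_bounded x0.
have [By By0 HBy] := theta_even_odd_bounded y0.
have [L L0 pL] := pfac_lim; have [U U0 HU] := seq_lim_bounded pL.
exists (U ^+ 2 * (G / normc p * (Bx * By + Bx * By))) => m.
have factor (u S k D : C) : u * (x * S) / x - u * k * D = u * (S - k * D) by field.
rewrite theta_part_product // factor normcM -[U ^+ 2 * _ * _]mulrA.
apply: ler_pM; rewrite ?normc_ge0 //.
  by rewrite normcX; apply: lerXn2r; rewrite ?nnegrE ?normc_ge0.
pose c1 i j := theta_coef m (i + j + 1) * theta_coef m (i + 1 - j) - theta_const m.
pose c2 i j := theta_coef m (i + j + 1) * theta_coef m (i - j) - theta_const m.
set S := \sum_(i <- _) _.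
have -> : S - theta_const m * theta_det m x y =
    \sum_(i <- int_range m.+1) \sum_(j <- int_range m.+1)
      (c1 i j * (theta_odd x i * theta_even y j) - c2 i j * (theta_even x i * theta_odd y j)).
  rewrite /S /theta_det mulrBr !big_distrlr /= !mulr_sumr -sumrB -sumrB; apply: eq_bigr => i _.
  rewrite !mulr_sumr -sumrB -sumrB; apply: eq_bigr => j _; rewrite /c1 /c2; ring.
pose ratio (f : C -> int -> C) z i := normc (f z i) / normc p ^+ absz i.
have ratio_ge0 f z i : 0 <= ratio f z i by rewrite divr_ge0 ?normc_ge0 // exprn_ge0 // ltW.
pose E := G / normc p * normc p ^+ m.
have E0 : 0 <= E by rewrite mulr_ge0 ?divr_ge0 ?exprn_ge0 // ltW.
(* The loss at [|i| + |j| + 1] splits into [1 / normc p], a weight in [i] and a weight in [j], so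
   the double sum of the bounds factors. *)
have cE i j k l : (absz k <= (absz i + absz j).+1)%N -> (absz l <= (absz i + absz j).+1)%N ->
   forall f g, normc ((theta_coef m k * theta_coef m l - theta_const m) * (f x i * g y j)) <=
     E * (ratio f x i * ratio g y j).
  move=> kK lK f g; rewrite !normcM.
  apply: le_trans (ler_wpM2r _ (HG m _ k l kK lK)) _; first by rewrite mulr_ge0 ?normc_ge0.
  rewrite /E /ratio exprS exprD.
  have : normc p ^+ absz i != 0 by rewrite expf_neq0 // gt_eqF.
  have : normc p ^+ absz j != 0 by rewrite expf_neq0 // gt_eqF.
  have : normc p != 0 by rewrite gt_eqF.
  move: (normc p ^+ absz i) (normc p ^+ absz j) (normc p ^+ m) (normc p) => u v w r r'0 v0 u0.
  by rewrite le_eqVlt; apply/orP; left; apply/eqP; field; rewrite r'0 u0 v0.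
apply: le_trans (_ : \sum_(i <- int_range m.+1) \sum_(j <- int_range m.+1)
    (E * (ratio theta_odd x i * ratio theta_even y j) +
     E * (ratio theta_even x i * ratio theta_odd y j)) <= _).
  apply: le_trans (normc_sum _ _ _) _; apply: ler_sum => i _.
  apply: le_trans (normc_sum _ _ _) _; apply: ler_sum => j _.
  apply: le_trans (le_normcD _ _) _; rewrite normcN; apply: lerD.
    by apply: cE; clear; lia.
  by apply: cE; clear; lia.
have -> : \sum_(i <- int_range m.+1) \sum_(j <- int_range m.+1)
    (E * (ratio theta_odd x i * ratio theta_even y j) +
     E * (ratio theta_even x i * ratio theta_odd y j)) =
  E * ((\sum_(i <- int_range m.+1) ratio theta_odd x i) *
       (\sum_(j <- int_range m.+1) ratio theta_even y j) +
       (\sum_(i <- int_range m.+1) ratio theta_even x i) *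
       (\sum_(j <- int_range m.+1) ratio theta_odd y j)).
  rewrite !big_distrlr /= -big_split mulr_sumr; apply: eq_bigr => i _ /=.
  by rewrite -big_split mulr_sumr; apply: eq_bigr => j _ /=; rewrite mulrDr.
have [xe xo] := HBx m.+1; have [ye yo] := HBy m.+1.
rewrite [leRHS]mulrAC -/E; apply: ler_wpM2l => //.
by apply: lerD; apply: ler_pM => //; apply: sumr_ge0.
Qed.

Lemma Ell_addition_nonzero x y u v : x != 0 -> y != 0 -> u != 0 -> v != 0 ->
  let psi x y := Ell p (x * y) * Ell p (x / y) / x in
  psi x y * psi u v - psi x u * psi y v + psi x v * psi y u = 0.
Proof.
move=> x0 y0 u0 v0 psi.
pose D m x y := pfac (m + m) ^+ 2 * theta_const m * theta_det m x y.
have lim s t : s != 0 -> t != 0 -> seq_lim (fun m => D m s t) (psi s t).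
  move=> s0 t0.
  have L : seq_lim (fun m => theta_part p (s * t) m * theta_part p (s / t) m / s) (psi s t).
    apply: seq_limM (seq_lim_cst _); apply: seq_limM; exact: Ell_lim.
  have Z : seq_lim (fun m => theta_part p (s * t) m * theta_part p (s / t) m / s - D m s t) 0.
    have [B HB] := theta_part_det s0 t0; apply/seq_lim_normcP => e e0.
    have [k0 Hk] := geometric_small B (normp p1) e0; exists k0 => k /Hk lt.
    by rewrite subr0; apply: le_lt_trans (HB k) lt.
  have := seq_limD L (seq_limN Z); rewrite oppr0 addr0; apply: eq_seq_lim => m.
  by rewrite opprB addrC subrK.
(* [D m] is a scaled 2 by 2 determinant for each [m], so the relation is exact before the limit. *)
have zero : seq_lim (fun m => D m x y * D m u v + - (D m x u * D m y v) + D m x v * D m y u) 0.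
  have pluecker (w a0 a1 b0 b1 c0 c1 d0 d1 : C) :
      0 = w * (a1 * b0 - a0 * b1) * (w * (c1 * d0 - c0 * d1)) +
          - (w * (a1 * c0 - a0 * c1) * (w * (b1 * d0 - b0 * d1))) +
          w * (a1 * d0 - a0 * d1) * (w * (b1 * c0 - b0 * c1)) by ring.
  by apply: eq_seq_lim (seq_lim_cst 0) => m; exact: pluecker.
symmetry; apply: seq_lim_unique zero _.
apply: seq_limD; [apply: seq_limD; [|apply: seq_limN] |]; apply: seq_limM; exact: lim.
Qed.

End NonzeroNome.

Lemma Ell_addition x y u v : x != 0 -> y != 0 -> u != 0 -> v != 0 ->
  let psi x y := Ell p (x * y) * Ell p (x / y) / x in
  psi x y * psi u v - psi x u * psi y v + psi x v * psi y u = 0.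
Proof.
move=> x0 y0 u0 v0; have [p0|p0] := eqVneq p 0; last first.
  apply: (@Ell_addition_nonzero (sqrtC p)); rewrite ?sqrtC_eq0 //.
  by rewrite sqrtCK.
have E y' : Ell p y' = 1 - y'.
  apply: seq_lim_unique (Ell_lim p1 y') _ => e e0; exists 1%N => -[//|k] _.
  rewrite theta_partE big_ord_recl big1 => [|i _].
    by rewrite p0 expr0 expr1 mul0r subr0 !mulr1 subrr normr0.
  by rewrite p0 /= !exprS !mul0r mulr0 subr0 mulr1.
by rewrite /= !E; field; rewrite x0 y0 u0 v0.
Qed.

End Addition.

(** * The odd theta function of the logarithm *)

Section Sigma.
Local Open Scope classical_set_scope.
Local Open Scope ring_scope.
Variable R : realType.

Lemma poly_roots_in_seq (F : {poly R}) : F != 0 ->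
  exists s : seq R, forall t, root F t -> t \in s.
Proof.
move: {2}(size F) (leqnn (size F)) => n; elim: n F => [|n IH] F szF F0.
  by move: F0; rewrite -size_poly_eq0 -leqn0 szF.
have [[t rt]|no_root] := pselect (exists t, root F t); last first.
  by exists [::] => t rt; exfalso; apply: no_root; exists t.
have /factor_theorem[G FE] := rt.
have G0 : G != 0 by apply: contraNneq F0 => G0; rewrite FE G0 mul0r.
have [|s Hs] := IH G _ G0; first by move: szF;
  rewrite FE size_Mmonic ?monicXsubC // size_XsubC addn2.
exists (t :: s) => u; rewrite FE rootM root_XsubC inE => /orP[/Hs ->|->]; by rewrite ?orbT.
Qed.

Local Notation C := R[i].

Definition cexp (z : C) : C :=
  ((expR (complex.Re z) * cos (complex.Im z)) +i* (expR (complex.Re z) * sin (complex.Im z)))%C.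

Lemma cexpD z w : cexp (z + w) = cexp z * cexp w.
Proof.
case: z => a b; case: w => c d; rewrite /cexp /= expRD cosD sinD.
by congr (_ +i* _)%C; ring.
Qed.

Lemma cexp0 : cexp 0 = 1.
Proof. by rewrite /cexp /= expR0 cos0 sin0 !mul1r. Qed.

Lemma normc_cexp z : normc (cexp z) = expR (complex.Re z).
Proof.
case: z => a b; rewrite /cexp /= !exprMn -mulrDr cos2sin2 subrK mulr1 sqrtr_sqr.
by rewrite ger0_norm // expR_ge0.
Qed.

Lemma cexp_neq0 z : cexp z != 0.
Proof. by rewrite -normc_gt0 normc_cexp expR_gt0. Qed.

Lemma cexpN z : cexp (- z) = (cexp z)^-1.
Proof.
by apply: (mulfI (cexp_neq0 z)); rewrite -cexpD subrr cexp0 mulfV // cexp_neq0.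
Qed.

Lemma cexpX z k : cexp (k%:R * z) = cexp z ^+ k.
Proof.
elim: k => [|k IH]; first by rewrite mul0r cexp0.
by rewrite -natr1 mulrDl mul1r cexpD IH exprSr.
Qed.

Lemma cexp_onto y : y != 0 -> exists z, cexp z = y.
Proof.
move=> y0; have n0 : 0 < normc y by rewrite normc_gt0.
case: y y0 n0 => a b y0; set r := normc _ => r0; have rn0 : r != 0 by rewrite gt_eqF.
have rE : r ^+ 2 = a ^+ 2 + b ^+ 2 by rewrite /r /= sqr_sqrtr // addr_ge0 ?sqr_ge0.
have ar : -1 <= a / r <= 1.
  rewrite -ler_norml normrM normfV (ger0_norm (ltW r0)) ler_pdivrMr // mul1r.
  exact: (abs_Re (a +i* b)%C).
have er : expR (ln r) = r by rewrite lnK.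
have cE : r * cos (acos (a / r)) = a.
  by rewrite acosK ?in_itv //= mulrCA mulfV ?mulr1.
have sE : r * sin (acos (a / r)) = `|b|.
  rewrite sin_acos //; have -> : 1 - (a / r) ^+ 2 = (b / r) ^+ 2.
    by have : b ^+ 2 = r ^+ 2 - a ^+ 2 by [rewrite rE; ring]; rewrite !expr_div_n => ->; field.
  by rewrite sqrtr_sqr normrM normfV (ger0_norm (ltW r0)) mulrCA mulfV ?mulr1.
(* [acos] takes values in [[0, pi]], so the sign of [b] must be put into the argument. *)
have [b0|b0] := lerP 0 b.
  exists (ln r +i* acos (a / r))%C; rewrite /cexp /= er cE sE ger0_norm //.
exists (ln r +i* - acos (a / r))%C; rewrite /cexp /= er cosN sinN cE mulrN sE ltr0_norm // opprK //.
Qed.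

Lemma seq_lim_ReIm (u : nat -> C) (L : C) :
  (fun k => complex.Re (u k)) @ \oo --> complex.Re L ->
  (fun k => complex.Im (u k)) @ \oo --> complex.Im L -> seq_lim u L.
Proof.
move=> /cvgrPdist_lt uR /cvgrPdist_lt uI; apply/seq_lim_normcP => e e0.
have e20 : 0 < e / 2%:R by rewrite divr_gt0.
have [k1 _ H1] := uR _ e20; have [k2 _ H2] := uI _ e20.
exists (maxn k1 k2) => k; rewrite geq_max => /andP[/H1 /= h1 /H2 /= h2].
rewrite normcB; apply: le_lt_trans (normc_le _) _; rewrite !raddfB /=.
by rewrite (splitr e); apply: ltrD.
Qed.

Lemma seq_lim_Re (u : nat -> C) (L : C) : seq_lim u L ->
  (fun k => complex.Re (u k)) @ \oo --> complex.Re L.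
Proof.
move=> /seq_lim_normcP uL; apply/cvgrPdist_lt => e /uL[k0 Hk]; exists k0 => // k /= /Hk lt.
by rewrite -raddfB; apply: le_lt_trans (abs_Re _) _; rewrite normcB.
Qed.

Lemma seq_lim_Im (u : nat -> C) (L : C) : seq_lim u L ->
  (fun k => complex.Im (u k)) @ \oo --> complex.Im L.
Proof.
move=> /seq_lim_normcP uL; apply/cvgrPdist_lt => e /uL[k0 Hk]; exists k0 => // k /= /Hk lt.
by rewrite -raddfB; apply: le_lt_trans (abs_Im _) _; rewrite normcB.
Qed.

Lemma cexp_continuous (u : nat -> C) L : seq_lim u L -> seq_lim (fun k => cexp (u k)) (cexp L).
Proof.
move=> uL; have uR := seq_lim_Re uL; have uI := seq_lim_Im uL.
apply: seq_lim_ReIm => /=; apply: cvgM.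
- by apply: continuous_cvg uR; exact: continuous_expR.
- by apply: continuous_cvg uI; exact: continuous_cos.
- by apply: continuous_cvg uR; exact: continuous_expR.
- by apply: continuous_cvg uI; exact: continuous_sin.
Qed.

Variable p : C.
Hypothesis p1 : normc p < 1.

Definition sigma (z : C) : C := Ell p (cexp z) * cexp (- (z / 2%:R)).

Lemma EllE z : Ell p (cexp z) = sigma z * cexp (z / 2%:R).
Proof. by rewrite /sigma -mulrA -cexpD addNr cexp0 mulr1. Qed.

Lemma sigma_odd z : sigma (- z) = - sigma z.
Proof.
rewrite /sigma (cexpN z) (EllV p1 (cexp_neq0 z)) -cexpN -mulrA -cexpD mulNr.
by congr (- (_ * cexp _)); field.
Qed.

Lemma sigma_psi x y : sigma (x + y) * sigma (x - y) =
  Ell p (cexp x * cexp y) * Ell p (cexp x / cexp y) / cexp x.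
Proof.
rewrite /sigma mulrACA -cexpD -!cexpN -!cexpD; by congr (_ * cexp _); field.
Qed.

Lemma sigma_add x y u v :
  sigma (x + y) * sigma (x - y) * (sigma (u + v) * sigma (u - v)) -
  sigma (x + u) * sigma (x - u) * (sigma (y + v) * sigma (y - v)) +
  sigma (x + v) * sigma (x - v) * (sigma (y + u) * sigma (y - u)) = 0.
Proof.
rewrite (sigma_psi x y) (sigma_psi u v) (sigma_psi x u) (sigma_psi y v) (sigma_psi x v) (sigma_psi
  y u).
exact: (Ell_addition p1 (cexp_neq0 x) (cexp_neq0 y) (cexp_neq0 u) (cexp_neq0 v)).
Qed.

Lemma sigma_eq0 z : sigma z = 0 -> exists j : int, complex.Re z = j%:~R * ln (normc p).
Proof.
move=> /eqP; rewrite mulf_eq0 (negbTE (cexp_neq0 _)) orbF => /eqP.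
move=> /(Ell_eq0 p1 (cexp_neq0 z)); rewrite normc_cexp; case=> j jE.
by exists j; rewrite -jE expRK.
Qed.

Lemma sigma_continuous (u : nat -> C) L :
  seq_lim u L -> seq_lim (fun k => sigma (u k)) (sigma L).
Proof.
move=> uL; apply: seq_limM.
  by apply: Ell_continuous; rewrite ?cexp_neq0 //; exact: cexp_continuous.
by apply: cexp_continuous; apply: seq_limN; apply: seq_limM uL (seq_lim_cst _).
Qed.

Lemma Re_intM (k : int) (z : C) : complex.Re (k%:~R * z) = k%:~R * complex.Re z.
Proof. by rewrite -(rmorph_int (real_complex R)); case: z => u v /=; rewrite mul0r subr0. Qed.

(* Every integral relation between the perturbed parameters is a nonzero polynomial condition
   on [t], because the powers of [t] are distinct. *)
Definition perturb (u : C) (t : R) (k : nat) : C := u + (t ^+ k)%:C%C.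

(** Zeros of [sigma] have real part in the integral multiples of [ln (normc p)], so a relation with
    coefficients [ka, ..., kx] can fail to be avoided only at a root of one of the polynomials
    indexed by [j]. There are countably many such roots in all, and the interval has positive
    measure. *)
Lemma generic_perturbation (a b c d q x : C) (e : R) : 0 < e ->
  exists2 t : R, 0 < t < e &
    generic sigma (perturb a t 1) (perturb b t 2) (perturb c t 3) (perturb d t 4)
      (perturb q t 5) (perturb x t 6).
Proof.
move=> e0; pose I : countType := (int * int * int * int * int * int * int)%type.
pose poly_of (k : I) : {poly R} := let: (ka, kb, kc, kd, kq, kx, j) := k in
  Poly [:: ka%:~R * complex.Re a + kb%:~R * complex.Re b + kc%:~R * complex.Re c
           + kd%:~R * complex.Re d + kq%:~R * complex.Re q + kx%:~R * complex.Re x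
           - j%:~R * ln (normc p); ka%:~R; kb%:~R; kc%:~R; kd%:~R; kq%:~R; kx%:~R].
pose bad := \bigcup_(k in [set k : I | poly_of k != 0]) [set t : R | root (poly_of k) t].
have bad_countable : countable bad.
  apply: bigcup_countable => // k /= k0; apply: finite_set_countable.
  have [rts Hr] := poly_roots_in_seq k0.
  by apply: (sub_finite_set (B := [set` rts])) => // t /= /Hr.
have [t t_itv t_good] : exists2 t : R, 0 < t < e & ~ bad t.
  apply: contrapT => H.
  have sub : `]0, e[%classic `<=` bad.
    move=> t /=; rewrite in_itv => t_itv; apply: contrapT => t_bad; apply: H.
    by exists t.
  have := countable_lebesgue_measure0 (sub_countable (subset_card_le sub) bad_countable).
  rewrite lebesgue_measure_itv /= lte_fin e0 oppr0 adde0 => -[] /eqP.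
  by rewrite gt_eqF.
exists t => //.
move=> ka kb kc kd kq kx nz; apply/negP => /eqP /sigma_eq0[j jE].
apply: t_good; exists (ka, kb, kc, kd, kq, kx, j); rewrite /mkset /poly_of.
  apply/negP => /eqP F0; move: nz.
  have {}F0 : Poly [:: _; ka%:~R; kb%:~R; kc%:~R; kd%:~R; kq%:~R; kx%:~R] = 0 :> {poly R} := F0.
  set c0 := (X in Poly [:: X; _; _; _; _; _; _]) in F0.
  have coef i : [:: c0; ka%:~R; kb%:~R; kc%:~R; kd%:~R; kq%:~R; kx%:~R]`_i = 0 :> R.
    by rewrite -coef_Poly F0 coef0.
  have /eqP := coef 1%N; have /eqP := coef 2%N; have /eqP := coef 3%N.
  have /eqP := coef 4%N; have /eqP := coef 5%N; have /eqP := coef 6%N.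
  by rewrite /= !intr_eq0; do 6! move=> /eqP ->.
rewrite /root horner_Poly; apply/eqP.
move: jE; rewrite /perturb !raddfD /= !Re_intM !raddfD /= => jE.
by rewrite /= -jE; ring.
Qed.

End Sigma.

(** * From generic to arbitrary parameters *)

Section Conversion.
Variable R : realType.
Local Notation C := R[i].
Variable p : C.
Hypothesis p1 : normc p < 1.
Local Notation sg := (sigma p).
Local Notation sph := (ph sg).

Lemma cexp_sum (I : Type) (r : seq I) (P : pred I) (f : I -> C) :
  cexp (\sum_(i <- r | P i) f i) = \prod_(i <- r | P i) cexp (f i).
Proof. exact: (big_morph (@cexp R) (@cexpD R) (@cexp0 R)). Qed.

Lemma cexpXz (z : C) (n : int) : cexp z ^ n = cexp (n%:~R * z).
Proof.
case: n => n; first by rewrite -exprnP -cexpX.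
by rewrite NegzE -invr_expz -exprnP -cexpX -cexpN -mulNr mulrNz.
Qed.

(* The quadratic part of the monomial only depends on [q] and [k], hence cancels in ratios. *)
Lemma epochE (q y : C) (k : nat) : epoch p (cexp y) (cexp q) (Posz k) =
  sph q y k * cexp (k%:R * (y / 2)) * cexp ('C(k, 2)%:R * (q / 2)).
Proof.
rewrite /=; elim: k => [|k IH].
  by rewrite /ph !big_ord0 !mul0r cexp0 !mulr1.
rewrite big_ord_recr /= IH phS -cexpX -cexpD EllE.
rewrite binS bin1 natrD.
have -> : (y + k%:R * q) / 2 = y / 2 + k%:R * (q / 2) by field.
have -> : k.+1%:R * (y / 2) = k%:R * (y / 2) + y / 2 by rewrite -natr1; ring.
rewrite mulrDl !cexpD; ring.
Qed.

Lemma epoch_neq0 (q y : C) (k : nat) :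
  (epoch p (cexp y) (cexp q) (Posz k) != 0) = (sph q y k != 0).
Proof. by rewrite epochE !mulf_eq0 !(negbTE (cexp_neq0 _)) !orbF. Qed.

Lemma epoch_ratio (q y1 y2 : C) (k : nat) :
  epoch p (cexp y1) (cexp q) (Posz k) / epoch p (cexp y2) (cexp q) (Posz k) =
  sph q y1 k / sph q y2 k * cexp (k%:R * ((y1 - y2) / 2)).
Proof.
rewrite !epochE; have -> : k%:R * ((y1 - y2) / 2) = k%:R * (y1 / 2) - k%:R * (y2 / 2) by field.
rewrite cexpD cexpN !invfM; have := cexp_neq0 ('C(k, 2)%:R * (q / 2)).
move: (cexp ('C(k, 2)%:R * (q / 2))) (sph q y2 k)^-1 (cexp (k%:R * (y2 / 2)))^-1 => u v w u0.
by field.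
Qed.

Lemma Ell_neq0 z : (Ell p (cexp z) != 0) = (sg z != 0).
Proof. by rewrite EllE mulf_eq0 (negbTE (cexp_neq0 _)) orbF. Qed.

Lemma Ell_ratio y1 y2 : Ell p (cexp y1) / Ell p (cexp y2) = sg y1 / sg y2 * cexp ((y1 - y2) / 2).
Proof.
rewrite !EllE mulrBl cexpD cexpN invfM; ring.
Qed.

(** The normalizing exponentials leave [x^(2 k)], which involves the upper row only. Row [i] is the
    upper one in [n - 1 - i] pairs, and these contributions cancel what is left in
    [single_conversion]. *)
Lemma pair_conversion (a q x : C) (i j k l : nat) : (i < j)%N -> (l <= k)%N ->
  Ell p (cexp x ^+ (j - i) * cexp q ^ (Posz k - Posz l)) / Ell p (cexp x ^+ (j - i))
    * (Ell p (cexp a * cexp x ^- (i + j) * cexp q ^+ (k + l)) / Ell p (cexp a * cexp x ^- (i + j)))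
    * (epoch p (cexp a * cexp x ^ (1 - Posz (i + j))) (cexp q) (Posz k + Posz l)
       * epoch p (cexp x ^+ (j - i).+1) (cexp q) (Posz k - Posz l))
    / (epoch p (cexp a * cexp q * cexp x ^- (i + j).+1) (cexp q) (Posz k + Posz l)
       * epoch p (cexp q * cexp x ^+ (j - i - 1)) (cexp q) (Posz k - Posz l)) =
  pair_weight sg (a - i%:R * x - j%:R * x) (j%:R * x - i%:R * x) q x (k + l) (k - l)
    * cexp (k%:R * x + k%:R * x).
Proof.
move=> ltij lekl; rewrite subzn // -PoszD -exprnP cexpXz -!cexpX -!cexpN -!cexpD.
have ji : (j - i)%:R = j%:R - i%:R :> C by rewrite natrB // ltnW.
have ji1 : (j - i - 1)%:R = j%:R - i%:R - 1 :> C by rewrite natrB ?subn_gt0 // ji.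
have kl : (k - l)%:R = k%:R - l%:R :> C by rewrite natrB.
set A := a - i%:R * x - j%:R * x; set D := j%:R * x - i%:R * x.
have -> : (j - i)%:R * x = D by rewrite ji mulrBl.
have -> : a - (i + j)%:R * x = A by rewrite natrD /A; ring.
have -> : a + (1 - Posz (i + j))%:~R * x = A + x by rewrite intrB -pmulrn natrD /A; ring.
have -> : (j - i).+1%:R * x = D + x by rewrite -natr1 ji /D; ring.
have -> : a + q - (i + j).+1%:R * x = A + q - x by rewrite -natr1 natrD /A; ring.
have -> : q + (j - i - 1)%:R * x = D + q - x by rewrite ji1 /D; ring.
rewrite -[X in X = _]mulrA -mulf_div !epoch_ratio !Ell_ratio /pair_weight.
have -> : k%:R * x + k%:R * x = (D + (k - l)%:R * q - D) / 2 + ((A + (k + l)%:R * q - A) / 2 +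
   ((k + l)%:R * ((A + x - (A + q - x)) / 2) + (k - l)%:R * ((D + x - (D + q - x)) / 2))).
  by rewrite kl natrD; field.
rewrite !cexpD !invfM; ring.
Qed.

Lemma params_conversion (a q x : C) (i k : nat) (rs : seq C) :
  (\prod_(r <- rs) epoch p (cexp r * cexp x ^- i) (cexp q) (Posz k)) /
  (\prod_(r <- rs) epoch p (cexp (a + q - r) * cexp x ^- i) (cexp q) (Posz k)) =
  \prod_(r <- rs) (sph q (r - i%:R * x) k / sph q (a + q - r - i%:R * x) k) *
  cexp (k%:R * \sum_(r <- rs) (r - (a + q) / 2)).
Proof.
rewrite -prodf_div mulr_sumr cexp_sum -big_split /=; apply: eq_bigr => r _.
rewrite -!cexpX -!cexpN -!cexpD epoch_ratio; congr (_ * cexp (_ * _)).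
by field.
Qed.

(** By the balancing the six [r - (a + q) / 2] add up to [- 2 q - 2 (n - 1) x], so that all powers
    of [q] cancel and only one of [x] remains. *)
Lemma single_conversion (n N : nat) (a b c d e q x : C) (i k : nat) :
  e = 2%:R * a + N.+1%:R * q - (n%:R * x - x) - b - c - d ->
  let rs := [:: a - (n%:R * x - x); b; c; d; e; - (N%:R * q)] in
  Ell p (cexp a * cexp x ^- (2 * i) * cexp q ^+ (2 * k)) / Ell p (cexp a * cexp x ^- (2 * i))
    * cexp q ^+ k * cexp x ^+ (2 * i * k) *
  ((\prod_(r <- rs) epoch p (cexp r * cexp x ^- i) (cexp q) (Posz k)) /
   (\prod_(r <- rs) epoch p (cexp (a + q - r) * cexp x ^- i) (cexp q) (Posz k))) =
  single_weight sg n N a b c d e q x i k *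
  cexp (- ((n%:R - 1 - i%:R) * (k%:R * x + k%:R * x))).
Proof.
move=> eE rs; rewrite params_conversion -!cexpX -!cexpN -!cexpD Ell_ratio.
rewrite /single_weight -/rs.
have -> : a - (2 * i)%:R * x = a - i%:R * x - i%:R * x by rewrite natrM; ring.
have -> : (2 * k)%:R * q = k%:R * q + k%:R * q by rewrite natrM; ring.
have -> : - ((n%:R - 1 - i%:R) * (k%:R * x + k%:R * x)) =
   (a - i%:R * x - i%:R * x + (k%:R * q + k%:R * q) - (a - i%:R * x - i%:R * x)) / 2 +
   (k%:R * q + ((2 * i * k)%:R * x + k%:R * \sum_(r <- rs) (r - (a + q) / 2))).
  by rewrite /rs !big_cons big_nil eE !natrM -natr1; field.
rewrite !cexpD addrA; ring.
Qed.

Section Terms.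
Variables (n N : nat) (a b c d e q x : C).
Hypothesis n_gt0 : (0 < n)%N.
Hypothesis eE : e = 2%:R * a + N.+1%:R * q - (n%:R * x - x) - b - c - d.

Let rs := [:: a - (n%:R * x - x); b; c; d; e; - (N%:R * q)].

Lemma predn_natr : n.-1%:R = n%:R - 1 :> C.
Proof. by rewrite -[in RHS](prednK n_gt0) -natr1 addrK. Qed.

Lemma numer_list : [:: cexp a * cexp x ^- n.-1; cexp b; cexp c; cexp d; cexp e; cexp q ^- N] =
  map (@cexp R) rs.
Proof. by rewrite /= -!cexpX predn_natr -!cexpN -cexpD mulrBl mul1r. Qed.

Lemma denom_list : [:: cexp q * cexp x ^+ n.-1; cexp a * cexp q / cexp b; cexp a * cexp q / cexp c;
    cexp a * cexp q / cexp d; cexp a * cexp q / cexp e; cexp a * cexp q ^+ N.+1] =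
  [seq cexp (a + q - r) | r <- rs].
Proof.
rewrite /= -!cexpX predn_natr -!cexpN -!cexpD -natr1.
congr [:: cexp _; _; _; _; _; cexp _]; ring.
Qed.

Lemma term_conversion (lam : {ffun 'I_n -> 'I_N.+1}) : inLambda lam ->
    (\prod_(i < n)
         (Ell p (cexp a * cexp x ^- (2 * i) * cexp q ^+ (2 * lam i)) / Ell p (cexp a * cexp x ^- (2
           * i))
          * cexp q ^+ (lam i) * cexp x ^+ (2 * i * lam i)))
    * (\prod_(i < n) \prod_(j < n | (i < j)%N)
         (Ell p (cexp x ^+ (j - i) * cexp q ^ (Posz (lam i) - Posz (lam j))) / Ell p (cexp x ^+ (j
           - i))
          * (Ell p (cexp a * cexp x ^- (i + j) * cexp q ^+ (lam i + lam j)) / Ell p (cexp a * cexp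
            x ^- (i + j)))
          * (epoch p (cexp a * cexp x ^ (1 - Posz (i + j))) (cexp q) (Posz (lam i) + Posz (lam j))
             * epoch p (cexp x ^+ (j - i).+1) (cexp q) (Posz (lam i) - Posz (lam j)))
          / (epoch p (cexp a * cexp q * cexp x ^- (i + j).+1) (cexp q) (Posz (lam i) + Posz (lam j))
             * epoch p (cexp q * cexp x ^+ (j - i - 1)) (cexp q) (Posz (lam i) - Posz (lam j)))))
    * epochXs p [:: cexp a * cexp x ^- n.-1; cexp b; cexp c; cexp d; cexp e;
      cexp q ^- N] (cexp q) (cexp x) (lamZ lam)
    / epochXs p [:: cexp q * cexp x ^+ n.-1; cexp a * cexp q / cexp b; cexp a * cexp q / cexp c;
        cexp a * cexp q / cexp d; cexp a * cexp q / cexp e;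
                    cexp a * cexp q ^+ N.+1] (cexp q) (cexp x) (lamZ lam)
  = weight sg N a b c d e q x (fun i => lam i).
Proof.
move=> /inLambdaP mono; rewrite numer_list denom_list /epochXs /epochX /lamZ.
rewrite [X in _ * X / _]exchange_big [X in _ / X]exchange_big /= -mulrA -prodf_div.
rewrite mulrAC -big_split /= /weight.
rewrite [X in _ * X](eq_bigr (fun i : 'I_n => (\prod_(j < n | (i < j)%N)
    pair_weight sg (a - i%:R * x - j%:R * x) (j%:R * x - i%:R * x) q x (lam i + lam j) (lam i - lam
      j)) *
    cexp ((n%:R - 1 - i%:R) * ((lam i)%:R * x + (lam i)%:R * x)))); last first.
  move=> i _; rewrite (eq_bigr _ (fun j ltij => pair_conversion a q x ltij (mono i j (ltnW ltij)))).
  rewrite big_split /=; congr (_ * _); set z := cexp _.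
  have -> : \prod_(j < n | (i < j)%N) z = z ^+ (n - i.+1).
    by rewrite -prodr_const_nat big_geq_mkord.
  rewrite -cexpX; congr cexp; congr (_ * _).
  by rewrite natrB // -natr1; ring.
rewrite [X in X * _ = _](eq_bigr (fun i : 'I_n => single_weight sg n N a b c d e q x i (lam i) *
    cexp (- ((n%:R - 1 - i%:R) * ((lam i)%:R * x + (lam i)%:R * x))))); last first.
  by move=> i _; rewrite -(single_conversion _ _ eE) !big_cons !big_nil.
rewrite !big_split /= mulrACA -[X in _ * X = _]big_split /= [X in _ * X = _]big1 ?mulr1 // => i _.
by rewrite -cexpD addNr cexp0.
Qed.

(** The denominators of [weight]: what the hypotheses of the theorem provide and what continuity at
    the given parameters requires. *)
Definition weight_regular (lam : 'I_n -> nat) : Prop :=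
  (forall i : 'I_n, sg (a - i%:R * x - i%:R * x) != 0 /\
     forall r, r \in rs -> sph q (a + q - r - i%:R * x) (lam i) != 0) /\
  (forall i j : 'I_n, (i < j)%N ->
     [/\ sg (j%:R * x - i%:R * x) != 0, sg (a - i%:R * x - j%:R * x) != 0,
         sph q (a - i%:R * x - j%:R * x + q - x) (lam i + lam j) != 0 &
         sph q (j%:R * x - i%:R * x + q - x) (lam i - lam j) != 0]).

Lemma epochXs_neq0 (us : seq C) (lam : 'I_n -> nat) :
  epochXs p (map (@cexp R) us) (cexp q) (cexp x) (fun i => Posz (lam i)) != 0 ->
  forall u (i : 'I_n), u \in us -> sph q (u - i%:R * x) (lam i) != 0.
Proof.
move=> nz u i u_us; apply: contraNneq nz => ph0; rewrite /epochXs big_map.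
rewrite (big_rem u) //= /epochX (bigD1 i) //.
have -> : cexp u * cexp x ^- i = cexp (u - i%:R * x) by rewrite cexpD cexpN cexpX.
by rewrite epochE ph0 !mul0r /= !mul0r eqxx.
Qed.

Lemma weight_regularP (lam : {ffun 'I_n -> 'I_N.+1}) : inLambda lam ->
  (forall i : 'I_n, Ell p (cexp a * cexp x ^- (2 * i)) != 0) ->
  (forall i j : 'I_n, (i < j)%N ->
     Ell p (cexp x ^+ (j - i)) != 0 /\ Ell p (cexp a * cexp x ^- (i + j)) != 0) ->
  (forall i j : 'I_n, (i < j)%N ->
        epoch p (cexp a * cexp q * cexp x ^- (i + j).+1) (cexp q) (Posz (lam i) + Posz (lam j)) !=
          0 /\
        epoch p (cexp q * cexp x ^+ (j - i - 1)) (cexp q) (Posz (lam i) - Posz (lam j)) != 0) ->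
  epochXs p [:: cexp q * cexp x ^+ n.-1; cexp a * cexp q / cexp b; cexp a * cexp q / cexp c;
        cexp a * cexp q / cexp d; cexp a * cexp q / cexp e;
                    cexp a * cexp q ^+ N.+1] (cexp q) (cexp x) (lamZ lam) != 0 ->
  weight_regular (fun i => lam i).
Proof.
move=> /inLambdaP mono H1 H2 H3 H4; split=> [i|i j ltij].
  split=> [|r r_rs].
    have := H1 i; rewrite -cexpX -cexpN -cexpD Ell_neq0 //.
    by congr (sg _ != 0); rewrite natrM; ring.
  move: H4; rewrite denom_list (map_comp (@cexp R) (fun r => a + q - r)).
  by move=> /epochXs_neq0; apply; exact: (map_f (fun r => a + q - r) r_rs).
have [h1 h2] := H2 i j ltij; have [h3 h4] := H3 i j ltij.
have ji : (j - i)%:R = j%:R - i%:R :> C by rewrite natrB // ltnW.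
have ji1 : (j - i - 1)%:R = j%:R - i%:R - 1 :> C by rewrite natrB ?subn_gt0 // ji.
split.
- by move: h1; rewrite -cexpX Ell_neq0 // ji mulrBl.
- move: h2; rewrite -cexpX -cexpN -cexpD Ell_neq0 //.
  by congr (sg _ != 0); rewrite natrD; ring.
- move: h3; rewrite -PoszD -cexpX -cexpN -!cexpD epoch_neq0 //.
  by congr (sph q _ _ != 0); rewrite -natr1 natrD; ring.
- move: h4; rewrite subzn ?(mono i j (ltnW ltij)) // -cexpX -!cexpD epoch_neq0 //.
  by congr (sph q _ _ != 0); rewrite ji1; ring.
Qed.

End Terms.

(** * Continuity and passage to the limit *)

Lemma seq_lim_ph (q_ y_ : nat -> C) q y k : seq_lim q_ q -> seq_lim y_ y ->
  seq_lim (fun m => sph (q_ m) (y_ m) k) (sph q y k).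
Proof.
move=> qL yL; apply: seq_lim_prod => j _; apply: sigma_continuous => //.
by seq_lim_linear.
Qed.

Lemma weight_continuous (n N : nat) (a_ b_ c_ d_ e_ q_ x_ : nat -> C) (a b c d e q x : C)
    (lam : 'I_n -> nat) :
  seq_lim a_ a -> seq_lim b_ b -> seq_lim c_ c -> seq_lim d_ d -> seq_lim e_ e ->
  seq_lim q_ q -> seq_lim x_ x -> weight_regular N a b c d e q x lam ->
  seq_lim (fun m => weight sg N (a_ m) (b_ m) (c_ m) (d_ m) (e_ m) (q_ m) (x_ m) lam)
    (weight sg N a b c d e q x lam).
Proof.
move=> aL bL cL dL eL qL xL [H1 H2].
apply: seq_limM; last first.
  apply: seq_lim_prod => i _; apply: seq_lim_prod => j ltij.
  have [h1 h2 h3 h4] := H2 i j ltij.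
  apply: seq_limM.
    apply: seq_lim_div; first exact: mulf_neq0 h1 h2.
      by apply: seq_limM; apply: sigma_continuous => //; seq_lim_linear.
    by apply: seq_limM; apply: sigma_continuous => //; seq_lim_linear.
  apply: seq_lim_div; first exact: mulf_neq0 h3 h4.
    by apply: seq_limM; apply: seq_lim_ph => //; seq_lim_linear.
  by apply: seq_limM; apply: seq_lim_ph => //; seq_lim_linear.
apply: seq_lim_prod => i _; have [h1 h2] := H1 i.
apply: seq_limM.
  by apply: seq_lim_div => //; apply: sigma_continuous => //; seq_lim_linear.
have ratio (r_ : nat -> C) r : seq_lim r_ r ->
    r \in [:: a - (n%:R * x - x); b; c; d; e; - (N%:R * q)] ->
    seq_lim (fun m => sph (q_ m) (r_ m - i%:R * x_ m) (lam i) /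
      sph (q_ m) (a_ m + q_ m - r_ m - i%:R * x_ m) (lam i))
     (sph q (r - i%:R * x) (lam i) / sph q (a + q - r - i%:R * x) (lam i)).
  move=> rL r_in; apply: seq_lim_div; first exact: h2.
    by apply: seq_lim_ph => //; seq_lim_linear.
  by apply: seq_lim_ph => //; seq_lim_linear.
rewrite !big_cons big_nil; apply: eq_seq_lim => [m|]; first by rewrite !big_cons big_nil.
do 6! (apply: seq_limM; first by apply: ratio; [seq_lim_linear | rewrite !inE eqxx ?orbT]).
exact: seq_lim_cst.
Qed.

Definition product_regular (n N : nat) (a b c d q x : C) : Prop :=
  forall u (i : 'I_n), u \in [:: a + q - b; a + q - c; a + q - d; a + q - b - c - d] ->
    sph q (u - i%:R * x) N != 0.

Lemma jackson_product_continuous (n N : nat) (a_ b_ c_ d_ q_ x_ : nat -> C) (a b c d q x : C) :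
  seq_lim a_ a -> seq_lim b_ b -> seq_lim c_ c -> seq_lim d_ d ->
  seq_lim q_ q -> seq_lim x_ x -> product_regular n N a b c d q x ->
  seq_lim (fun m => jackson_product sg n N (a_ m) (b_ m) (c_ m) (d_ m) (q_ m) (x_ m))
    (jackson_product sg n N a b c d q x).
Proof.
move=> aL bL cL dL qL xL reg; apply: seq_lim_prod => i _; apply: seq_lim_div.
- by rewrite !mulf_neq0 //; apply: reg; rewrite !inE eqxx ?orbT.
- apply: seq_limM; last by apply: seq_lim_ph => //; seq_lim_linear.
  apply: seq_limM; last by apply: seq_lim_ph => //; seq_lim_linear.
  by apply: seq_limM; apply: seq_lim_ph => //; seq_lim_linear.
- apply: seq_limM; last by apply: seq_lim_ph => //; seq_lim_linear.
  apply: seq_limM; last by apply: seq_lim_ph => //; seq_lim_linear.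
  by apply: seq_limM; apply: seq_lim_ph => //; seq_lim_linear.
Qed.

Lemma jackson_sum_regular (n N : nat) (a b c d e q x : C) : (0 < n)%N ->
  e = 2%:R * a + N.+1%:R * q - (n%:R * x - x) - b - c - d ->
  (forall lam : {ffun 'I_n -> 'I_N.+1}, inLambda lam ->
     weight_regular N a b c d e q x (fun i => lam i)) ->
  product_regular n N a b c d q x ->
  \sum_(lam : {ffun 'I_n -> 'I_N.+1} | inLambda lam)
     weight sg N a b c d e q x (fun i => lam i) = jackson_product sg n N a b c d q x.
Proof.
move=> n_gt0 eE wreg preg.
have half01 : 0 <= (2^-1 : R) < 1 by apply/andP; split; lra.
have /choice[t Ht] m : exists t : R, 0 < t < 2^-1 ^+ m /\
    generic sg (perturb a t 1) (perturb b t 2) (perturb c t 3) (perturb d t 4)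
      (perturb q t 5) (perturb x t 6).
  have [t t_itv t_gen] := generic_perturbation p1 a b c d q x
    (exprn_gt0 m (ltac:(lra) : 0 < (2^-1 : R))).
  by exists t.
have perturbL (u : C) k : seq_lim (fun m => perturb u (t m) k.+1) u.
  apply/seq_lim_normcP => eps eps0.
  have [k0 Hk] := geometric_small 1 half01 eps0; exists k0 => m /Hk; rewrite mul1r.
  apply: le_lt_trans; have [/andP[t0 t1] _] := Ht m.
  have -> : perturb u (t m) k.+1 - u = (t m ^+ k.+1)%:C%C by rewrite /perturb addrC addKr.
  rewrite normc_real ger0_norm ?exprn_ge0 ?(ltW t0) // exprS.
  have t_le1 : t m <= 1.
    by rewrite (le_trans (ltW t1)) // exprn_ile1 //; [lra | lra].
  by rewrite (le_trans _ (ltW t1)) // ler_piMr ?(ltW t0) // exprn_ile1 // ltW.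
pose a_ m := perturb a (t m) 1; pose b_ m := perturb b (t m) 2; pose c_ m := perturb c (t m) 3.
pose d_ m := perturb d (t m) 4; pose q_ m := perturb q (t m) 5; pose x_ m := perturb x (t m) 6.
have aL : seq_lim a_ a := perturbL a 0%N; have bL : seq_lim b_ b := perturbL b 1%N.
have cL : seq_lim c_ c := perturbL c 2%N; have dL : seq_lim d_ d := perturbL d 3%N.
have qL : seq_lim q_ q := perturbL q 4%N; have xL : seq_lim x_ x := perturbL x 5%N.
have gen m : generic sg (a_ m) (b_ m) (c_ m) (d_ m) (q_ m) (x_ m) by have [] := Ht m.
move: a_ b_ c_ d_ q_ x_ aL bL cL dL qL xL gen => a_ b_ c_ d_ q_ x_ aL bL cL dL qL xL gen.
(* [e] is recomputed from the other perturbed parameters, so that the balancing holds along the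
   whole sequence. *)
pose e_ m := 2%:R * a_ m + N.+1%:R * q_ m - (n%:R * x_ m - x_ m) - b_ m - c_ m - d_ m.
have eL : seq_lim e_ e by rewrite eE /e_; seq_lim_linear.
have lhsL := seq_lim_sum (index_enum {ffun 'I_n -> 'I_N.+1})
  (fun lam Llam => weight_continuous aL bL cL dL eL qL xL (wreg lam Llam)).
have rhsL := jackson_product_continuous aL bL cL dL qL xL preg.
apply: seq_lim_unique lhsL _; apply: eq_seq_lim rhsL => m.
by rewrite (jackson_sum_generic (sigma_odd p1) (sigma_add p1) n_gt0 (erefl (e_ m)) (gen m)).
Qed.

Lemma product_conversion (n N : nat) (a b c d q x : C) : product_regular n N a b c d q x ->
  epochXs p [:: cexp a * cexp q; cexp a * cexp q / (cexp b * cexp c);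
      cexp a * cexp q / (cexp b * cexp d); cexp a * cexp q / (cexp c * cexp d)] (cexp q) (cexp x)
    (fun _ : 'I_n => Posz N) /
  epochXs p [:: cexp a * cexp q / cexp b; cexp a * cexp q / cexp c; cexp a * cexp q / cexp d;
      cexp a * cexp q / (cexp b * cexp c * cexp d)] (cexp q) (cexp x) (fun _ : 'I_n => Posz N) =
  jackson_product sg n N a b c d q x.
Proof.
move=> reg; rewrite -!cexpD -!cexpN -!cexpD /epochXs /epochX !opprD !addrA.
rewrite exchange_big [X in _ / X]exchange_big -prodf_div; apply: eq_bigr => i _.
rewrite !big_cons !big_nil -!cexpX -!cexpN -!cexpD !epochE.
have := reg (a + q - b) i; have := reg (a + q - c) i.
have := reg (a + q - d) i; have := reg (a + q - b - c - d) i.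
rewrite !inE !eqxx !orbT => /(_ isT) n1 /(_ isT) n2 /(_ isT) n3 /(_ isT) n4.
pose y (u : C) := cexp (N%:R * ((u - i%:R * x) / 2)).
(* Numerator and denominator arguments have the same sum [4 (a + q) - 2 (b + c + d)], so the
   exponential prefactors cancel. *)
have eqy : y (a + q) * y (a + q - b - c) * y (a + q - b - d) * y (a + q - c - d) =
   y (a + q - b) * y (a + q - c) * y (a + q - d) * y (a + q - b - c - d).
  by rewrite /y -!cexpD; congr cexp; field.
have y0 u : y u != 0 by exact: cexp_neq0.
move: eqy (y0 (a + q - b)) (y0 (a + q - c)) (y0 (a + q - d)) (y0 (a + q - b - c - d)).
have := cexp_neq0 ('C(N, 2)%:R * (q / 2)).
rewrite -!/(y _); move: n1 n2 n3 n4.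
have ratio (u1 u2 u3 u4 v1 v2 v3 v4 y1 y2 y3 y4 z1 z2 z3 z4 w : C) :
    v4 != 0 -> v3 != 0 -> v2 != 0 -> v1 != 0 -> w != 0 -> y1 * y2 * y3 * y4 = z1 * z2 * z3 * z4 ->
    z1 != 0 -> z2 != 0 -> z3 != 0 -> z4 != 0 ->
    (u1 * y1 * w) * ((u2 * y2 * w) * ((u3 * y3 * w) * ((u4 * y4 * w) * 1))) /
    ((v1 * z1 * w) * ((v2 * z2 * w) * ((v3 * z3 * w) * ((v4 * z4 * w) * 1)))) =
    u1 * u2 * u3 * u4 / (v1 * v2 * v3 * v4).
  move=> v40 v30 v20 v10 w0 yz z10 z20 z30 z40.
  transitivity (u1 * u2 * u3 * u4 / (v1 * v2 * v3 * v4) *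
      ((y1 * y2 * y3 * y4) / (z1 * z2 * z3 * z4))).
    by field; rewrite v10 v20 v30 v40 z10 z20 z30 z40 w0.
  by rewrite yz mulfV ?mulr1 // !mulf_neq0.
exact: ratio.
Qed.

End Conversion.

Theorem theorem1 (R : realType) (p : R[i]) (n N : nat) (a b c d e q x : R[i]) :
  `|p| < 1 -> (1 <= n)%N ->
  a != 0 -> b != 0 -> c != 0 -> d != 0 -> e != 0 -> q != 0 -> x != 0 ->
  (* genericity: no denominator vanishes *)
  (forall i : 'I_n, Ell p (a * x ^- (2 * i)) != 0) ->
  (forall i j : 'I_n, (i < j)%N ->
     Ell p (x ^+ (j - i)) != 0 /\ Ell p (a * x ^- (i + j)) != 0) ->
  (forall lam : {ffun 'I_n -> 'I_N.+1}, inLambda lam ->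
     (forall i j : 'I_n, (i < j)%N ->
        epoch p (a * q * x ^- (i + j).+1) q (Posz (lam i) + Posz (lam j)) != 0 /\
        epoch p (q * x ^+ (j - i - 1)) q (Posz (lam i) - Posz (lam j)) != 0) /\
     epochXs p [:: q * x ^+ n.-1; a * q / b; a * q / c; a * q / d; a * q / e;
                   a * q ^+ N.+1] q x (lamZ lam) != 0) ->
  epochXs p [:: a * q / b; a * q / c; a * q / d; a * q / (b * c * d)] q x
          (fun _ : 'I_n => Posz N) != 0 ->
  (* balancing condition *)
  b * c * d * e * x ^+ n.-1 = a ^+ 2 * q ^+ N.+1 ->
  \sum_(lam : {ffun 'I_n -> 'I_N.+1} | inLambda lam)
    ( (\prod_(i < n)
         (Ell p (a * x ^- (2 * i) * q ^+ (2 * lam i)) / Ell p (a * x ^- (2 * i))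
          * q ^+ (lam i) * x ^+ (2 * i * lam i)))
    * (\prod_(i < n) \prod_(j < n | (i < j)%N)
         (Ell p (x ^+ (j - i) * q ^ (Posz (lam i) - Posz (lam j))) / Ell p (x ^+ (j - i))
          * (Ell p (a * x ^- (i + j) * q ^+ (lam i + lam j)) / Ell p (a * x ^- (i + j)))
          * (epoch p (a * x ^ (1 - Posz (i + j))) q (Posz (lam i) + Posz (lam j))
             * epoch p (x ^+ (j - i).+1) q (Posz (lam i) - Posz (lam j)))
          / (epoch p (a * q * x ^- (i + j).+1) q (Posz (lam i) + Posz (lam j))
             * epoch p (q * x ^+ (j - i - 1)) q (Posz (lam i) - Posz (lam j)))))
    * epochXs p [:: a * x ^- n.-1; b; c; d; e; q ^- N] q x (lamZ lam)
    / epochXs p [:: q * x ^+ n.-1; a * q / b; a * q / c; a * q / d; a * q / e;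
                    a * q ^+ N.+1] q x (lamZ lam) )
  = epochXs p [:: a * q; a * q / (b * c); a * q / (b * d); a * q / (c * d)] q x
            (fun _ : 'I_n => Posz N)
    / epochXs p [:: a * q / b; a * q / c; a * q / d; a * q / (b * c * d)] q x
              (fun _ : 'I_n => Posz N).
Proof.
move=> p_lt1 n_gt0 a0 b0 c0 d0 e0 q0 x0 H1 H2 H3 H4 bal.
have p1 : normc p < 1 by rewrite -ltcR -normcE'.
have [A AE] := cexp_onto a0; have [B BE] := cexp_onto b0; have [C CE] := cexp_onto c0.
have [D DE] := cexp_onto d0; have [Q QE] := cexp_onto q0; have [X XE] := cexp_onto x0.
(* An arbitrary logarithm of [e] would satisfy the additive balancing only up to a period of [cexp].
   [E] is therefore defined by that balancing, and [bal] shows that it is a logarithm of [e]. *)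
pose E := 2%:R * A + N.+1%:R * Q - (n%:R * X - X) - B - C - D.
have EE : cexp E = e.
  apply: (mulfI (mulf_neq0 (mulf_neq0 (mulf_neq0 b0 c0) d0) (expf_neq0 n.-1 x0))).
  rewrite [RHS]mulrAC bal -AE -BE -CE -DE -QE -XE -!cexpX -!cexpD predn_natr //.
  by congr cexp; rewrite /E; ring.
move: H1 H2 H3 H4; rewrite -{}EE -{}AE -{}BE -{}CE -{}DE -{}QE -{}XE => H1 H2 H3 H4.
have preg : product_regular p n N A B C D Q X.
  move=> u i u_in; apply: (@epochXs_neq0 _ p n Q X _ (fun=> N) _ u i u_in).
  move: H4; rewrite /= -!cexpD -!cexpN -!cexpD.
  by rewrite !opprD !addrA.
rewrite (eq_bigr (fun lam : {ffun 'I_n -> 'I_N.+1} => weight (sigma p) N A B C D E Q X (fun i =>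
  lam i))).
  rewrite (jackson_sum_regular p1 n_gt0 (erefl E)) ?product_conversion // => lam Llam.
  have [H31 H32] := H3 lam Llam.
  exact: (weight_regularP n_gt0 Llam H1 H2 H31 H32).
by move=> lam Llam; apply: term_conversion.
Qed.
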